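(* Let $\Omega\subset\mathbb{R}^n$ be a bounded Lipschitz domain and let $L$ be a uniformly elliptic differential expression with $L^\infty(\Omega)$ coefficients as in the context. For $\lambda\in\rho(\mathcal{L}^N)$ the operator $N(\lambda)\mathcal{R}-i$ is invertible if and only if $\lambda\in\rho(\mathcal{L}^{i\mathcal{R}})$, and one defines $$\mathbf{W}_0(\lambda)=\big(N(\lambda)\mathcal{R}+i\big)\big(N(\lambda)\mathcal{R}-i\big)^{-1}\in\mathcal{B}(H^{1/2}(\partial\Omega)),\qquad\lambda\in\rho(\mathcal{L}^N)\cap\rho(\mathcal{L}^{i\mathcal{R}}).$$ Then $\mathbf{W}_0(\lambda)=2iN_{i\mathcal{R}}(\lambda)\mathcal{R}-I_{H^{1/2}(\partial\Omega)}$, and hence $\mathbf{W}_0$ can be analytically continued to $\rho(\mathcal{L}^{i\mathcal{R}})$. For any bounded $\Theta\colon H^{1/2}(\partial\Omega)\to H^{-1/2}(\partial\Omega)$ such that the form $\Phi_\Theta$ is elliptic on $H^1(\Omega)$, the continuation, denoted $\mathbf{W}$, is given by $$\mathbf{W}(\lambda)=-\mathcal{R}^{-1}R_{\Theta,-i\mathcal{R}}(\lambda)R_{i\mathcal{R},\Theta}(\lambda)\mathcal{R}=2iN_\Theta(\lambda)R_{i\mathcal{R},\Theta}(\lambda)\mathcal{R}-I_{H^{1/2}(\partial\Omega)}$$ for all $\lambda\in\rho(\mathcal{L}^{i\mathcal{R}})\cap\rho(\mathcal{L}^\Theta)$.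
   Context: All function spaces are complex-valued; sesquilinear forms are linear in the first and antilinear in the second argument; $\langle\cdot,\cdot\rangle$ is the $L^2(\Omega)$ inner product. $H^{-1/2}(\partial\Omega)$ is the space of bounded antilinear functionals on $H^{1/2}(\partial\Omega)$, with pairing $\langle\!\langle\varphi,g\rangle\!\rangle=\varphi(g)$; $\mathcal{R}\colon H^{1/2}(\partial\Omega)\to H^{-1/2}(\partial\Omega)$ is the (linear) Riesz isomorphism $\langle\!\langle\mathcal{R}f,g\rangle\!\rangle=\langle f,g\rangle_{H^{1/2}(\partial\Omega)}$. $Lu=-\sum_{j,k}\partial_j(a_{jk}\partial_k u)+\sum_j b_j\partial_j u-\sum_j\partial_j(d_ju)+qu$, with complex-valued coefficients in $L^\infty(\Omega)$ and, for some $C>0$, $\mathrm{Re}\sum_{j,k}a_{jk}(x)\bar\xi_j\xi_k\ge C\sum_j|\xi_j|^2$ for all $\xi\in\mathbb{C}^n$, $x\in\Omega$. Its form is $\Phi(u,v)=\sum_{j,k}\langle a_{jk}\partial_ku,\partial_jv\rangle+\sum_j\langle b_j\partial_ju,v\rangle+\sum_j\langle d_ju,\partial_jv\rangle+\langle qu,v\rangle$, and $\Phi_\Theta(u,v)=\Phi(u,v)+\langle\!\langle\Theta\gamma_Du,\gamma_Dv\rangle\!\rangle$ on $H^1(\Omega)$. A form is elliptic on $H^1(\Omega)$ if it is bounded there and $\mathrm{Re}\,\Phi_\Theta(u,u)\ge\gamma\|u\|_{H^1}^2+c\|u\|_{L^2}^2$ for some $\gamma>0$, $c\in\mathbb{R}$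 (this holds for $\Theta=0$ and $\Theta=i\mathcal{R}$). $\gamma_D\colon H^1(\Omega)\to H^{1/2}(\partial\Omega)$ is the Dirichlet trace. For $u\in H^1(\Omega)$ with $Lu\in L^2(\Omega)$ (distributionally), $\gamma_N^Lu\in H^{-1/2}(\partial\Omega)$ is determined by $\Phi(u,v)=\langle Lu,v\rangle+\langle\!\langle\gamma_N^Lu,\gamma_Dv\rangle\!\rangle$ for all $v\in H^1(\Omega)$. $\mathcal{L}^\Theta$ acts as $L$ in $L^2(\Omega)$ with domain $\{u\in H^1(\Omega):Lu\in L^2(\Omega),\ \gamma_N^Lu+\Theta\gamma_Du=0\}$; $\mathcal{L}^N=\mathcal{L}^{0}$ and $\mathcal{L}^{i\mathcal{R}}$ is $\mathcal{L}^\Theta$ with $\Theta=i\mathcal{R}$. For $\lambda\in\rho(\mathcal{L}^{\Theta_1})$ and $g\in H^{-1/2}(\partial\Omega)$ let $u\in H^1(\Omega)$ be the unique solution of $Lu=\lambda u$, $\gamma_N^Lu+\Theta_1\gamma_Du=g$. Then $N_{\Theta_1}(\lambda)g=\gamma_Du\in H^{1/2}(\partial\Omega)$ and, for bounded $\Theta_2\colon H^{1/2}(\partial\Omega)\to H^{-1/2}(\partial\Omega)$, $R_{\Theta_1,\Theta_2}(\lambda)g=\gamma_N^Lu+\Theta_2\gamma_Du\in H^{-1/2}(\partial\Omega)$. $N(\lambda)=N_0(\lambda)$. *)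

(* Defs.v *)
From HB Require Import structures.
From mathcomp Require Import all_boot all_order all_algebra.
From mathcomp Require Import complex.
From mathcomp Require Import all_classical all_reals all_analysis.
From mathcomp Require Import measurable_realfun ring lra.

Set Implicit Arguments.
Unset Strict Implicit.
Unset Printing Implicit Defensive.
Import Order.TTheory GRing.Theory Num.Theory.
Import numFieldNormedType.Exports.
Import Normc.

Local Open Scope classical_set_scope.
Local Open Scope ring_scope.

Section subquotient.
Context {K : nzRingType} {V : lmodType K}.

Definition subspace (S : set V) : Prop :=
  S 0 /\ forall (a : K) (x y : V), S x -> S y -> S (a *: x + y).

Record subquot_data := SubquotData {
  sq_space : set V ;
  sq_null : set V ;
  sq_spaceP : subspace sq_space ;
  sq_nullP : subspace sq_null }.

Variable D : subquot_data.
Local Notation S := (sq_space D).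
Local Notation N := (sq_null D).

Definition sq_canon (x : V) : V := xget 0 [set y | S y /\ N (y - x)].

(* The quotient of the subspace S by S `&` N; every class is represented by
   the element of V that sq_canon chooses in it. *)
Record subquot := Subquot {
  sq_val : V ;
  _ : `[< S sq_val /\ sq_canon sq_val = sq_val >] }.

HB.instance Definition _ := [isSub for sq_val].
HB.instance Definition _ := [Choice of subquot by <:].

Let S0 : S 0. Proof. by case: (sq_spaceP D). Qed.
Let N0 : N 0. Proof. by case: (sq_nullP D). Qed.
Let SD x y : S x -> S y -> S (x + y).
Proof. by move=> Sx Sy; rewrite -[x]scale1r; apply: (sq_spaceP D).2. Qed.
Let ND x y : N x -> N y -> N (x + y).
Proof. by move=> Sx Sy; rewrite -[x]scale1r; apply: (sq_nullP D).2. Qed.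
Let SZ a x : S x -> S (a *: x).
Proof. by move=> Sx; rewrite -[_ *: _]addr0; apply: (sq_spaceP D).2. Qed.
Let NZ a x : N x -> N (a *: x).
Proof. by move=> Sx; rewrite -[_ *: _]addr0; apply: (sq_nullP D).2. Qed.
Let NN x : N x -> N (- x).
Proof. by move=> Nx; rewrite -scaleN1r; apply: NZ. Qed.
Let NB x y : N (x - y) -> N (y - x).
Proof. by move=> Nx; rewrite -opprB; apply: NN. Qed.

Lemma sq_canonP x : S x -> S (sq_canon x) /\ N (sq_canon x - x).
Proof.
move=> Sx; rewrite /sq_canon; case: xgetP => [y _ //|/(_ x)[]].
by split=> //; rewrite subrr.
Qed.

Lemma sq_canon_eq x y : S x -> S y -> N (x - y) -> sq_canon x = sq_canon y.
Proof.
move=> Sx Sy Nxy; rewrite /sq_canon.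
congr (xget _ _).
apply/seteqP; split=> z [Sz Nz]; split=> //.
  by rewrite -(subrK x z) -addrA; apply: ND.
by rewrite -(subrK y z) -addrA; apply: ND => //; apply: NB.
Qed.

Lemma sq_val_space (p : subquot) : S (sq_val p).
Proof. by case: p => x /= /asboolP[]. Qed.

Let pi_subproof x : S x ->
  `[< S (sq_canon x) /\ sq_canon (sq_canon x) = sq_canon x >].
Proof.
move=> Sx; apply/asboolP; have [Sc Nc] := sq_canonP Sx.
by split=> //; apply: sq_canon_eq.
Qed.

Definition sq_pi x (Sx : S x) : subquot := Subquot (pi_subproof Sx).

Lemma sq_piK x (Sx : S x) : N (sq_val (sq_pi Sx) - x).
Proof. exact: (sq_canonP Sx).2. Qed.

Lemma sq_eqP (p q : subquot) : N (sq_val p - sq_val q) -> p = q.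
Proof.
move=> Npq; apply: val_inj => /=.
case: p q Npq => [x px] [y py] /=.
move: (px) (py) => /asboolP[Sx ex] /asboolP[Sy ey] Nxy.
by rewrite -ex -ey; apply: sq_canon_eq.
Qed.

Definition sq_zero := sq_pi S0.
Definition sq_add (p q : subquot) :=
  sq_pi (SD (sq_val_space p) (sq_val_space q)).
Definition sq_scale (a : K) (p : subquot) := sq_pi (SZ a (sq_val_space p)).
Definition sq_opp (p : subquot) := sq_scale (-1) p.

Let eqN x y := N (x - y).
Let eqNt y x z : eqN x y -> eqN y z -> eqN x z.
Proof. by move=> xy yz; rewrite /eqN -(subrK y x) -addrA; apply: ND. Qed.
Let eqNs x y : eqN x y -> eqN y x. Proof. exact: NB. Qed.
Let eqNr x : eqN x x. Proof. by rewrite /eqN subrr. Qed.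
Let eqND x y x' y' : eqN x x' -> eqN y y' -> eqN (x + y) (x' + y').
Proof. by move=> xx yy; rewrite /eqN opprD addrACA; apply: ND. Qed.
Let eqNZ a x y : eqN x y -> eqN (a *: x) (a *: y).
Proof. by move=> xx; rewrite /eqN -scalerBr; apply: NZ. Qed.
Let eqD p q : eqN (sq_val (sq_add p q)) (sq_val p + sq_val q).
Proof. exact: sq_piK. Qed.
Let eqZ a p : eqN (sq_val (sq_scale a p)) (a *: sq_val p).
Proof. exact: sq_piK. Qed.
Let eq0 : eqN (sq_val sq_zero) 0. Proof. exact: sq_piK. Qed.

Let addA : associative sq_add.
Proof.
move=> p q r; apply: sq_eqP.
apply: (eqNt (eqD _ _)); apply: (eqNt (eqND (eqNr _) (eqD _ _))).
apply/eqNs; apply: (eqNt (eqD _ _)); apply: (eqNt (eqND (eqD _ _) (eqNr _))).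
by rewrite addrA; apply: eqNr.
Qed.

Let addC : commutative sq_add.
Proof.
move=> p q; apply: sq_eqP; apply: (eqNt (eqD _ _)).
by rewrite addrC; apply/eqNs/eqD.
Qed.

Let add0 : left_id sq_zero sq_add.
Proof.
move=> p; apply: sq_eqP; apply: (eqNt (eqD _ _)).
by apply: (eqNt (eqND eq0 (eqNr _))); rewrite add0r; apply: eqNr.
Qed.

Let addN : left_inverse sq_zero sq_opp sq_add.
Proof.
move=> p; apply: sq_eqP; apply: (eqNt (eqD _ _)).
apply: (eqNt (eqND (eqZ _ _) (eqNr _))); rewrite scaleN1r addNr.
exact/eqNs/eq0.
Qed.

HB.instance Definition _ := GRing.isZmodule.Build subquot addA addC add0 addN.

Let scaleA a b v : sq_scale a (sq_scale b v) = sq_scale (a * b) v.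
Proof.
apply: sq_eqP; apply: (eqNt (eqZ _ _)); apply: (eqNt (eqNZ _ (eqZ _ _))).
by rewrite scalerA; apply/eqNs/eqZ.
Qed.

Let scale1 : left_id 1 sq_scale.
Proof.
by move=> p; apply: sq_eqP; apply: (eqNt (eqZ _ _)); rewrite scale1r; apply: eqNr.
Qed.

Let scaleDr : right_distributive sq_scale +%R.
Proof.
move=> a p q; apply: sq_eqP; apply: (eqNt (eqZ _ _)).
apply: (eqNt (eqNZ _ (eqD _ _))); rewrite scalerDr.
by apply/eqNs/(eqNt (eqD _ _))/eqND; apply/eqZ.
Qed.

Let scaleDl v : {morph sq_scale^~ v : a b / a + b}.
Proof.
move=> a b; apply: sq_eqP; apply: (eqNt (eqZ _ _)); rewrite scalerDl.
by apply/eqNs/(eqNt (eqD _ _))/eqND; apply/eqZ.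
Qed.

HB.instance Definition _ := GRing.Zmodule_isLmodule.Build K subquot
  scaleA scale1 scaleDr scaleDl.

Lemma sq_valD (p q : subquot) : N (sq_val (p + q) - (sq_val p + sq_val q)).
Proof. exact: eqD. Qed.

Lemma sq_valZ a (p : subquot) : N (sq_val (a *: p) - a *: sq_val p).
Proof. exact: eqZ. Qed.

End subquotient.
Arguments subquot {K V} D.

Definition rV_display : measure_display. Proof. exact. Qed.

Section rV_measurable.
Context {R : realType} {n : nat}.

(* The product of the Borel sigma-algebras of the coordinates. *)
Let coord (i : 'I_n) (x : 'rV[R]_n) : R := x 0 i.

Let rV_set0 : g_sigma_preimage coord set0.
Proof. exact: sigma_algebra0. Qed.

Let rV_setC A : g_sigma_preimage coord A -> g_sigma_preimage coord (~` A).
Proof. exact: sigma_algebraC. Qed.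

Let rV_bigcup (F : _^nat) : (forall i, g_sigma_preimage coord (F i)) ->
  g_sigma_preimage coord (\bigcup_i (F i)).
Proof. exact: sigma_algebra_bigcup. Qed.

HB.instance Definition _ := @isMeasurable.Build rV_display
  'rV[R]_n (g_sigma_preimage coord) rV_set0 rV_setC rV_bigcup.

Lemma measurable_coord (i : 'I_n) :
  measurable_fun [set: 'rV[R]_n] (fun x : 'rV[R]_n => x 0 i).
Proof.
move=> _ Y mY; rewrite setTI; apply: sub_sigma_algebra.
rewrite -bigcup_seq/=; exists i => /=; first by rewrite mem_index_enum.
by exists Y => //; rewrite setTI.
Qed.

Lemma measurable_rVP d (T : measurableType d) (f : T -> 'rV[R]_n) :
  (forall i, measurable_fun setT (fun t => f t 0 i)) -> measurable_fun setT f.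
Proof.
move=> mf.
have : g_sigma_preimage (fun i t => f t 0 i) `<=` @measurable _ T.
  apply: smallest_sub; first exact: sigma_algebra_measurable.
  rewrite -bigcup_seq => A/= [i _ [B mB <-]]; exact: mf.
rewrite (_ : (fun i t => f t 0 i) = (fun i => coord i \o f))//.
rewrite g_sigma_preimage_comp => sub _ A mA; apply: sub.
by exists A.
Qed.

Lemma open_measurable_rV (U : set 'rV[R]_n) : open U -> measurable U.
Proof.
move=> oU.
pose B (q : nat * {ffun 'I_n -> rat}) : set 'rV[R]_n :=
  [set x | forall i, `|x 0 i - ratr (q.2 i)| < q.1.+1%:R^-1].
have mB q : measurable (B q).
  rewrite (_ : B q = \bigcap_(i in [set: 'I_n])
     ((fun x : 'rV[R]_n => x 0 i) @^-1`
       ball (ratr (q.2 i) : R) q.1.+1%:R^-1)); last first.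
    apply/seteqP; split=> x Bx i /=; first by move=> _; rewrite /ball/= distrC.
    by have := Bx i I; rewrite /= /ball /= distrC.
  apply: fin_bigcap_measurable => // i _.
  rewrite -[X in measurable X]setTI; apply: measurable_coord => //.
  exact: measurable_ball.
rewrite (_ : U = \bigcup_(q in [set q | B q `<=` U]) B q).
  rewrite bigcup_mkcond; apply: countable_bigcupT_measurable => // q.
  by case: ifP => // _; exact: mB.
apply/seteqP; split=> [x Ux|x [q /= BU Bx]]; last exact: BU.
have /nbhs_ballP[e /= e0 xeU] : nbhs x U by apply: open_nbhs_nbhs.
have [k ke] : exists k : nat, k.+1%:R^-1 < e / 2.
  have e20 : 0 < e / 2 by rewrite divr_gt0.
  by have [k] := ltr_add_invr e20; rewrite add0r; exists k.
have qx i : {q : rat | `|x 0 i - ratr q| < k.+1%:R^-1}.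
  apply/cid; have k0 : (0 : R) < k.+1%:R^-1 by rewrite invr_gt0.
  have /rat_in_itvoo[q] : x 0 i - k.+1%:R^-1 < x 0 i + k.+1%:R^-1.
    by rewrite ltrBlDr -addrA ltrDl addr_gt0.
  by rewrite in_itv/= -ltr_distl distrC; exists q.
exists (k, [ffun i => sval (qx i)]) => /=; last first.
  by move=> i; rewrite ffunE; case: (qx i).
move=> y By; apply: xeU; split=> // j i; rewrite ord1.
have := By i; rewrite ffunE/=; case: (qx i) => q /= xq yq.
rewrite /ball/= -(subrK (ratr q) (x 0 i)) -addrA (le_lt_trans (ler_normD _ _))//.
rewrite (splitr e) ltrD// ?(lt_trans xq)//.
by rewrite distrC (lt_trans yq).
Qed.

Lemma continuous_measurable_rV (f : 'rV[R]_n -> R) :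
  continuous f -> measurable_fun setT f.
Proof.
move=> cf; apply: (measurability _ (RGenOpens.measurableE R)) => //.
move=> _ [_ [a [b ->] <-]]; rewrite setTI; apply: open_measurable_rV.
by apply: open_comp => // x _; exact: cf.
Qed.

End rV_measurable.

Section lebesgue_rV.
Context {R : realType}.

Definition rV_cons n (p : R * 'rV[R]_n) : 'rV[R]_n.+1 :=
  \row_i if unlift ord0 i is Some j then p.2 0 j else p.1.

Lemma measurable_rV_cons n : measurable_fun setT (@rV_cons n).
Proof.
apply: measurable_rVP => i; case: (unliftP ord0 i) => [j ->|->].
  rewrite (_ : (fun _ => _) = (fun x : 'rV_n => x 0 j) \o snd).
    by apply: measurableT_comp => //; exact: measurable_coord.
  by apply/funext => p /=; rewrite mxE liftK.
rewrite (_ : (fun _ => _) = fst) //.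
by apply/funext => p /=; rewrite mxE unlift_none.
Qed.

Section step.
Context n (m : {sigma_finite_measure set 'rV[R]_n -> \bar R}).

Definition lebesgue_step : set 'rV[R]_n.+1 -> \bar R :=
  pushforward (lebesgue_measure \x m)%E (@rV_cons n).

Let mT := @measurable_rV_cons n.

Let lebesgue_step0 : lebesgue_step set0 = 0%E.
Proof. by rewrite /lebesgue_step /pushforward preimage_set0 measure0. Qed.

Let lebesgue_step_ge0 A : (0 <= lebesgue_step A)%E.
Proof. by rewrite /lebesgue_step /pushforward. Qed.

Let lebesgue_step_sigma_additive : semi_sigma_additive lebesgue_step.
Proof.
move=> F mF tF mUF; rewrite /lebesgue_step /pushforward preimage_bigcup.
apply: measure_semi_sigma_additive.
- by move=> k; rewrite -[X in measurable X]setTI; exact: mT.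
- apply/trivIsetP => /= i j _ _ ij; rewrite -preimage_setI.
  by move/trivIsetP : tF => /(_ _ _ _ _ ij) ->//; rewrite preimage_set0.
- by rewrite -preimage_bigcup -[X in measurable X]setTI; exact: mT.
Qed.

HB.instance Definition _ := isMeasure.Build _ _ _ lebesgue_step
  lebesgue_step0 lebesgue_step_ge0 lebesgue_step_sigma_additive.

Let lebesgue_step_sigma_finite : sigma_finite setT lebesgue_step.
Proof.
have /sigma_finiteP[A [TA ndA Aoo]] := sigma_finiteT (@lebesgue_measure R).
have /sigma_finiteP[B [TB ndB Boo]] := sigma_finiteT m.
pose F k := A k `*` B k.
have TF : setT = \bigcup_k F k.
  apply/seteqP; split=> // -[x y] _.
  have : [set: R] x by []. rewrite TA => -[i _ Ax].
  have : [set: 'rV[R]_n] y by []. rewrite TB => -[j _ By].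
  exists (maxn i j) => //; split=> /=.
    by move: x Ax; exact/subsetPset/ndA/leq_maxl.
  by move: y By; exact/subsetPset/ndB/leq_maxr.
have mF k : measurable (F k) /\ ((lebesgue_measure \x m)%E (F k) < +oo)%E.
  have [? ?] := Aoo k; have [? ?] := Boo k.
  split; first exact: measurableX.
  by rewrite product_measure1E// lte_mul_pinfty// ge0_fin_numE.
pose h (x : 'rV[R]_n.+1) : R * 'rV[R]_n := (x 0 0, \row_j x 0 (lift ord0 j)).
have mh : measurable_fun setT h.
  apply: measurable_fun_pair; first exact: measurable_coord.
  apply: measurable_rVP => i.
  under eq_fun do rewrite mxE.
  exact: measurable_coord.
have hK p : h (rV_cons p) = p.
  case: p => a x; rewrite /h /rV_cons !mxE unlift_none; congr (_, _).
  by apply/rowP => j; rewrite !mxE liftK.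
exists (fun k => h @^-1` F k).
  apply/seteqP; split=> // x _; have : [set: R * 'rV[R]_n] (h x) by [].
  by rewrite TF => -[k _ Fk]; exists k.
move=> k; split.
  by rewrite -[X in measurable X]setTI; apply: mh => //; exact: (mF k).1.
rewrite /lebesgue_step /pushforward -comp_preimage.
rewrite (_ : _ \o _ = id); first exact: (mF k).2.
by apply/funext => p; exact: hK.
Qed.
HB.instance Definition _ := Measure_isSigmaFinite.Build _ _ _ lebesgue_step
  lebesgue_step_sigma_finite.
End step.

Fixpoint lebesgue_rV n : {sigma_finite_measure set 'rV[R]_n -> \bar R} :=
  match n with
  | 0 => \d_(0 : 'rV[R]_0)
  | n'.+1 => lebesgue_step (lebesgue_rV n')
  end.

Lemma lebesgue_rV_bounded n (M : R) :
  (lebesgue_rV n [set x : 'rV[R]_n | forall i, (`|x 0 i| <= M)%R] < +oo)%E.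
Proof.
elim: n => [|n IHn] /=.
  by rewrite diracE; case: (_ \in _) => //=; rewrite ltry.
rewrite /lebesgue_step /pushforward.
rewrite (_ : _ @^-1` _ = `[- M, M]%classic `*`
   [set x : 'rV[R]_n | forall i, (`|x 0 i| <= M)%R]).
  rewrite product_measure1E//=; last first.
    rewrite (_ : mkset _ = \bigcap_(i in [set: 'I_n])
        ((fun x : 'rV[R]_n => x 0 i) @^-1` `[- M, M]%classic)); last first.
      by apply/seteqP; split=> x xM i /=; have := xM i; rewrite /= in_itv/= -ler_norml;
        [move=> + _|exact].
    apply: fin_bigcap_measurable => // i _.
    by rewrite -[X in measurable X]setTI; exact: measurable_coord.
  rewrite lebesgue_measure_itv/=; case: ifP => [MM|_]; last by rewrite mul0e.
  rewrite -EFinD lte_mul_pinfty// lee_fin subr_ge0 ltW//.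
apply/seteqP; split=> [[a x] /= ax|[a x]/= [aM xM] i].
  split; first by rewrite in_itv/= -ler_norml; have := ax 0; rewrite mxE unlift_none.
  by move=> i; have := ax (lift ord0 i); rewrite mxE liftK.
rewrite mxE; case: (unliftP ord0 i) => [j _|_]/=; first exact: xM.
by rewrite ler_norml; move: aM; rewrite in_itv.
Qed.
End lebesgue_rV.

Section complex_integral.
Context {R : realType} d {T : measurableType d}.
Variable mu : {measure set T -> \bar R}.
Implicit Types (D : set T) (f g : T -> R[i]).

Definition sqmod (z : R[i]) : R := complex.Re z ^+ 2 + complex.Im z ^+ 2.

Definition cmeasurable D f : Prop :=
  measurable_fun D (fun x => complex.Re (f x)) /\
  measurable_fun D (fun x => complex.Im (f x)).

Definition cintegral D f : R[i] :=
  Complex (\int[mu]_(x in D) complex.Re (f x))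
          (\int[mu]_(x in D) complex.Im (f x)).

Definition square_integrable D f : Prop :=
  cmeasurable D f /\ (\int[mu]_(x in D) (sqmod (f x))%:E < +oo)%E.

Definition ae_null D f : Prop := {ae mu, forall x, D x -> f x = 0}.

Lemma sqmod_ge0 z : 0 <= sqmod z.
Proof. by rewrite addr_ge0// sqr_ge0. Qed.

Lemma sqmod_le (a z w : R[i]) :
  sqmod (a * z + w) <= (2 * sqmod a) * sqmod z + 2 * sqmod w.
Proof.
case: a z w => [a b] [x y] [u v]; rewrite /sqmod /=.
rewrite -subr_ge0 [X in 0 <= X](_ : _ =
  (a * x - b * y - u) ^+ 2 + (a * y + b * x - v) ^+ 2); last by ring.
by rewrite addr_ge0// sqr_ge0.
Qed.

Lemma cmeasurableZD D a f g : cmeasurable D f -> cmeasurable D g ->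
  cmeasurable D (a *: f + g).
Proof.
move=> [rf jf] [rg jg]; split.
  rewrite (_ : (fun _ => _) = fun x =>
    complex.Re a * complex.Re (f x) - complex.Im a * complex.Im (f x)
      + complex.Re (g x)); last first.
    apply/funext => x; rewrite [X in complex.Re X](_ : _ = a * f x + g x) //.
    by case: a (f x) (g x) => [? ?] [? ?] [? ?].
  by apply: measurable_funD => //; apply: measurable_funB; apply: measurable_funM.
rewrite (_ : (fun _ => _) = fun x =>
    complex.Re a * complex.Im (f x) + complex.Im a * complex.Re (f x)
      + complex.Im (g x)); last first.
  apply/funext => x; rewrite [X in complex.Im X](_ : _ = a * f x + g x) //.
  by case: a (f x) (g x) => [? ?] [? ?] [? ?].
by apply: measurable_funD => //; apply: measurable_funD; apply: measurable_funM.
Qed.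

Lemma measurable_sqmod D f : cmeasurable D f ->
  measurable_fun D (fun x => sqmod (f x)).
Proof.
by move=> [? ?]; apply: measurable_funD; apply: measurable_funX.
Qed.

Lemma integral_lty_dom D (f g h : T -> R) (c : R) : measurable D -> 0 <= c ->
  measurable_fun D f -> measurable_fun D g -> measurable_fun D h ->
  (forall x, 0 <= f x) -> (forall x, 0 <= g x) -> (forall x, 0 <= h x) ->
  (forall x, D x -> f x <= c * g x + 2 * h x) ->
  (\int[mu]_(x in D) (g x)%:E < +oo)%E -> (\int[mu]_(x in D) (h x)%:E < +oo)%E ->
  (\int[mu]_(x in D) (f x)%:E < +oo)%E.
Proof.
move=> mD c0 mf mg mh f0 g0 h0 le gfin hfin.
apply: (@le_lt_trans _ _ (\int[mu]_(x in D) (c%:E * (g x)%:E + 2%:E * (h x)%:E))%E).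
  apply: ge0_le_integral => //.
  - by move=> x _; rewrite lee_fin.
  - exact/measurable_EFinP.
  - by apply: emeasurable_funD; apply: measurable_funeM; exact/measurable_EFinP.
rewrite ge0_integralD//; last 4 first.
- by move=> ? _; rewrite mule_ge0// lee_fin.
- by apply: measurable_funeM; exact/measurable_EFinP.
- by move=> ? _; rewrite mule_ge0// lee_fin.
- by apply: measurable_funeM; exact/measurable_EFinP.
rewrite !ge0_integralZl_EFin//; try by [exact/measurable_EFinP|move=> x _; rewrite lee_fin].
by rewrite lte_add_pinfty// lte_mul_pinfty// lee_fin.
Qed.

Lemma square_integrable_subspace D : measurable D ->
  subspace (square_integrable D).
Proof.
move=> mD; split.
  split; first by split; apply: measurable_cst.
  rewrite (_ : (fun _ => _) = cst 0%E) ?integral_cst ?mul0e ?ltry//.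
  by apply/funext => x; rewrite /sqmod /= expr0n addr0.
move=> a f g [mf ff] [mg gf]; have mh := cmeasurableZD a mf mg; split=> //.
apply: (@integral_lty_dom D _ (fun x => sqmod (f x)) (fun x => sqmod (g x))
  (2 * sqmod a)) => //; try by move=> x; exact: sqmod_ge0.
- by rewrite mulr_ge0// sqmod_ge0.
- exact: measurable_sqmod.
- exact: measurable_sqmod.
- exact: measurable_sqmod.
- by move=> x _; exact: sqmod_le.
Qed.

Lemma ae_null_subspace D : subspace (ae_null D).
Proof.
split; first exact: nearW.
move=> a f g; apply: filterS2 => x f0 g0 Dx.
by rewrite (_ : _ x = a * f x + g x)// f0// g0// mulr0 addr0.
Qed.

Definition cintegrable D f : Prop :=
  mu.-integrable D (fun x => (complex.Re (f x))%:E) /\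
  mu.-integrable D (fun x => (complex.Im (f x))%:E).

Lemma cintegralZD D a f g : measurable D -> cintegrable D f ->
  cintegrable D g ->
  cintegral D (a *: f + g) = a * cintegral D f + cintegral D g.
Proof.
move=> mD [rf jf] [rg jg]; case: a => a b.
have iZ (k : R) (h : T -> R) : mu.-integrable D (EFin \o h) ->
  mu.-integrable D (EFin \o (fun x => k * h x)).
  by move=> ih; have := integrableZl mD k ih; apply: eq_integrable.
rewrite /cintegral /=; congr Complex.
  rewrite (_ : (fun _ => _) = fun x =>
    (a * complex.Re (f x) + - b * complex.Im (f x)) + complex.Re (g x)); last first.
    apply/funext => x; rewrite [X in complex.Re X](_ : _ = Complex a b * f x + g x) //.
    by case: (f x) (g x) => [? ?] [? ?]; rewrite /= mulNr.
  rewrite RintegralD//; last first.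
    by have := integrableD mD (iZ a _ rf) (iZ (- b) _ jf); apply: eq_integrable.
  rewrite RintegralD//; try exact: iZ.
  by rewrite !RintegralZl// mulNr.
rewrite (_ : (fun _ => _) = fun x =>
  (a * complex.Im (f x) + b * complex.Re (f x)) + complex.Im (g x)); last first.
  apply/funext => x; rewrite [X in complex.Im X](_ : _ = Complex a b * f x + g x) //.
  by case: (f x) (g x) => [? ?] [? ?].
rewrite RintegralD//; last first.
  by have := integrableD mD (iZ a _ jf) (iZ b _ rf); apply: eq_integrable.
rewrite RintegralD//; try exact: iZ.
by rewrite !RintegralZl.
Qed.

Lemma cintegrable_mul D f g (M : R) : measurable D -> (mu D < +oo)%E ->
  square_integrable D f -> cmeasurable D g ->
  (forall x, D x -> `|complex.Re (g x)| <= M /\ `|complex.Im (g x)| <= M) ->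
  cintegrable D (f * g).
Proof.
move=> mD muD [[rf jf] ff] [rg jg] gM.
have [D0|/set0P[x0 Dx0]] := eqVneq D set0.
  by rewrite D0; split; apply: integrable_set0.
have M0 : 0 <= M by rewrite (le_trans _ (gM _ Dx0).1).
have dom (h : T -> R) : measurable_fun D h ->
    (forall x, D x -> `|h x| <= M * sqmod (f x) + 2 * M) ->
    mu.-integrable D (EFin \o h).
  move=> mh hle; apply/integrableP; split; first exact/measurable_EFinP.
  apply: (@integral_lty_dom D (fun x => `|h x|) (fun x => sqmod (f x))
    (cst M) M) => //.
  - exact: measurableT_comp.
  - exact: measurable_sqmod.
  - by move=> x; exact: sqmod_ge0.
  - by rewrite (_ : (fun _ => _) = cst M%:E)// integral_cst// lte_mul_pinfty.
have key (a b c e : R) : `|c| <= M -> `|e| <= M ->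
    `|a * c + b * e| <= M * (a ^+ 2 + b ^+ 2) + 2 * M.
  move=> cM eM; apply: (le_trans (ler_normD _ _)); rewrite !normrM.
  have le1 (t : R) : `|t| <= t ^+ 2 + 1.
    rewrite -(real_normK (num_real t)); have : 0 <= (`|t| - 1) ^+ 2 by rewrite sqr_ge0.
    have := normr_ge0 t; nra.
  apply: (@le_trans _ _ (M * (a ^+ 2 + 1) + M * (b ^+ 2 + 1))).
    by rewrite ![M * _]mulrC lerD// ler_pM.
  by rewrite -mulrDr -[2 * M]mulrC -mulrDr ler_wpM2l//; lra.
split.
  apply: (dom (fun x => complex.Re ((f * g) x))).
    rewrite (_ : (fun _ => _) = fun x => complex.Re (f x) * complex.Re (g x) -
      complex.Im (f x) * complex.Im (g x)).
      by apply: measurable_funB; apply: measurable_funM.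
    apply/funext => x; rewrite [X in complex.Re X](_ : _ = f x * g x)//.
    by case: (f x) (g x) => [? ?] [? ?].
  move=> x Dx; rewrite [X in complex.Re X](_ : _ = f x * g x)//.
  have [] := gM x Dx; case: (f x) (g x) => [a b] [c e]/= cM eM.
  by rewrite -mulrN key// normrN.
apply: (dom (fun x => complex.Im ((f * g) x))).
  rewrite (_ : (fun _ => _) = fun x => complex.Re (f x) * complex.Im (g x) +
    complex.Im (f x) * complex.Re (g x)).
    by apply: measurable_funD; apply: measurable_funM.
  apply/funext => x; rewrite [X in complex.Im X](_ : _ = f x * g x)//.
  by case: (f x) (g x) => [? ?] [? ?].
move=> x Dx; rewrite [X in complex.Im X](_ : _ = f x * g x)//.
have [] := gM x Dx; case: (f x) (g x) => [a b] [c e]/= cM eM.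
exact: key.
Qed.

Definition L2_data D (mD : measurable D) : subquot_data :=
  SubquotData (square_integrable_subspace mD) (ae_null_subspace D).

End complex_integral.

Section domains.
Context {R : realType} {n : nat}.
Implicit Types (A Omega : set 'rV[R]_n).

(* The norm of 'rV[R]_n is the sup norm, hence this Euclidean distance. *)
Definition edist (x y : 'rV[R]_n) : R :=
  Num.sqrt (\sum_(i < n) (x 0 i - y 0 i) ^+ 2).

Definition diameter A : \bar R :=
  ereal_sup [set r | exists x y, [/\ A x, A y & r = (edist x y)%:E]].

(* The weight of the empty set is 0 also for s = 0. *)
Definition hausdorff_weight (s : nat) A : \bar R :=
  if `[< A = set0 >] then 0%E else ((fine (diameter A)) ^+ s)%:E.

Definition hausdorff_delta (s : nat) (delta : R) A : \bar R :=
  ereal_inf [set r | exists F : nat -> set 'rV[R]_n,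
    [/\ forall k, (diameter (F k) <= delta%:E)%E,
        A `<=` \bigcup_k F k &
        r = (\sum_(0 <= k <oo) hausdorff_weight s (F k))%E]].

(* Hausdorff measure, without the factor vol_s(B(0, 1/2)). *)
Definition hausdorff (s : nat) A : \bar R :=
  ereal_sup [set hausdorff_delta s delta A | delta in [set delta | 0 < delta]].

Definition partial (i : 'I_n) (f : 'rV[R]_n -> R) : 'rV[R]_n -> R :=
  fun x => 'D_(delta_mx 0 i) f x.

Fixpoint Ck (k : nat) (f : 'rV[R]_n -> R) : Prop :=
  continuous f /\
  if k is k'.+1 then
    forall i, (forall x, derivable f x (delta_mx 0 i)) /\ Ck k' (partial i f)
  else True.

Definition smooth (w : 'rV[R]_n -> R[i]) : Prop :=
  forall k, Ck k (fun x => complex.Re (w x)) /\ Ck k (fun x => complex.Im (w x)).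

Definition cpartial (i : 'I_n) (w : 'rV[R]_n -> R[i]) : 'rV[R]_n -> R[i] :=
  fun x => Complex (partial i (fun y => complex.Re (w y)) x)
                   (partial i (fun y => complex.Im (w y)) x).

Definition test_function Omega (w : 'rV[R]_n -> R[i]) : Prop :=
  smooth w /\ exists K, [/\ compact K, K `<=` Omega & forall x, ~ K x -> w x = 0].

End domains.

(* Near each boundary point, after an orthogonal change of coordinates, Omega
   is the region above the graph of a Lipschitz function of all coordinates
   but the first one; the translation is absorbed in the function. *)
Definition lipschitz_boundary (R : realType) (n : nat)
    (Omega : set 'rV[R]_n.+1) : Prop :=
  forall x, (closure Omega `\` interior Omega) x ->
  exists (Q : 'M[R]_n.+1) (zeta : 'rV[R]_n -> R) (k : R),
    [/\ Q *m Q^T = 1%:M, k.-lipschitz zeta &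
      \forall y \near x,
        Omega y <-> zeta (col' 0 (y *m Q)) < (y *m Q) 0 0].

Record bounded_lipschitz_domain (R : realType) (n : nat) := LipschitzDomain {
  dom :> set 'rV[R]_n.+1 ;
  dom_nonempty : dom !=set0 ;
  dom_open : open dom ;
  dom_connected : connected dom ;
  dom_bounded : bounded_set dom ;
  dom_lipschitz : lipschitz_boundary dom }.

Section sobolev.
Context {R : realType} {n : nat}.
Local Notation C := R[i].
Local Notation T := 'rV[R]_n.+1.
Local Notation I := 'I_n.+1.
Local Notation leb := (@lebesgue_rV R n.+1).
Variable Omega : bounded_lipschitz_domain R n.

Lemma dom_measurable : measurable Omega.
Proof. by apply: open_measurable_rV; exact: dom_open. Qed.

Lemma dom_le : exists M : R, forall x : T, dom Omega x -> `|x| <= M.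
Proof.
have [M [_ OM]] := dom_bounded Omega.
by exists (M + 1) => x Ox; apply: (OM (M + 1)) => //; rewrite ltrDl.
Qed.

Lemma lebesgue_dom : (leb Omega < +oo)%E.
Proof.
have [M OM] := dom_le.
apply: le_lt_trans (lebesgue_rV_bounded n.+1 M).
apply: le_measure; rewrite ?inE; first exact: dom_measurable.
  rewrite (_ : mkset _ = \bigcap_(i in [set: 'I_n.+1])
      ((fun x : T => x 0 i) @^-1` `[- M, M]%classic)); last first.
    by apply/seteqP; split=> x xM i /=; have := xM i;
      rewrite /= in_itv/= -ler_norml; [move=> + _|exact].
  apply: fin_bigcap_measurable => // i _.
  by rewrite -[X in measurable X]setTI; exact: measurable_coord.
move=> x /OM xM i /=; apply: le_trans xM.
by rewrite [leRHS]/Num.norm /= mx_normrE; apply/bigmax_geP; right; exists (0, i).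
Qed.

Lemma continuous_dom_bounded (f : T -> R) : continuous f ->
  exists M, forall x, dom Omega x -> `|f x| <= M.
Proof.
move=> cf; have [M OM] := dom_le.
have cK : compact (closed_ball (0 : T) (`|M| + 1)).
  apply: bounded_closed_compact; last exact: closed_ball_closed.
  exists (`|M| + 1); split; first exact: num_real.
  move=> r Mr x; rewrite closed_ballE ?ltr_wpDl// /closed_ball_ /= sub0r normrN.
  by move=> /le_trans; apply; exact: ltW.
have := continuous_compact (continuous_subspaceT cf) cK.
move=> /compact_bounded[N [_ fN]]; exists (N + 1) => x Ox.
apply: (fN (N + 1)); rewrite ?ltrDl//; exists x => //.
rewrite closed_ballE ?ltr_wpDl// /closed_ball_ /= sub0r normrN.
by rewrite (le_trans (OM _ Ox))// (le_trans (ler_norm _))// lerDl.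
Qed.

Definition L2 := subquot (L2_data leb dom_measurable).

(* w.1 is a function and w.2 a candidate for its weak gradient. *)
Definition weak_gradient (w : (T -> C) * (I -> T -> C)) : Prop :=
  forall phi, test_function Omega phi -> forall j : I,
    cintegral leb Omega (w.1 * cpartial j phi) =
    - cintegral leb Omega (w.2 j * phi).

Definition H1_fun (w : (T -> C) * (I -> T -> C)) : Prop :=
  [/\ square_integrable leb Omega w.1,
      forall j, square_integrable leb Omega (w.2 j) & weak_gradient w].

Definition H1_null (w : (T -> C) * (I -> T -> C)) : Prop :=
  ae_null leb Omega w.1 /\ forall j, ae_null leb Omega (w.2 j).

Let test_bound phi : smooth phi -> cmeasurable Omega phi /\
  exists M, forall x, dom Omega x ->
    `|complex.Re (phi x)| <= M /\ `|complex.Im (phi x)| <= M.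
Proof.
move=> /(_ 0)[[cr _] [ci _]]; split.
  by split; apply: measurable_funTS; exact: continuous_measurable_rV.
have [M1 h1] := continuous_dom_bounded cr.
have [M2 h2] := continuous_dom_bounded ci.
exists (Num.max M1 M2) => x Ox.
by rewrite !le_max h1// h2// orbT.
Qed.

Lemma smooth_cpartial j (phi : T -> C) : smooth phi -> smooth (cpartial j phi).
Proof. by move=> sphi k; have [[_ /(_ j)[_ ?]] [_ /(_ j)[_ ?]]] := sphi k.+1. Qed.

Let H1_fun_subspace : subspace H1_fun.
Proof.
have sq := square_integrable_subspace leb dom_measurable.
have fin := lebesgue_dom; have mO := dom_measurable.
have ip u phi : square_integrable leb Omega u -> smooth phi ->
    cintegrable leb Omega (u * phi).
  move=> su /test_bound[mphi [M phiM]].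
  exact: (cintegrable_mul mO fin su mphi phiM).
split.
  split=> [|j|]; [exact: sq.1|exact: sq.1|].
  move=> phi _ j /=; rewrite !mul0r.
  rewrite (_ : cintegral _ _ 0 = 0) ?oppr0//.
  by rewrite /cintegral /Rintegral; congr Complex;
    rewrite (eq_integral (cst 0%E))// integral0.
move=> a f g [f1 f2 fw] [g1 g2 gw]; split=> [|j|].
- exact: sq.2.
- exact: sq.2.
move=> phi tphi j; have sphi := tphi.1.
have E (u v w : T -> C) : (a *: u + v) * w = a *: (u * w) + v * w.
  by apply/funext => x; rewrite (_ : _ x = (a * u x + v x) * w x)// mulrDl -mulrA.
rewrite /= !E !cintegralZD//; try exact: ip;
  try by apply: ip => //; exact: smooth_cpartial.
by rewrite fw// gw// opprD mulrN.
Qed.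

Let H1_null_subspace : subspace H1_null.
Proof.
have nl := ae_null_subspace leb Omega.
split; first by split=> [|j]; exact: nl.1.
by move=> a f g [f1 f2] [g1 g2]; split=> [|j]; apply: nl.2.
Qed.

(* H^1(Omega), as the graph of the weak gradient: the second component of
   sq_val u is the (a.e. unique) weak gradient of the first one. *)
Definition H1_data : subquot_data := SubquotData H1_fun_subspace H1_null_subspace.
Definition H1 := subquot H1_data.

Let H1_square_integrable (u : H1) : sq_space (L2_data leb dom_measurable) (sq_val u).1.
Proof. by have [] := sq_val_space u. Qed.

Definition H1_L2 (u : H1) : L2 := sq_pi (H1_square_integrable u).

End sobolev.

Section boundary_space.
Context {R : realType} {n : nat}.
Local Notation C := R[i].
Local Notation T := 'rV[R]_n.+1.

(* The surface measure of Omega, as a measure on the whole space. *)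
Definition is_surface_measure (Omega : set T)
    (sigma : {finite_measure set T -> \bar R}) : Prop :=
  forall A, measurable A ->
    sigma A = (lebesgue_rV n [set y : 'rV[R]_n | (edist y 0 <= 1 / 2)%R] *
               hausdorff n (A `&` (closure Omega `\` interior Omega)))%E.

Variable sigma : {finite_measure set T -> \bar R}.

(* Sobolev-Slobodeckij integrand for H^{1/2} of an n-dimensional surface. *)
Definition slobodeckij (f : T -> C) (p : T * T) : R :=
  sqmod (f p.1 - f p.2) / edist p.1 p.2 ^+ n.+1.

Definition H12_fun (f : T -> C) : Prop :=
  square_integrable sigma setT f /\
  (\int[(sigma \x sigma)%E]_p (slobodeckij f p)%:E < +oo)%E.

Let edist_ge0 (x y : T) : 0 <= edist x y. Proof. exact: sqrtr_ge0. Qed.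

Let slobodeckij_ge0 f p : 0 <= slobodeckij f p.
Proof. by rewrite divr_ge0 ?sqmod_ge0 ?exprn_ge0. Qed.

Let measurable_slobodeckij f : cmeasurable setT f ->
  measurable_fun setT (slobodeckij f).
Proof.
move=> [rf jf].
have m1 (h : T -> R) : measurable_fun setT h ->
    measurable_fun setT (fun p : T * T => h p.1).
  by move=> mh; apply: (measurableT_comp mh); exact: measurable_fst.
have m2 (h : T -> R) : measurable_fun setT h ->
    measurable_fun setT (fun p : T * T => h p.2).
  by move=> mh; apply: (measurableT_comp mh); exact: measurable_snd.
apply: measurable_funM.
  rewrite (_ : (fun _ => _) = fun p : T * T =>
    (complex.Re (f p.1) - complex.Re (f p.2)) ^+ 2 +
    (complex.Im (f p.1) - complex.Im (f p.2)) ^+ 2).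
    apply: measurable_funD; apply: measurable_funX; apply: measurable_funB.
    - exact: (m1 (fun x => complex.Re (f x))).
    - exact: (m2 (fun x => complex.Re (f x))).
    - exact: (m1 (fun x => complex.Im (f x))).
    - exact: (m2 (fun x => complex.Im (f x))).
  by apply/funext => p; case: (f p.1) (f p.2) => [? ?] [? ?].
rewrite (_ : (fun _ => _) =
    fun p : T * T => (edist p.1 p.2 ^+ n.+1) `^ (-1)); last first.
  by apply/funext => p; rewrite powR_inv1// exprn_ge0.
apply: (@measurableT_comp _ _ _ _ _ _ (fun x : R => x `^ (-1))) => //.
apply: measurable_funX; apply: (@measurableT_comp _ _ _ _ _ _ (@Num.sqrt R)).
  by apply: continuous_measurable_fun; exact: sqrt_continuous.
apply: measurable_sum => i; apply: measurable_funX; apply: measurable_funB.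
  exact: (m1 (fun x : T => x 0 i) (measurable_coord i)).
exact: (m2 (fun x : T => x 0 i) (measurable_coord i)).
Qed.

Let H12_fun_subspace : subspace H12_fun.
Proof.
have sq := square_integrable_subspace sigma (measurableT : measurable [set: T]).
split.
  split; first exact: sq.1.
  rewrite (_ : (fun _ => _) = cst 0%E) ?integral0 ?ltry//.
  by apply/funext => p; rewrite /slobodeckij subrr /sqmod /= expr0n addr0 mul0r.
move=> a f g [sf ff] [sg gf]; split; first exact: sq.2.
have [mf mg] := (sf.1, sg.1); have mh := cmeasurableZD a mf mg.
apply: (@integral_lty_dom _ _ _ _ setT (slobodeckij (a *: f + g))
  (slobodeckij f) (slobodeckij g) (2 * sqmod a)) => //.
- by rewrite mulr_ge0// sqmod_ge0.
- exact: measurable_slobodeckij.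
- exact: measurable_slobodeckij.
- exact: measurable_slobodeckij.
move=> p _; rewrite /slobodeckij !mulrA -mulrDl ler_wpM2r//.
  by rewrite invr_ge0 exprn_ge0.
apply: le_trans (sqmod_le _ _ _).
rewrite (_ : (a *: f + g) p.1 = a * f p.1 + g p.1)//.
rewrite (_ : (a *: f + g) p.2 = a * f p.2 + g p.2)//.
by rewrite opprD addrACA mulrBr.
Qed.

(* sigma is carried by the boundary, so functions on the whole space up to
   sigma-null sets are functions on the boundary up to null sets. *)
Definition H12_data : subquot_data :=
  SubquotData H12_fun_subspace (ae_null_subspace sigma setT).
Definition H12 := subquot H12_data.

Definition H12_norm (f : H12) : R :=
  Num.sqrt (fine (\int[sigma]_x (sqmod (sq_val f x))%:E)
    + fine (\int[(sigma \x sigma)%E]_p (slobodeckij (sq_val f) p)%:E)).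

Definition antidual_fun (phi : H12 -> C) : Prop :=
  (forall a f g, phi (a *: f + g) = conjc a * phi f + phi g) /\
  exists M, forall f, normc (phi f) <= M * H12_norm f.

Let antidual_subspace : subspace antidual_fun.
Proof.
split.
  split; first by move=> a f g; rewrite /= mulr0 addr0.
  by exists 0 => f; rewrite mul0r normc0.
move=> a u v [u1 [M uM]] [v1 [N vN]]; split.
  move=> b f g.
  have E h : (a *: u + v) h = a * u h + v h by [].
  by rewrite !E u1 v1; ring.
exists (normc a * M + N) => f; rewrite (_ : (a *: u + v) f = a * u f + v f)//.
rewrite (le_trans (le_normcD _ _))// normcM mulrDl lerD// -mulrA ler_wpM2l//.
by case: a => ? ?; exact: sqrtr_ge0.
Qed.

Let null_subspace : subspace [set 0 : H12 -> C].
Proof. by split=> // a x y -> ->; rewrite scaler0 addr0. Qed.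

(* H^{-1/2}: the bounded antilinear functionals on H12 (the null space is
   trivial, so the quotient is the space itself). *)
Definition Hm12_data : subquot_data := SubquotData antidual_subspace null_subspace.
Definition Hm12 := subquot Hm12_data.

Definition pairing (phi : Hm12) (g : H12) : C := sq_val phi g.

(* Any inner product whose norm is equivalent to the Sobolev-Slobodeckij norm. *)
Record H12_inner_product := H12InnerProduct {
  ip :> H12 -> H12 -> C ;
  ip_linear : forall a f g h, ip (a *: f + g) h = a * ip f h + ip g h ;
  ip_herm : forall f g, ip g f = conjc (ip f g) ;
  ip_bounded : exists M, forall f g,
    normc (ip f g) <= M * (H12_norm f * H12_norm g) ;
  ip_coercive : exists c, 0 < c /\
    forall f, c * H12_norm f ^+ 2 <= complex.Re (ip f f) }.

Let riesz_subproof (p : H12_inner_product) (f : H12) :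
  sq_space Hm12_data (fun g => p f g).
Proof.
split.
  move=> a g h; rewrite ip_herm ip_linear (ip_herm p g f) (ip_herm p h f).
  by case: a (p g f) (p h f) => [? ?] [? ?] [? ?] /=; congr Complex; ring.
have [M pM] := ip_bounded p; exists (M * H12_norm f) => g.
by rewrite -mulrA.
Qed.

Definition riesz (p : H12_inner_product) (f : H12) : Hm12 :=
  sq_pi (riesz_subproof p f).

Definition riesz_inv (p : H12_inner_product) (phi : Hm12) : H12 :=
  xget 0 [set f | riesz p f = phi].

Definition bounded_linear (S : H12 -> H12) : Prop :=
  (forall a f g, S (a *: f + g) = a *: S f + S g) /\
  exists M, forall f, H12_norm (S f) <= M * H12_norm f.

Definition bounded_linear_dual (Theta : H12 -> Hm12) : Prop :=
  (forall a f g, Theta (a *: f + g) = a *: Theta f + Theta g) /\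
  exists M, forall f g,
    normc (pairing (Theta f) g) <= M * H12_norm f * H12_norm g.

Definition invertible (S : H12 -> H12) : Prop :=
  bounded_linear S /\
  exists S', [/\ bounded_linear S', cancel S S' & cancel S' S].

Definition inverse (S : H12 -> H12) (f : H12) : H12 :=
  xget 0 [set h | S h = f].

(* Complex differentiability in operator norm on an open set. *)
Definition analytic_on (U : set C) (W : C -> H12 -> H12) : Prop :=
  (forall z, U z -> exists2 r : R, 0 < r & forall w, normc (w - z) < r -> U w) /\
  forall z, U z -> bounded_linear (W z) /\
    exists2 D, bounded_linear D &
      forall e : R, 0 < e -> exists2 r : R, 0 < r &
        forall w, U w -> normc (w - z) < r -> forall f,
          H12_norm (W w f - W z f - (w - z) *: D f)
            <= e * normc (w - z) * H12_norm f.

End boundary_space.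

Section operators.
Context {R : realType} {n : nat}.
Local Notation C := R[i].
Local Notation T := 'rV[R]_n.+1.
Local Notation I := 'I_n.+1.
Local Notation leb := (@lebesgue_rV R n.+1).
Variables (Omega : bounded_lipschitz_domain R n)
  (sigma : {finite_measure set T -> \bar R}).
Local Notation L2 := (L2 Omega).
Local Notation H1 := (H1 Omega).
Local Notation H12 := (H12 sigma).
Local Notation Hm12 := (Hm12 sigma).

Definition l2ip (f g : T -> C) : C :=
  cintegral leb Omega (fun x => f x * conjc (g x)).

Definition L2_norm (f : L2) : R :=
  Num.sqrt (fine (\int[leb]_(x in Omega) (sqmod (sq_val f x))%:E)).

Definition H1_norm (u : H1) : R :=
  Num.sqrt (fine (\int[leb]_(x in Omega) (sqmod ((sq_val u).1 x))%:E) +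
    \sum_(j < n.+1) fine (\int[leb]_(x in Omega) (sqmod ((sq_val u).2 j x))%:E)).

(* For a Lipschitz domain exactly one map satisfies this: the bounded linear
   surjective extension of the restriction to the boundary of functions smooth
   up to the boundary. *)
Record is_dirichlet_trace (gammaD : H1 -> H12) : Prop := IsDirichletTrace {
  trace_linear : forall a u v, gammaD (a *: u + v) = a *: gammaD u + gammaD v ;
  trace_bounded : exists M, forall u, H12_norm (gammaD u) <= M * H1_norm u ;
  trace_onto : forall f, exists u, gammaD u = f ;
  trace_restriction : forall (u : H1) (w : T -> C), smooth w ->
    ae_null leb Omega ((sq_val u).1 - w) ->
    ae_null sigma setT (sq_val (gammaD u) - w) }.

Record coefficients := Coefficients {
  coef_a : I -> I -> T -> C ;
  coef_b : I -> T -> C ;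
  coef_d : I -> T -> C ;
  coef_q : T -> C }.

Definition Linfty (f : T -> C) : Prop :=
  cmeasurable Omega f /\
  exists M, {ae leb, forall x, dom Omega x -> normc (f x) <= M}.

Definition Linfty_coefficients (L : coefficients) : Prop :=
  [/\ forall j k, Linfty (coef_a L j k), forall j, Linfty (coef_b L j),
      forall j, Linfty (coef_d L j) & Linfty (coef_q L)].

Definition uniformly_elliptic (L : coefficients) : Prop :=
  exists2 c : R, 0 < c & forall (xi : I -> C) x, dom Omega x ->
    c * (\sum_j sqmod (xi j)) <=
    complex.Re (\sum_j \sum_k coef_a L j k x * conjc (xi j) * xi k).

(* The form Phi, on pairs consisting of a function and its gradient. *)
Definition form (L : coefficients) (u v : (T -> C) * (I -> T -> C)) : C :=
  \sum_j \sum_k l2ip (coef_a L j k * u.2 k) (v.2 j)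
  + \sum_j l2ip (coef_b L j * u.2 j) v.1
  + \sum_j l2ip (coef_d L j * u.1) (v.2 j)
  + l2ip (coef_q L * u.1) v.1.

Section operator.
Variables (L : coefficients) (gammaD : H1 -> H12).

Definition Phi (u v : H1) : C := form L (sq_val u) (sq_val v).

Definition PhiTheta (Theta : H12 -> Hm12) (u v : H1) : C :=
  Phi u v + pairing (Theta (gammaD u)) (gammaD v).

Definition elliptic_form (Psi : H1 -> H1 -> C) : Prop :=
  (exists M, forall u v, normc (Psi u v) <= M * H1_norm u * H1_norm v) /\
  exists gamma c : R, 0 < gamma /\ forall u,
    gamma * H1_norm u ^+ 2 + c * L2_norm (H1_L2 u) ^+ 2 <= complex.Re (Psi u u).

(* L u = f in the sense of distributions. *)
Definition distributional (u : H1) (f : L2) : Prop :=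
  forall w, test_function Omega w ->
    form L (sq_val u) (w, fun j => cpartial j w) = l2ip (sq_val f) w.

(* L u = f belongs to L^2, and phi is the conormal derivative of u; it is
   determined by the second identity because gammaD is onto. *)
Definition conormal (u : H1) (f : L2) (phi : Hm12) : Prop :=
  distributional u f /\
  forall v, Phi u v = l2ip (sq_val f) (sq_val (H1_L2 v)) + pairing phi (gammaD v).

Definition LTheta (Theta : H12 -> Hm12) : set (L2 * L2) :=
  [set p | exists (u : H1) (phi : Hm12), [/\ H1_L2 u = p.1, conormal u p.2 phi &
                             phi + Theta (gammaD u) = 0]].

Definition resolvent_set (A : set (L2 * L2)) : set C :=
  [set lambda |
    (forall f : L2, exists! v : L2,
       exists2 h : L2, A (v, h) & h - lambda *: v = f) /\
    exists M, forall v h : L2, A (v, h) -> L2_norm v <= M * L2_norm (h - lambda *: v)].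

Definition boundary_problem (Theta : H12 -> Hm12) (lambda : C) (g : Hm12)
    (u : H1) : Prop :=
  exists2 phi, conormal u (lambda *: H1_L2 u) phi & phi + Theta (gammaD u) = g.

Definition solution (Theta : H12 -> Hm12) (lambda : C) (g : Hm12) : H1 :=
  xget 0 [set u | boundary_problem Theta lambda g u].

Definition conormal_derivative (lambda : C) (u : H1) : Hm12 :=
  xget 0 [set phi | conormal u (lambda *: H1_L2 u) phi].

Definition Nmap (Theta : H12 -> Hm12) (lambda : C) (g : Hm12) : H12 := gammaD (solution Theta lambda g).

Definition Rmap (Theta1 Theta2 : H12 -> Hm12) (lambda : C) (g : Hm12) : Hm12 :=
  let u := solution Theta1 lambda g in
  conormal_derivative lambda u + Theta2 (gammaD u).

Variable p : H12_inner_product sigma.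

Definition iriesz (f : H12) : Hm12 := 'i%C *: riesz p f.

(* (N(lambda) R + i) (N(lambda) R - i)^{-1}. *)
Definition W0 (lambda : C) (f : H12) : H12 :=
  let NR h := Nmap (fun=> 0) lambda (riesz p h) in
  let h := inverse (fun k => NR k - 'i%C *: k) f in
  NR h + 'i%C *: h.

End operator.
End operators.

(* Main.v *)
(* A weak solution of L u = lambda u, gamma_N u + Theta gamma_D u = R f is an
   element u of H^1 with Phi_Theta(u, v) - lambda <u, v> = <f, gamma_D v> for
   all v, and lambda lies in rho(L^Theta) if and only if this problem, with
   right-hand sides <x, v> for x in L^2, is uniquely solvable with a bound.
   Lax-Milgram applied to a shifted form, corrected by the resolvent, extends
   solvability to every bounded antilinear right-hand side; this gives the
   boundary data.

   If u solves the i R problem with data f, then it solves the Neumann problem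
   with data f - i gamma_D u.  Hence K = N R - i has the inverse
   f |-> gamma_D u + i f, so that W_0 = (K + 2 i) K^{-1} = 2 i N_{iR} R - 1.
   Conversely, an inverse of K turns the Neumann resolvent into the resolvent
   of the i R problem.  The expression 2 i N_{iR} R - 1 makes sense on all of
   rho(L^{iR}), where it is analytic by the resolvent identity. *)

From mathcomp Require Import all_boot all_order all_algebra.
From mathcomp Require Import complex.
From mathcomp Require Import all_classical all_reals all_analysis.
From mathcomp Require Import measurable_realfun ring lra.
Require Import Defs.

Set Implicit Arguments.
Unset Strict Implicit.
Unset Printing Implicit Defensive.
Import Order.TTheory GRing.Theory Num.Theory.
Import numFieldNormedType.Exports.
Import Normc.
Local Open Scope classical_set_scope.
Local Open Scope complex_scope.
Local Open Scope ring_scope.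

(** The functional analysis is done for abstract spaces [V], [X], [B] with maps [j : V -> X] and
    [G : V -> B], later H^1, L^2 and H^{1/2} with the embedding and the trace. Right-hand sides are
    antilinear functionals on [V], which puts L^2 data and boundary data on the same footing. A
    resolvent bound controls only the L^2 norm, whereas traces need the H^1 norm; Garding's
    inequality supplies the difference. The main analytic work is the passage between weak equations
    and operators: a weak equation tested against H^1 must imply the distributional one. For this a
    test function has to be an element of H^1, by integration by parts for its classical gradient,
    and has to have zero trace, because the surface measure does not charge the open set.
    Completeness of H^1, on which Lax-Milgram and the Neumann series rest, comes from the
    Riesz-Fischer theorem and the closedness of the weak gradient. Classes are given by chosen
    representatives, so identities between functions hold only almost everywhere and have to be
    carried through inner products. *)

(** * Real parts, conjugates and moduli of complex numbers *)

Section complex_numbers.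
Context {R : realType}.
Implicit Types z w : R[i].

Lemma ReD z w : complex.Re (z + w) = complex.Re z + complex.Re w.
Proof. by case: z w => [? ?] [? ?]. Qed.

Lemma ReN z : complex.Re (- z) = - complex.Re z.
Proof. by case: z. Qed.

Lemma ReJ z : complex.Re (conjc z) = complex.Re z.
Proof. by case: z. Qed.

Lemma normc_ge0 z : 0 <= normc z.
Proof. by case: z => ? ?; exact: sqrtr_ge0. Qed.

Lemma sqr_normc z : normc z ^+ 2 = complex.Re z ^+ 2 + complex.Im z ^+ 2.
Proof. by case: z => a b; rewrite /= sqr_sqrtr// addr_ge0// sqr_ge0. Qed.

Lemma ler_Re_normc z : `|complex.Re z| <= normc z.
Proof.
rewrite -(ler_pXn2r (_ : 0 < 2)%N) ?nnegrE ?normr_ge0 ?normc_ge0//.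
by rewrite sqr_normc real_normK ?num_real// lerDl sqr_ge0.
Qed.

Lemma ler_Im_normc z : `|complex.Im z| <= normc z.
Proof.
rewrite -(ler_pXn2r (_ : 0 < 2)%N) ?nnegrE ?normr_ge0 ?normc_ge0//.
by rewrite sqr_normc real_normK ?num_real// lerDr sqr_ge0.
Qed.

Lemma Re_le_normc z : complex.Re z <= normc z.
Proof. exact: le_trans (ler_norm _) (ler_Re_normc z). Qed.

Lemma normcJ z : normc (conjc z) = normc z.
Proof. by case: z => a b; rewrite /= sqrrN. Qed.

Lemma conjcD z w : conjc (z + w) = conjc z + conjc w.
Proof. exact: rmorphD. Qed.

Lemma conjcN z : conjc (- z) = - conjc z.
Proof. exact: rmorphN. Qed.

Lemma conjcM z w : conjc (z * w) = conjc z * conjc w.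
Proof. exact: rmorphM. Qed.

Lemma normc_real (a : R) : 0 <= a -> normc a%:C = a.
Proof. by move=> a0; rewrite /= expr0n addr0 sqrtr_sqr ger0_norm. Qed.

Lemma normc_i : normc ('i%C : R[i]) = 1.
Proof. by rewrite /= expr0n expr1n add0r sqrtr1. Qed.

End complex_numbers.

(** * Hilbert spaces *)

Section semi_inner_product.
Context {R : realType} {V : lmodType R[i]}.

(** Definiteness is a separate predicate. Only the real part of [p u u] is constrained, since
    hermitian symmetry makes the imaginary part vanish. *)
Record sip := Sip {
  sip_fun :> V -> V -> R[i] ;
  sip_lin : forall a u v w, sip_fun (a *: u + v) w = a * sip_fun u w + sip_fun v w ;
  sip_herm : forall u v, sip_fun v u = conjc (sip_fun u v) ;
  sip_ge0 : forall u, 0 <= complex.Re (sip_fun u u) }.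

Definition hnorm (p : sip) (u : V) : R := Num.sqrt (complex.Re (p u u)).

Definition definite (p : sip) := forall u, hnorm p u = 0 -> u = 0.

Definition converges (p : sip) (u : nat -> V) (l : V) :=
  forall e : R, 0 < e -> exists N, forall n, (N <= n)%N -> hnorm p (u n - l) <= e.

Definition complete (p : sip) := forall u : nat -> V,
  (forall e : R, 0 < e -> exists N, forall m n, (N <= m)%N -> (N <= n)%N ->
     hnorm p (u m - u n) <= e) ->
  exists l, converges p u l.

Definition antilinear (F : V -> R[i]) :=
  forall a u v, F (a *: u + v) = conjc a * F u + F v.

Definition linear_to (W : lmodType R[i]) (F : V -> W) :=
  forall a u v, F (a *: u + v) = a *: F u + F v.

Variable p : sip.
Implicit Types u v w : V.
Local Notation nr := (hnorm p).

Lemma sipDl u v w : p (u + v) w = p u w + p v w.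
Proof. by have := sip_lin p 1 u v w; rewrite scale1r mul1r. Qed.

Lemma sip0l w : p 0 w = 0.
Proof. by apply: (addrI (p 0 w)); rewrite -sipDl !addr0. Qed.

Lemma sipZl a u w : p (a *: u) w = a * p u w.
Proof. by rewrite -[a *: u]addr0 sip_lin sip0l addr0. Qed.

Lemma sipNl u w : p (- u) w = - p u w.
Proof. by rewrite -scaleN1r sipZl mulN1r. Qed.

Lemma sipBl u v w : p (u - v) w = p u w - p v w.
Proof. by rewrite sipDl sipNl. Qed.

Lemma sip_linr a u v w : p w (a *: u + v) = conjc a * p w u + p w v.
Proof. by rewrite sip_herm sip_lin conjcD conjcM -!sip_herm. Qed.

Lemma sipDr u v w : p w (u + v) = p w u + p w v.
Proof. by have := sip_linr 1 u v w; rewrite scale1r conjc1 mul1r. Qed.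

Lemma sip0r w : p w 0 = 0.
Proof. by rewrite sip_herm sip0l conjc0. Qed.

Lemma sipZr a u w : p w (a *: u) = conjc a * p w u.
Proof. by rewrite -[a *: u]addr0 sip_linr sip0r addr0. Qed.

Lemma sipNr u w : p w (- u) = - p w u.
Proof. by rewrite sip_herm sipNl conjcN -sip_herm. Qed.

Lemma hnorm_ge0 u : 0 <= nr u. Proof. exact: sqrtr_ge0. Qed.

Lemma sqr_hnorm u : nr u ^+ 2 = complex.Re (p u u).
Proof. by rewrite sqr_sqrtr ?sip_ge0. Qed.

Lemma sip_self u : p u u = (nr u ^+ 2)%:C.
Proof.
rewrite sqr_hnorm; have := sip_herm p u u; case: (p u u) => a b [/eqP].
rewrite -subr_eq0 opprK -mulr2n mulrn_eq0/= => /eqP ->.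
by [].
Qed.

Lemma hnorm0 : nr 0 = 0. Proof. by rewrite /hnorm sip0l sqrtr0. Qed.

Lemma hnormZ a u : nr (a *: u) = normc a * nr u.
Proof.
have e : nr (a *: u) ^+ 2 = (normc a * nr u) ^+ 2.
  rewrite sqr_hnorm sipZl sipZr sip_self exprMn sqr_normc.
  by case: a => a b /=; ring.
apply/eqP; rewrite -(eqrXn2 (_ : 0 < 2)%N) ?e ?hnorm_ge0//.
by rewrite mulr_ge0 ?normc_ge0 ?hnorm_ge0.
Qed.

Lemma hnormN u : nr (- u) = nr u.
Proof. by rewrite -scaleN1r hnormZ normcN normc1 mul1r. Qed.

Lemma hnormBC u v : nr (u - v) = nr (v - u).
Proof. by rewrite -hnormN opprB. Qed.

Lemma sqr_hnormD u v :
  nr (u + v) ^+ 2 = nr u ^+ 2 + 2 * complex.Re (p u v) + nr v ^+ 2.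
Proof.
rewrite !sqr_hnorm sipDl !sipDr !ReD (sip_herm p u v) ReJ; ring.
Qed.

Lemma cauchy_schwarz u v : normc (p u v) <= nr u * nr v.
Proof.
rewrite -(ler_pXn2r (_ : 0 < 2)%N) ?nnegrE ?normc_ge0 ?mulr_ge0 ?hnorm_ge0//.
rewrite exprMn; set D := normc _ ^+ 2; set A := nr u ^+ 2; set B := nr v ^+ 2.
have D0 : 0 <= D by rewrite sqr_ge0.
have A0 : 0 <= A by rewrite sqr_ge0.
have B0 : 0 <= B by rewrite sqr_ge0.
(* This expands the squared norm of u - t p(u, v) v for real t; the later choice t = 1/B minimises
   it. *)
have key (t : R) : 0 <= A - 2 * t * D + t ^+ 2 * D * B.
  have := sqr_ge0 (nr (u + (- (t%:C * p u v)) *: v)).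
  rewrite sqr_hnormD hnormZ sipZr exprMn normcN normcM exprMn -/A -/B -/D.
  rewrite (_ : complex.Re _ = - (t * D)).
    rewrite (_ : normc t%:C ^+ 2 = t ^+ 2); first by move=> h; lra.
    by rewrite sqr_normc /= expr0n addr0.
  by rewrite /D sqr_normc; case: (p u v) => a b /=; ring.
(* The form may be degenerate, so B = 0 does not give v = 0. *)
have [B_eq0|Bn0] := eqVneq B 0.
  rewrite B_eq0 mulr0; rewrite leNgt; apply/negP => Dgt0.
  (* For B = 0 the bound is affine in t, and this t turns it into 0 <= -1. *)
  have := key ((A + 1) / (2 * D)); rewrite B_eq0 mulr0 addr0.
  have -> : 2 * ((A + 1) / (2 * D)) * D = A + 1 by field; rewrite gt_eqF.
  by lra.
have Bgt0 : 0 < B by rewrite lt_def Bn0.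
have := key B^-1.
have -> : A - 2 * B^-1 * D + B^-1 ^+ 2 * D * B = A - D / B by field.
by rewrite subr_ge0 ler_pdivrMr.
Qed.

Lemma ler_hnormD u v : nr (u + v) <= nr u + nr v.
Proof.
rewrite -(ler_pXn2r (_ : 0 < 2)%N) ?nnegrE ?addr_ge0 ?hnorm_ge0//.
rewrite sqr_hnormD; have := cauchy_schwarz u v; have := Re_le_normc (p u v).
by move=> h1 h2; rewrite sqrrD; lra.
Qed.

Lemma parallelogram u v :
  nr (u + v) ^+ 2 + nr (u - v) ^+ 2 = 2 * nr u ^+ 2 + 2 * nr v ^+ 2.
Proof. by rewrite !sqr_hnormD sipNr ReN hnormN; ring. Qed.

Hypotheses (p_def : definite p) (p_complete : complete p).

Lemma sip_ext u v : (forall w, p u w = p v w) -> u = v.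
Proof.
move=> uv; apply/eqP; rewrite -subr_eq0; apply/eqP/p_def.
by rewrite /hnorm sipBl uv subrr sqrtr0.
Qed.

Lemma converges_unique x l m : converges p x l -> converges p x m -> l = m.
Proof.
move=> xl xm; apply/eqP; rewrite -subr_eq0; apply/eqP/p_def.
apply/eqP; rewrite eq_le hnorm_ge0 andbT; apply/ler_addgt0Pr => e e0.
rewrite add0r; have e20 : 0 < e / 2 by rewrite divr_gt0.
have [N lN] := xl _ e20; have [M mM] := xm _ e20.
rewrite -(subrKA (x (maxn N M))).
have {}lN := lN _ (leq_maxl N M); have {}mM := mM _ (leq_maxr N M).
apply: le_trans (ler_hnormD _ _) _; rewrite hnormBC; lra.
Qed.

(** Fixed-point iteration started at 0. It serves both Lax-Milgram and the openness of the resolvent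
    set. *)
Lemma neumann_series (T : V -> V) (q : R) : linear_to T -> q < 1 ->
  (forall v, nr (T v) <= q * nr v) -> forall f, exists v, v = T v + f.
Proof.
move=> Tlin q1 Tq f.
(* A negative [q] forces every norm to vanish, so the space is zero. *)
have [q0|qlt0] := leP 0 q; last first.
  exists 0; have z v : v = 0.
    apply: p_def; apply/eqP; rewrite eq_le hnorm_ge0 andbT.
    have := Tq v; have := hnorm_ge0 (T v); have := hnorm_ge0 v; nra.
  by rewrite [RHS]z.
have T0 : T 0 = 0.
  by apply: (addrI (T 0)); rewrite -{1}[T 0]scale1r -Tlin !addr0 scaler0.
have TB u v : T (u - v) = T u - T v.
  by rewrite addrC -scaleN1r Tlin scaleN1r addrC.
pose x := fix x k := if k is k'.+1 then T (x k') + f else 0.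
have xS k : x k.+1 = T (x k) + f by [].
(* [C] solves q C + |f| = C, so it bounds every iterate, and [q ^+ n * C] bounds the tails. *)
pose C := nr f / (1 - q).
have q10 : 0 < 1 - q by rewrite subr_gt0.
have C0 : 0 <= C by rewrite divr_ge0 ?hnorm_ge0 ?ltW.
have CE : q * C + nr f = C by rewrite /C; field; rewrite gt_eqF.
have xC k : nr (x k) <= C.
  elim: k => [|k IH]; first by rewrite hnorm0.
  rewrite xS; apply: le_trans (ler_hnormD _ _) _; rewrite -CE lerD2r.
  by apply: le_trans (Tq _) _; rewrite ler_wpM2l.
have xd n k : nr (x (n + k)%N - x n) <= q ^+ n * C.
  elim: n => [|n IH]; first by rewrite subr0 expr0 mul1r add0n.
  rewrite addSn !xS opprD addrACA subrr addr0 -TB.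
  by apply: le_trans (Tq _) _; rewrite exprS -mulrA ler_wpM2l.
have qC (e : R) : 0 < e -> exists N, forall n, (N <= n)%N -> q ^+ n * C <= e.
  move=> e0; have : (fun n => q ^+ n * C) @ \oo --> 0 * C.
    by apply: cvgMl; apply: cvg_expr; rewrite ger0_norm.
  rewrite mul0r => /cvgrPdist_le/(_ e e0)[N _ NP]; exists N => n Nn.
  have := NP n Nn; rewrite /= sub0r normrN ger0_norm//.
  by rewrite mulr_ge0 ?exprn_ge0.
have xd' N m : (N <= m)%N -> nr (x m - x N) <= q ^+ N * C.
  by move=> Nm; rewrite -(subnKC Nm).
have [l xl] : exists l, converges p x l.
  apply: p_complete => e e0.
  have [N NP] := qC (e / 2) (divr_gt0 e0 (ltr0n _ 2)).
  exists N => m n Nm Nn; rewrite -(subrKA (x N)).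
  apply: le_trans (ler_hnormD _ _) _; rewrite [in X in _ + X]hnormBC.
  have := NP N (leqnn N); have := xd' _ _ Nm; have := xd' _ _ Nn; lra.
(* The shifted iterates converge to l and, by continuity of T, also to T l + f. *)
exists l; apply: (@converges_unique (fun n => x n.+1)) => e e0.
  by have [N NP] := xl e e0; exists N => n Nn; apply: NP; rewrite leqW.
have [N NP] := xl e e0; exists N => n Nn; rewrite xS opprD addrACA subrr addr0 -TB.
apply: le_trans (Tq _) _; apply: le_trans (NP _ Nn).
by rewrite ler_piMl ?hnorm_ge0// ltW.
Qed.

Lemma riesz_representation (F : V -> R[i]) (M : R) : antilinear F ->
  (forall v, normc (F v) <= M * nr v) -> exists u, forall v, F v = p u v.
Proof.
move=> Fl FM.
have FD u v : F (u + v) = F u + F v by have := Fl 1 u v; rewrite scale1r conjc1 mul1r.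
have F0 : F 0 = 0 by apply: (addrI (F 0)); rewrite -FD !addr0.
have FZ a u : F (a *: u) = conjc a * F u by rewrite -[a *: u]addr0 Fl F0 addr0.
(* The representing vector minimises J; minimising sequences are Cauchy by the
   parallelogram law. *)
pose J v : R := nr v ^+ 2 - 2 * complex.Re (F v).
have J_ge v : - M ^+ 2 <= J v.
  have h1 := FM v; have h2 := Re_le_normc (F v).
  have h3 := sqr_ge0 (nr v - M); rewrite sqrrB in h3.
  by rewrite /J; lra.
have infJ : has_inf (range J).
  split; first by exists (J 0), 0.
  by exists (- M ^+ 2) => _ [v _ <-].
pose d := inf (range J).
have dJ v : d <= J v by apply: ge_inf; [exact: infJ.2|exists v].
have xP n : exists v, J v < d + n.+1%:R^-1.
  have n0 : (0 : R) < n.+1%:R^-1 by rewrite invr_gt0.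
  by have [_ [v _ <-] ?] := inf_adherent n0 infJ; exists v.
have [x xJ] := choice xP.
have Jmid u v : nr (u - v) ^+ 2 <= 2 * (J u - d + (J v - d)).
  have := dJ ((2^-1)%:C *: (u + v)).
  rewrite /J hnormZ FZ FD normc_real ?invr_ge0// exprMn.
  rewrite (_ : complex.Re (_ * _) = 2^-1 * (complex.Re (F u) + complex.Re (F v))).
    by have := parallelogram u v => e; rewrite (_ : nr (u + v) ^+ 2 =
      2 * nr u ^+ 2 + 2 * nr v ^+ 2 - nr (u - v) ^+ 2); [lra|rewrite -e; ring].
  by case: (F u) (F v) => [a b] [c e] /=; ring.
have ninv (e : R) : 0 < e -> exists N, forall n, (N <= n)%N -> n.+1%:R^-1 <= e.
  move=> e0; have [N] := ltr_add_invr e0; rewrite add0r => Ne.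
  exists N => n Nn; apply: le_trans (ltW Ne).
  by rewrite lef_pV2 ?posrE ?ltr0n// ler_nat ltnS.
have [l xl] : exists l, converges p x l.
  apply: p_complete => e e0.
  have e20 : 0 < e ^+ 2 / 4 by rewrite divr_gt0 ?exprn_gt0.
  have [N NP] := ninv _ e20.
  exists N => m n Nm Nn; have ge := ltW e0; rewrite -(ler_pXn2r (_ : 0 < 2)%N) ?nnegrE ?hnorm_ge0//.
  have := Jmid (x m) (x n); have := xJ m; have := xJ n.
  have := NP m Nm; have := NP n Nn.
  by move: (J (x m)) (J (x n)) (n.+1%:R^-1) (m.+1%:R^-1) => a b s t *; lra.
(* Compare d <= J (x n + v) with J (x n) < d + 1/(n+1) for large n. Half of e absorbs 1/(n+1), the
   other half the replacement of x n by l. *)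
have key v : 2 * complex.Re (F v - p l v) <= nr v ^+ 2.
  apply/ler_addgt0Pr => e e0.
  have e1 : 0 < e / 2 by rewrite divr_gt0.
  have e2 : 0 < e / 2 / (2 * (nr v + 1)).
    by rewrite divr_gt0// mulr_gt0// ltr_pwDr ?hnorm_ge0.
  have [N1 N1P] := ninv _ e1; have [N2 N2P] := xl _ e2.
  pose n := maxn N1 N2.
  have h1 := N1P n (leq_maxl _ _); have h2 := N2P n (leq_maxr _ _).
  have h3 := le_trans (Re_le_normc _) (cauchy_schwarz (x n - l) v).
  have h4 := xJ n; have h5 := dJ (x n + v).
  rewrite /J sqr_hnormD FD ReD in h5.
  rewrite ReD ReN; rewrite sipBl ReD ReN in h3.
  have h6 : 2 * (nr (x n - l) * nr v) <= e / 2.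
    apply: (@le_trans _ _ (2 * (e / 2 / (2 * (nr v + 1)) * nr v))).
      by rewrite ler_pM2l// ler_wpM2r ?hnorm_ge0.
    have nv : 0 < nr v + 1 by rewrite ltr_pwDr ?hnorm_ge0.
    rewrite (_ : 2 * _ = (e / 2) * (nr v / (nr v + 1))); last by field; rewrite gt_eqF.
    by rewrite ler_piMr ?ltW// ltr_pdivrMr// mul1r ltrDl.
  rewrite /J in h4; move: (nr (x n - l)) (n.+1%:R^-1) h1 h3 h4 h5 h6 => s t *; lra.
(* [key] bounds a linear quantity by a quadratic one: insert t v, divide by t, and let t be small.
   The summand 1 in the denominator of t covers the case |v| = 0. *)
have Fle v : complex.Re (F v - p l v) <= 0.
  apply/ler_addgt0Pr => e e0; rewrite add0r.
  have nv : 0 < nr v ^+ 2 + 1 by rewrite ltr_pwDr ?sqr_ge0.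
  pose t := e / (nr v ^+ 2 + 1).
  have t0 : 0 < t by rewrite divr_gt0.
  have := key (t%:C *: v).
  rewrite FZ sipZr conjc_real -mulrBr hnormZ (normc_real (ltW t0)).
  rewrite (_ : complex.Re (_ * _) = t * complex.Re (F v - p l v)); last first.
    by case: (F v - p l v) => a b /=; ring.
  rewrite exprMn expr2 -mulrA mulrCA ler_pM2l// => h.
  have : t * nr v ^+ 2 <= e.
    rewrite /t mulrAC ler_pdivrMr// ler_pM2l// lerDl//.
  have := sqr_ge0 (nr v); nra.
have Fe v : complex.Re (F v - p l v) = 0.
  apply/eqP; rewrite eq_le Fle/=; have := Fle (- v).
  by rewrite -scaleN1r FZ sipZr -mulrBr conjcN conjc1 mulN1r ReN oppr_le0.
(* Replacing v by i v turns the vanishing of the real part into that of the imaginary part. *)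
exists l => v; apply/eqP; rewrite -subr_eq0; apply/eqP.
have := Fe v; have := Fe ('i%C *: v); rewrite FZ sipZr -mulrBr.
case: (F v - p l v) => a b /= + ->.
by rewrite mul0r mulN1r opprK add0r => ->.
Qed.

Lemma lax_milgram (b : V -> V -> R[i]) (M g : R) (F : V -> R[i]) (N : R) :
  (forall a u v w, b (a *: u + v) w = a * b u w + b v w) ->
  (forall u, antilinear (b u)) ->
  (forall u v, normc (b u v) <= M * nr u * nr v) ->
  0 < g -> (forall u, g * nr u ^+ 2 <= complex.Re (b u u)) ->
  antilinear F -> (forall v, normc (F v) <= N * nr v) ->
  exists u, forall v, b u v = F v.
Proof.
move=> bl br bM g0 bg Fl FN.
have [f fF] := riesz_representation Fl FN.
have AP u : exists w, forall v, b u v = p w v.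
  exact: (riesz_representation (br u) (bM u)).
have [A Ab] := choice AP.
have Alin : linear_to A.
  by move=> a u v; apply: sip_ext => w; rewrite sip_lin -!Ab bl.
(* [m] bounds [A], is positive and is at least [g], so that 1 - g^2/m^2 lies in [0, 1). *)
pose m := `|M| + g.
have m0 : 0 < m by rewrite ltr_wpDl.
have AM u : nr (A u) <= m * nr u.
  have [/eqP A0|A0] := boolP (nr (A u) == 0).
    by rewrite A0 mulr_ge0 ?hnorm_ge0// ltW.
  have Ap : 0 < nr (A u) by rewrite lt_def A0 hnorm_ge0.
  rewrite -(ler_pM2r Ap) -expr2 sqr_hnorm -Ab.
  apply: le_trans (Re_le_normc _) _; apply: le_trans (bM _ _) _.
  rewrite ler_pM2r// ler_wpM2r ?hnorm_ge0//.
  by apply: le_trans (ler_norm _) _; rewrite lerDl ltW.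
(* Since p(A u, .) = b(u, .), this T is a contraction. *)
pose r := g / m ^+ 2; pose T u := u - r%:C *: A u.
have r0 : 0 < r by rewrite divr_gt0// exprn_gt0.
have Tlin : linear_to T.
  move=> a u v; rewrite /T Alin !scalerDr !scalerN !scalerA (mulrC _ a).
  by rewrite opprD addrACA.
have gm : g ^+ 2 / m ^+ 2 <= 1.
  rewrite ler_pdivrMr ?exprn_gt0// mul1r ler_pXn2r ?nnegrE ?(ltW m0) ?(ltW g0)//.
  by rewrite lerDr.
(* |T v|^2 is at most (1 - 2 r g + r^2 m^2) |v|^2; the factor is least at r = g/m^2, where it equals
   q^2. *)
pose q := Num.sqrt (1 - g ^+ 2 / m ^+ 2).
have q1 : q < 1.
  rewrite -sqrtr1 ltr_sqrt// ltrBlDr ltrDl divr_gt0// exprn_gt0//.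
have qE : q ^+ 2 = 1 - g ^+ 2 / m ^+ 2 by rewrite sqr_sqrtr ?subr_ge0.
have Tq v : nr (T v) <= q * nr v.
  rewrite -(ler_pXn2r (_ : 0 < 2)%N) ?nnegrE ?mulr_ge0 ?sqrtr_ge0 ?hnorm_ge0//.
  rewrite exprMn qE /T sqr_hnormD sipNr hnormN hnormZ sipZr.
  rewrite (normc_real (ltW r0)) conjc_real.
  have -> : complex.Re (- (r%:C * p v (A v))) = - r * complex.Re (b v v).
    by rewrite Ab (sip_herm p v (A v)); case: (p v (A v)) => x y /=; ring.
  have h1 := AM v; have h2 := bg v.
  have h3 : nr (A v) ^+ 2 <= m ^+ 2 * nr v ^+ 2.
    by rewrite -exprMn ler_pXn2r ?nnegrE ?mulr_ge0 ?hnorm_ge0// ltW.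
  have h4 : r ^+ 2 * nr (A v) ^+ 2 <= r ^+ 2 * (m ^+ 2 * nr v ^+ 2).
    by rewrite ler_wpM2l ?sqr_ge0.
  have h5 : r * (g * nr v ^+ 2) <= r * complex.Re (b v v) by rewrite ler_pM2l.
  have h6 : r ^+ 2 * (m ^+ 2 * nr v ^+ 2) = r * (g * nr v ^+ 2).
    by rewrite /r; field; rewrite gt_eqF.
  have h7 : g ^+ 2 / m ^+ 2 * nr v ^+ 2 = r * (g * nr v ^+ 2).
    by rewrite /r; field; rewrite gt_eqF.
  by rewrite exprMn mulrBl h7 mul1r; lra.
have [u uE] := neumann_series Tlin q1 Tq (r%:C *: f).
exists u => v; rewrite Ab fF; congr (p _ v).
have rn0 : r%:C != 0 :> R[i] by apply/eqP => -[] /eqP; rewrite gt_eqF.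
apply: (scalerI rn0); apply/eqP; rewrite -subr_eq0; apply/eqP.
move: uE; rewrite /T -addrA -{1}[u]addr0 => /addrI.
by move/eqP; rewrite eq_sym addrC subr_eq0 => /eqP ->; rewrite subrr.
Qed.

End semi_inner_product.

Section linear_to_theory.
Context {R : realType} {V W : lmodType R[i]} (F : V -> W) (Fl : linear_to F).

Lemma linear_toD u v : F (u + v) = F u + F v.
Proof. by have := Fl 1 u v; rewrite !scale1r. Qed.

Lemma linear_to0 : F 0 = 0.
Proof. by apply: (addrI (F 0)); rewrite -linear_toD !addr0. Qed.

Lemma linear_toZ a u : F (a *: u) = a *: F u.
Proof. by have := Fl a u 0; rewrite linear_to0 !addr0. Qed.

Lemma linear_toN u : F (- u) = - F u.
Proof. by rewrite -scaleN1r linear_toZ scaleN1r. Qed.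

Lemma linear_toB u v : F (u - v) = F u - F v.
Proof. by rewrite linear_toD linear_toN. Qed.

End linear_to_theory.

(** * Resolvents of elliptic forms *)

Section elliptic_resolvent.
Context {R : realType} {V X : lmodType R[i]}.
Variables (pV : sip (V := V)) (pX : sip (V := X)) (j : V -> X).
Local Notation nV := (hnorm pV).
Local Notation nX := (hnorm pX).
Implicit Types (u v w : V) (x y : X) (lambda : R[i]).

Definition sesquilinear (b : V -> V -> R[i]) :=
  (forall a u v w, b (a *: u + v) w = a * b u w + b v w) /\
  forall u, antilinear (b u).

Definition bounded_form (b : V -> V -> R[i]) :=
  exists M, forall u v, normc (b u v) <= M * nV u * nV v.

(** Here [c] is the shift that makes b + c <j ., j .> coercive; its sign is opposite to the one in
    [elliptic_form]. *)
Definition garding (b : V -> V -> R[i]) :=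
  exists g c : R, 0 < g /\ forall u, g * nV u ^+ 2 <= complex.Re (b u u) + c * nX (j u) ^+ 2.

Definition elliptic_sesq b := [/\ sesquilinear b, bounded_form b & garding b].

(** [F] is <x, j v> for the resolvent equation and p(f, G v) for a boundary value problem. *)
Definition weak_sol (b : V -> V -> R[i]) lambda u (F : V -> R[i]) :=
  forall v, b u v - lambda * pX (j u) (j v) = F v.

(** Uniqueness is contained in the bound: x = 0 forces |j u| = 0, and the energy estimate then gives
    u = 0. *)
Definition resolvent_point b lambda :=
  (forall x, exists u, weak_sol b lambda u (fun v => pX x (j v))) /\
  exists M : R, forall x u, weak_sol b lambda u (fun v => pX x (j v)) ->
    nX (j u) <= M * nX x.

Hypotheses (V_def : definite pV) (V_complete : complete pV)
  (j_lin : linear_to j) (j_le : forall u, nX (j u) <= nV u).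

Lemma weak_solZD b lambda a u v F H : sesquilinear b ->
  weak_sol b lambda u F -> weak_sol b lambda v H ->
  weak_sol b lambda (a *: u + v) (fun w => a * F w + H w).
Proof.
move=> [bl _] uF vH w; rewrite bl j_lin sip_lin -uF -vH; ring.
Qed.

Lemma weak_solZ b lambda a u F : sesquilinear b ->
  weak_sol b lambda u F -> weak_sol b lambda (a *: u) (fun w => a * F w).
Proof.
move=> [bl _] uF w; have b0 : b 0 w = 0.
  by have := bl (-1) 0 0 w; rewrite scaler0 addr0 mulN1r addNr.
have := bl a u 0 w; rewrite b0 !addr0 => ->.
by rewrite (linear_toZ j_lin) sipZl -uF; ring.
Qed.

Lemma weak_solB b lambda u v F H : sesquilinear b ->
  weak_sol b lambda u F -> weak_sol b lambda v H ->
  weak_sol b lambda (u - v) (fun w => F w - H w).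
Proof.
move=> bs uF vH w; have := weak_solZD (-1) bs vH uF w.
by rewrite scaleN1r (addrC (- v)) => ->; rewrite mulN1r addrC.
Qed.

Lemma antilinear_ip x : antilinear (fun v => pX x (j v)).
Proof. by move=> a u v; rewrite j_lin sip_linr. Qed.

Lemma ip_bound x v : normc (pX x (j v)) <= nX x * nV v.
Proof.
by apply: le_trans (cauchy_schwarz _ _ _) _; rewrite ler_wpM2l ?hnorm_ge0.
Qed.

(* Since F = 0 and j u = 0 imply u = 0, injectivity of j is never needed. *)
Lemma weak_sol_energy b lambda : garding b -> exists2 K : R, 0 <= K & forall u F (N : R),
  0 <= N -> (forall v, normc (F v) <= N * nV v) -> weak_sol b lambda u F ->
  nV u <= K * (N + nX (j u)).
Proof.
move=> [g [c [g0 bg]]]; pose k := normc lambda + `|c|.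
have k0 : 0 <= k by rewrite addr_ge0 ?normc_ge0.
have K0 : 0 <= (1 + k) / g by rewrite divr_ge0 ?(ltW g0)// addr_ge0.
exists ((1 + k) / g) => // u F N N0 FN uF.
have n0 := hnorm_ge0 pV u; have x0 := hnorm_ge0 pX (j u); have jn := j_le u.
have [/eqP nu|nu] := eqVneq (nV u) 0.
  by rewrite (eqP nu) mulr_ge0// addr_ge0.
have {}nu : 0 < nV u by rewrite lt_def nu.
have := bg u; have := uF u => /eqP; rewrite subr_eq => /eqP ->.
rewrite sip_self ReD => h.
have h1 := le_trans (Re_le_normc _) (FN u).
have h2 : complex.Re (lambda * (nX (j u) ^+ 2)%:C) <= normc lambda * nX (j u) ^+ 2.
  by apply: le_trans (Re_le_normc _) _; rewrite normcM normc_real ?sqr_ge0.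
have h3 : c * nX (j u) ^+ 2 <= `|c| * nX (j u) ^+ 2.
  by rewrite ler_wpM2r ?sqr_ge0// ler_norm.
(* One factor |j u| is traded for |u|, so that |u| cancels and a bound linear in N and |j u|
   remains. *)
have h4 : k * nX (j u) ^+ 2 <= k * nX (j u) * nV u.
  by rewrite expr2 mulrA ler_wpM2l// mulr_ge0.
have h5 : g * nV u * nV u <= (N + k * nX (j u)) * nV u.
  by move: h h1 h2 h3 h4; rewrite /k expr2; lra.
move: h5; rewrite ler_pM2r// => h5.
rewrite mulrAC ler_pdivlMr// mulrC; apply: le_trans h5 _.
by have := mulr_ge0 k0 N0; lra.
Qed.

(** The hypothesis controls only [j u], for data from [X]; the energy estimate raises this to a
    bound in the norm of [V], as the trace requires. *)
Lemma resolvent_solve b lambda : elliptic_sesq b -> resolvent_point b lambda ->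
  exists2 K : R, 0 <= K & forall F (N : R), antilinear F -> 0 <= N ->
    (forall v, normc (F v) <= N * nV v) ->
    (exists u, weak_sol b lambda u F) /\
    forall u, weak_sol b lambda u F -> nV u <= K * N.
Proof.
move=> [bs [Mb bM] bg] [rex [M rM]].
have [K K0 KP] := weak_sol_energy lambda bg.
have uniq0 u : weak_sol b lambda u (fun=> 0) -> u = 0.
  move=> u0; have ju : nX (j u) <= 0.
    rewrite -(mulr0 M) -(hnorm0 pX); apply: rM => v.
    by rewrite u0 sip0l.
  apply: V_def; apply/le_anti; rewrite hnorm_ge0 andbT.
  apply: le_trans (KP u _ 0 _ _ u0) _ => //; first by move=> v; rewrite normc0 mul0r.
  by rewrite add0r mulr_ge0_le0.
have uniq u v F : weak_sol b lambda u F -> weak_sol b lambda v F -> u = v.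
  move=> uF vF; apply/eqP; rewrite -subr_eq0; apply/eqP/uniq0 => w.
  by rewrite (weak_solB bs uF vF) subrr.
case: (bg) => g [c [g0 gb]].
pose m := normc (lambda + c%:C).
pose K1 := K * (m * (g^-1 + `|M| * (m * g^-1))).
(* The coercive problem gives |u0| <= N/g. The correction u1 has the datum (lambda + c) j u0, of
   norm at most m N/g, and K (1 + |M|) times this bounds u1. *)
pose K2 := g^-1 + K * (m * g^-1 + `|M| * (m * g^-1)).
have m0 : 0 <= m by exact: normc_ge0.
have gi0 : 0 <= g^-1 by rewrite invr_ge0 ltW.
exists K2 => [|F N Fl N0 FN].
  by rewrite addr_ge0// mulr_ge0// addr_ge0// !mulr_ge0.
(* u0 solves the problem for the coercive form b'; the resolvent at lambda then
   removes the shift. *)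
pose b' u v := b u v + c%:C * pX (j u) (j v).
have [u0 u0P] : exists u, forall v, b' u v = F v.
  apply: (@lax_milgram _ _ pV V_def V_complete b' (Mb + `|c|) g F N) => //.
  - by move=> a u v w; rewrite /b' bs.1 j_lin sip_lin; ring.
  - by move=> u a v w; rewrite /b' bs.2 j_lin sip_linr; ring.
  - move=> u v; apply: le_trans (le_normcD _ _) _; rewrite normcM !mulrDl lerD//.
    have -> : normc c%:C = `|c| by rewrite /= expr0n addr0 sqrtr_sqr.
    rewrite -mulrA ler_wpM2l//; apply: le_trans (cauchy_schwarz _ _ _) _.
    by rewrite ler_pM ?hnorm_ge0.
  - move=> u; rewrite /b' ReD sip_self.
    have -> : complex.Re (c%:C * (nX (j u) ^+ 2)%:C) = c * nX (j u) ^+ 2.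
      by rewrite /=; ring.
    exact: gb.
have u0n : nV u0 <= g^-1 * N.
  have [/eqP nu|nu] := eqVneq (nV u0) 0; first by rewrite (eqP nu) mulr_ge0.
  have {}nu : 0 < nV u0 by rewrite lt_def nu hnorm_ge0.
  rewrite mulrC ler_pdivlMr// -(ler_pM2r nu) mulrAC -expr2 mulrC.
  apply: le_trans (FN u0); rewrite -u0P; apply: le_trans (Re_le_normc _).
  rewrite /b' ReD sip_self.
  have -> : complex.Re (c%:C * (nX (j u0) ^+ 2)%:C) = c * nX (j u0) ^+ 2.
    by rewrite /=; ring.
  exact: gb.
have [u1 u1P] := rex ((lambda + c%:C) *: j u0).
have uP : weak_sol b lambda (u0 + u1) F.
  move=> v; have := u1P v; have := u0P v; rewrite /b' sipZl => h1 h2.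
  have := bs.1 1 u0 u1 v; rewrite scale1r mul1r => ->.
  rewrite (linear_toD j_lin) sipDl -h1.
  rewrite (_ : b u1 v = (lambda + c%:C) * pX (j u0) (j v) + lambda * pX (j u1) (j v)).
    by ring.
  by rewrite -h2 subrK.
have ju0 : nX ((lambda + c%:C) *: j u0) <= m * (g^-1 * N).
  by rewrite hnormZ ler_wpM2l//; apply: le_trans (j_le _) _.
have u1n : nV u1 <= K * (m * (g^-1 * N) + `|M| * (m * (g^-1 * N))).
  apply: le_trans (KP u1 _ (nX ((lambda + c%:C) *: j u0)) _ _ u1P) _.
  - exact: hnorm_ge0.
  - exact: ip_bound.
  rewrite ler_wpM2l// lerD//; apply: le_trans (rM _ _ u1P) _.
  apply: (@le_trans _ _ (`|M| * nX ((lambda + c%:C) *: j u0))).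
    by rewrite ler_wpM2r ?hnorm_ge0// ler_norm.
  by rewrite ler_wpM2l.
split=> [|u uF]; first by exists (u0 + u1).
rewrite (uniq _ _ _ uF uP); apply: le_trans (ler_hnormD _ _ _) _.
rewrite (_ : K2 * N = g^-1 * N + K * (m * (g^-1 * N) + `|M| * (m * (g^-1 * N)))).
  by rewrite lerD.
by rewrite /K2; ring.
Qed.

Lemma weak_sol_unique b lambda u v F : elliptic_sesq b -> resolvent_point b lambda ->
  weak_sol b lambda u F -> weak_sol b lambda v F -> u = v.
Proof.
move=> be bl uF vF; have [K _ KP] := resolvent_solve be bl.
have [bs _ _] := be; have uv := weak_solB bs uF vF.
apply/eqP; rewrite -subr_eq0; apply/eqP/V_def/le_anti; rewrite hnorm_ge0 andbT.
have z0 : antilinear (fun _ : V => 0 : R[i]) by move=> a x y; rewrite mulr0 addr0.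
have zn (x : V) : normc (0 : R[i]) <= 0 * nV x by rewrite normc0 mul0r.
have := (KP _ 0 z0 (lexx _) zn).2 (u - v).
by rewrite mulr0; apply => w; rewrite uv subrr.
Qed.

(** A solution at z with datum x is a solution at lambda with datum x + (z - lambda) j u. This
    fixed-point equation is contractive once |z - lambda| K < 1; the radius uses K + 1 because K may
    be 0. *)
Lemma resolvent_open b lambda : elliptic_sesq b -> resolvent_point b lambda ->
  exists2 r : R, 0 < r & forall z, normc (z - lambda) < r -> resolvent_point b z.
Proof.
move=> be bl; have [K K0 KP] := resolvent_solve be bl.
have [bs _ _] := be.
have TP x : (exists u, weak_sol b lambda u (fun v => pX x (j v))) /\
    forall u, weak_sol b lambda u (fun v => pX x (j v)) -> nV u <= K * nX x.
  by apply: KP; [exact: antilinear_ip|exact: hnorm_ge0|exact: ip_bound].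
have [T TE] := choice (fun x => (TP x).1).
have Tlin : linear_to T.
  move=> a x y; apply: (weak_sol_unique be bl (TE _)) => v.
  by rewrite (weak_solZD a bs (TE x) (TE y)) sip_lin.
have K10 : 0 < K + 1 by rewrite ltr_wpDl.
exists (K + 1)^-1 => [|z zr]; first by rewrite invr_gt0.
pose d := normc (z - lambda); have d0 : 0 <= d := normc_ge0 _.
have dK : d * K < 1.
  apply: (@le_lt_trans _ _ (d * (K + 1))); first by rewrite ler_wpM2l// lerDl.
  by rewrite -ltr_pdivlMr// div1r.
have shift x u : weak_sol b z u (fun v => pX x (j v)) <->
    weak_sol b lambda u (fun v => pX (x + (z - lambda) *: j u) (j v)).
  split=> h v; have := h v; rewrite sipDl sipZl => e.
    by rewrite -e; ring.
  by apply: (addIr ((z - lambda) * pX (j u) (j v))); rewrite -e; ring.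
split=> [x|].
  pose S u := T ((z - lambda) *: j u).
  have Slin : linear_to S.
    by move=> a u v; rewrite /S j_lin scalerDr scalerA mulrC -scalerA Tlin.
  have Sq v : nV (S v) <= d * K * nV v.
    apply: le_trans ((TP _).2 _ (TE _)) _; rewrite hnormZ mulrCA -mulrA.
    by rewrite !ler_wpM2l.
  have [u uE] := neumann_series V_def V_complete Slin dK Sq (T x).
  exists u; apply/shift; rewrite {1}uE /S -(linear_toD Tlin) addrC; exact: TE.
(* This is |j u| <= K (|x| + d |j u|) solved for |j u|. *)
exists (K / (1 - d * K)) => x u /shift/((TP _).2) h.
have dK' : 0 < 1 - d * K by rewrite subr_gt0.
rewrite mulrAC ler_pdivlMr// mulrBr mulr1 lerBlDr.
apply: le_trans (j_le u) _; apply: le_trans h _.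
rewrite mulrC; apply: le_trans (ler_wpM2r K0 (ler_hnormD _ _ _)) _.
by rewrite hnormZ mulrDl -/d le_eqVlt; apply/orP; left; apply/eqP; ring.
Qed.

(** The first-order derivative estimate for z |-> w(z). At lambda, w - u has the datum (z - lambda)
    j w, and the remainder has the datum (z - lambda) j (w - u). Each passage costs a factor K |z -
    lambda|; the third K comes from |u| <= K N, and the 2 from absorbing w - u when |z - lambda| K
    <= 1/2. *)
Lemma resolvent_derivative b lambda : elliptic_sesq b -> resolvent_point b lambda ->
  exists2 K : R, 0 <= K & forall F (N : R) u, antilinear F -> 0 <= N ->
    (forall v, normc (F v) <= N * nV v) -> weak_sol b lambda u F ->
    forall u', weak_sol b lambda u' (fun v => pX (j u) (j v)) ->
    forall z w, normc (z - lambda) * K <= 2^-1 -> weak_sol b z w F ->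
      nV (w - u - (z - lambda) *: u') <= 2 * K ^+ 3 * normc (z - lambda) ^+ 2 * N.
Proof.
move=> be bl; have [K K0 KP] := resolvent_solve be bl.
have [bs _ _] := be.
have TP x u : weak_sol b lambda u (fun v => pX x (j v)) -> nV u <= K * nX x.
  by apply: (KP _ _ _ _ _).2; [exact: antilinear_ip|exact: hnorm_ge0|exact: ip_bound].
exists K => // F N u Fl N0 FN uF u' u'u z w; set d := normc _ => dK wF.
have d0 : 0 <= d := normc_ge0 _.
have un : nV u <= K * N := (KP F N Fl N0 FN).2 _ uF.
have wu : weak_sol b lambda (w - u) (fun v => pX ((z - lambda) *: j w) (j v)).
  move=> v; have wl : weak_sol b lambda w (fun v => F v + (z - lambda) * pX (j w) (j v)).
    by move=> v'; rewrite -wF; ring.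
  by rewrite (weak_solB bs wl uF) sipZl; ring.
have wun : nV (w - u) <= K * (d * nV w).
  apply: le_trans (TP _ _ wu) _; rewrite hnormZ ler_wpM2l// ler_wpM2l//.
have wn : nV w <= 2 * (K * N).
  have : nV w <= nV (w - u) + nV u by rewrite -{1}(subrK u w) ler_hnormD.
  have : d * K * nV w <= 2^-1 * nV w by rewrite ler_wpM2r ?hnorm_ge0.
  by rewrite mulrCA mulrA in wun; lra.
have eqn : weak_sol b lambda (w - u - (z - lambda) *: u')
    (fun v => pX ((z - lambda) *: j (w - u)) (j v)).
  move=> v; have := weak_solZD (- (z - lambda)) bs u'u wu v.
  rewrite (addrC (_ *: u')) scaleNr => ->.
  by rewrite (linear_toB j_lin) !sipZl sipBl; ring.
apply: le_trans (TP _ _ eqn) _; rewrite hnormZ -/d.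
apply: (@le_trans _ _ (K * (d * (K * (d * (2 * (K * N))))))).
  rewrite ler_wpM2l// ler_wpM2l//; apply: le_trans (j_le _) _.
  by apply: le_trans wun _; rewrite !ler_wpM2l.
by rewrite le_eqVlt; apply/orP; left; apply/eqP; ring.
Qed.

End elliptic_resolvent.

(** * Boundary data, and the passage between the Neumann and the i R problem *)

Section robin.
Context {R : realType} {V X B : lmodType R[i]}.
Variables (pV : sip (V := V)) (pX : sip (V := X)) (pB : sip (V := B)).
Variables (j : V -> X) (G : V -> B) (MG : R).
Local Notation nV := (hnorm pV).
Local Notation nX := (hnorm pX).
Local Notation nB := (hnorm pB).
Implicit Types (u v w : V) (x y : X) (f g : B) (lambda : R[i]).

Hypotheses (V_def : definite pV) (V_complete : complete pV)
  (j_lin : linear_to j) (j_le : forall u, nX (j u) <= nV u)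
  (G_lin : linear_to G) (G_bound : forall u, nB (G u) <= MG * nV u) (MG_ge0 : 0 <= MG).

Local Notation elliptic := (elliptic_sesq pV pX j).
Local Notation regular := (resolvent_point pX j).
Local Notation weak := (weak_sol pX j).

Definition boundary_data f v : R[i] := pB f (G v).

Definition robin_form (b : V -> V -> R[i]) u v : R[i] := b u v + 'i%C * pB (G u) (G v).

Lemma boundary_data_antilinear f : antilinear (boundary_data f).
Proof. by move=> a u v; rewrite /boundary_data G_lin sip_linr. Qed.

Lemma boundary_data_bound f v :
  normc (boundary_data f v) <= (nB f * MG) * nV v.
Proof.
apply: le_trans (cauchy_schwarz _ _ _) _; rewrite -mulrA.
by rewrite ler_wpM2l ?hnorm_ge0.
Qed.

Lemma boundary_data_bound_ge0 f : 0 <= nB f * MG.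
Proof. by rewrite mulr_ge0 ?hnorm_ge0. Qed.

(** The boundary term adds i |G u|^2 to the quadratic form. This has zero real part, so Garding's
    inequality keeps its constants. *)
Lemma robin_elliptic b : elliptic b -> elliptic (robin_form b).
Proof.
move=> [[bl br] [M bM] [g [c [g0 gb]]]]; split.
- split=> [a u v w|u a v w].
    by rewrite /robin_form bl G_lin sip_lin; ring.
  by rewrite /robin_form br G_lin sip_linr; ring.
- exists (M + MG * MG) => u v; apply: le_trans (le_normcD _ _) _.
  rewrite !mulrDl lerD//; rewrite normcM normc_i mul1r.
  apply: le_trans (cauchy_schwarz _ _ _) _.
  apply: (@le_trans _ _ ((MG * nV u) * (MG * nV v))).
    by rewrite ler_pM ?hnorm_ge0.
  by rewrite le_eqVlt; apply/orP; left; apply/eqP; ring.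
- exists g, c; split=> // u; rewrite /robin_form ReD sip_self.
  by rewrite (_ : complex.Re ('i%C * _) = 0) ?addr0//= mul0r mul1r subrr.
Qed.

Lemma weak_sol_robin b lambda u (F : V -> R[i]) :
  weak (robin_form b) lambda u F <->
  weak b lambda u (fun v => F v - 'i%C * pB (G u) (G v)).
Proof.
split=> h v; have := h v; rewrite /robin_form => e; first by rewrite -e; ring.
by apply: (addIr (- ('i%C * pB (G u) (G v)))); rewrite -e; ring.
Qed.

Lemma boundary_solution b lambda : elliptic b -> regular b lambda ->
  exists2 K : R, 0 <= K & forall f,
    (exists u, weak b lambda u (boundary_data f)) /\
    forall u, weak b lambda u (boundary_data f) -> nV u <= K * nB f.
Proof.
move=> be bl; have [K K0 KP] := resolvent_solve V_def V_complete j_lin j_le be bl.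
exists (K * MG) => [|f]; first by rewrite mulr_ge0.
have [ex bd] := KP _ _ (boundary_data_antilinear f) (boundary_data_bound_ge0 f)
  (boundary_data_bound f).
by split=> // u /bd; rewrite -mulrA (mulrC MG).
Qed.

Lemma boundary_solution_linear b lambda (S : B -> V) : elliptic b -> regular b lambda ->
  (forall f, weak b lambda (S f) (boundary_data f)) -> linear_to S.
Proof.
move=> be bl SP a f g; apply: (weak_sol_unique V_def V_complete j_lin j_le be bl (SP _)).
move=> v; have [bs _ _] := be.
by rewrite (weak_solZD j_lin a bs (SP f) (SP g)) /boundary_data sip_lin.
Qed.

(** With T the resolvent at lambda, the derivative of z |-> G S_z is G T j S. *)
Lemma trace_derivative b lambda (S : B -> V) : elliptic b -> regular b lambda ->
  (forall f, weak b lambda (S f) (boundary_data f)) ->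
  exists D : B -> B, [/\ linear_to D,
    exists2 M : R, 0 <= M & forall f, nB (D f) <= M * nB f &
    forall e : R, 0 < e -> exists2 r : R, 0 < r & forall z, normc (z - lambda) < r ->
      forall f u, weak b z u (boundary_data f) ->
        nB (G u - G (S f) - (z - lambda) *: D f) <= e * normc (z - lambda) * nB f].
Proof.
move=> be bl SP; have Sl := boundary_solution_linear be bl SP.
have [bs _ _] := be.
have [K1 K10 K1P] := boundary_solution be bl.
have [K2 K20 K2P] := resolvent_solve V_def V_complete j_lin j_le be bl.
have [K K0 KP] := resolvent_derivative V_def V_complete j_lin j_le be bl.
have K2X x : (exists u, weak b lambda u (fun v => pX x (j v))) /\
    forall u, weak b lambda u (fun v => pX x (j v)) -> nV u <= K2 * nX x.
  exact: (K2P _ _ (antilinear_ip pX j_lin x) (hnorm_ge0 pX x) (ip_bound j_le x)).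
have [T TP] := choice (fun x => (K2X x).1).
have Tl : linear_to T.
  move=> a x y; apply: (weak_sol_unique V_def V_complete j_lin j_le be bl (TP _)) => v.
  by rewrite (weak_solZD j_lin a bs (TP x) (TP y)) sip_lin.
exists (fun f => G (T (j (S f)))); split=> [a f g||e e0].
- by rewrite Sl j_lin Tl G_lin.
- exists (MG * (K2 * K1)) => [|f]; first by rewrite !mulr_ge0.
  apply: le_trans (G_bound _) _; rewrite -!mulrA ler_wpM2l//.
  apply: le_trans ((K2X _).2 _ (TP _)) _; rewrite ler_wpM2l//.
  by apply: le_trans (j_le _) _; exact: (K1P f).2 _ (SP f).
(* One factor MG comes from taking the trace, the other from the norm of the boundary datum; the
   remainder is at most c d^2 |f|. *)
pose c := MG * (2 * K ^+ 3) * MG.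
have c0 : 0 <= c by rewrite !mulr_ge0// exprn_ge0.
have K10' : 0 < 2 * (K + 1) by rewrite mulr_gt0// ltr_wpDl.
have c10 : 0 < c + 1 by rewrite ltr_wpDl.
(* The first radius gives d K <= 1/2, as [resolvent_derivative] asks; the second gives c d <= e. *)
exists (Num.min (2 * (K + 1))^-1 (e / (c + 1))) => [|z].
  by rewrite lt_min invr_gt0 K10' divr_gt0.
rewrite lt_min => /andP[d1 d2] f u uf; set d := normc _ in d1 d2 *.
have d0 : 0 <= d := normc_ge0 _.
have dK : d * K <= 2^-1.
  move/ltW: d1; rewrite -[X in _ <= X]div1r ler_pdivlMr// => d1.
  by rewrite -[X in _ <= X]div1r ler_pdivlMr//; nra.
have h := KP _ _ _ (boundary_data_antilinear f) (boundary_data_bound_ge0 f)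
  (boundary_data_bound f) (SP f) _ (TP _) z u dK uf.
rewrite -(linear_toZ G_lin) -!(linear_toB G_lin); apply: le_trans (G_bound _) _.
apply: le_trans (ler_wpM2l MG_ge0 h) _; rewrite -/d.
have cd : c * d <= e.
  move/ltW: d2; rewrite ler_pdivlMr// => d2; nra.
rewrite (_ : MG * _ = c * d * (d * nB f)); last by rewrite /c; ring.
by rewrite -(mulrA e) ler_wpM2r// mulr_ge0// hnorm_ge0.
Qed.

(** Covers N R - i, its inverse and 2 i N_{iR} R - 1 at once, with (a, c) equal to (1, -i), (1, i)
    and (2 i, -1). *)
Lemma affine_trace b lambda (S : B -> V) (a c : R[i]) : elliptic b -> regular b lambda ->
  (forall f, weak b lambda (S f) (boundary_data f)) ->
  linear_to (fun f => a *: G (S f) + c *: f) /\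
  exists2 M : R, 0 <= M & forall f, nB (a *: G (S f) + c *: f) <= M * nB f.
Proof.
move=> be bl SP; have Sl := boundary_solution_linear be bl SP.
have [K K0 KP] := boundary_solution be bl; split=> [z f g|].
  rewrite Sl G_lin !scalerDr addrACA !scalerA (mulrC a) (mulrC c).
  by rewrite -!scalerA.
exists (normc a * (MG * K) + normc c) => [|f].
  by rewrite addr_ge0 ?mulr_ge0 ?normc_ge0.
apply: le_trans (ler_hnormD _ _ _) _; rewrite !hnormZ mulrDl lerD// -!mulrA.
rewrite ler_wpM2l ?normc_ge0//; apply: le_trans (G_bound _) _; rewrite ler_wpM2l//.
exact: (KP f).2 _ (SP f).
Qed.

Lemma affine_trace_derivative b lambda (S : B -> V) (a : R[i]) :
  elliptic b -> regular b lambda ->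
  (forall f, weak b lambda (S f) (boundary_data f)) ->
  exists D : B -> B, [/\ linear_to D,
    exists2 M : R, 0 <= M & forall f, nB (D f) <= M * nB f &
    forall e : R, 0 < e -> exists2 r : R, 0 < r & forall z, normc (z - lambda) < r ->
      forall f u, weak b z u (boundary_data f) ->
        nB ((a *: G u - f) - (a *: G (S f) - f) - (z - lambda) *: D f)
          <= e * normc (z - lambda) * nB f].
Proof.
move=> be bl SP; have [D [Dl [M M0 DM] DP]] := trace_derivative be bl SP.
exists (fun f => a *: D f); split=> [c f g||e e0].
- by rewrite Dl scalerDr !scalerA mulrC.
- exists (normc a * M) => [|f]; first by rewrite mulr_ge0 ?normc_ge0.
  by rewrite hnormZ -mulrA ler_wpM2l ?normc_ge0.
have a0 : 0 < normc a + 1 by rewrite ltr_wpDl ?normc_ge0.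
have [r r0 rP] := DP _ (divr_gt0 e0 a0); exists r => // z zr f u uf.
rewrite opprB subrKA !scalerA (mulrC _ a) -!scalerA -!scalerBr hnormZ.
apply: le_trans (ler_wpM2l (normc_ge0 a) (rP z zr f u uf)) _.
rewrite !mulrA !ler_wpM2r ?hnorm_ge0 ?normc_ge0//.
by rewrite -mulrA mulrCA ler_piMr ?(ltW e0)// ler_pdivrMr// mul1r lerDl.
Qed.

(** Here g is the trace of the i R solution and h = K^{-1} f with K = N R - i. Since N R h = K h + i
    h = f + i h, the left-hand side is (N R + i) h. *)
Lemma cayley_identity (f g : B) :
  let h := g + 'i%C *: f in f + 'i%C *: h + 'i%C *: h = (2 * 'i%C) *: g - f.
Proof.
have ii : 2 * 'i%C * 'i%C = - 2 :> R[i] by rewrite -mulrA -expr2 sqr_i mulrN1.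
rewrite /= -addrA -scalerDl (_ : 'i%C + 'i%C = 2 * 'i%C); last by ring.
rewrite scalerDr scalerA ii scaleNr addrCA; congr (_ + _).
by rewrite scaler_nat mulr2n opprD addrA subrr add0r.
Qed.

Section cayley.
Variables (b : V -> V -> R[i]) (lambda : R[i]) (S0 S1 : B -> V).
Hypothesis b_elliptic : elliptic b.
Hypothesis neumann_solutionP : forall f, weak b lambda (S0 f) (boundary_data f).

Definition neumann_minus_i f : B := G (S0 f) - 'i%C *: f.

Lemma weak_sol_trace u f : weak (robin_form b) lambda u (boundary_data f) <->
  weak b lambda u (boundary_data (f - 'i%C *: G u)).
Proof.
rewrite weak_sol_robin; split=> h v; have := h v;
  by rewrite /boundary_data sipBl sipZl.
Qed.

Lemma robin_rightK : regular b lambda ->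
  (forall f, weak (robin_form b) lambda (S1 f) (boundary_data f)) ->
  cancel (fun f => G (S1 f) + 'i%C *: f) neumann_minus_i.
Proof.
move=> bl robin_solutionP f; rewrite /neumann_minus_i.
have S0l := boundary_solution_linear b_elliptic bl neumann_solutionP.
set u := S1 f; set g := f - 'i%C *: G u.
(* G u + i f is i times the Neumann datum g of u, so its Neumann solution is i u and K maps it to i
   G u + g = f. *)
have -> : G u + 'i%C *: f = 'i%C *: g.
  by rewrite scalerBr scalerA -expr2 sqr_i scaleN1r opprK addrC.
have -> : S0 ('i%C *: g) = 'i%C *: u.
  rewrite (linear_toZ S0l); congr (_ *: _).
  apply: (weak_sol_unique V_def V_complete j_lin j_le b_elliptic bl (neumann_solutionP _)).
  exact/weak_sol_trace/robin_solutionP.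
by rewrite (linear_toZ G_lin) scalerA -expr2 sqr_i scaleN1r opprK addrC subrK.
Qed.

Lemma robin_leftK : regular (robin_form b) lambda ->
  (forall f, weak (robin_form b) lambda (S1 f) (boundary_data f)) ->
  cancel neumann_minus_i (fun f => G (S1 f) + 'i%C *: f).
Proof.
move=> bl robin_solutionP f; rewrite /neumann_minus_i.
(* As an i R solution with datum h = G S0 f - i f, the element -i S0 f must have the Neumann datum h
   - i G (-i S0 f) = -i f, which it has. *)
have -> : S1 (G (S0 f) - 'i%C *: f) = - 'i%C *: S0 f.
  have re := robin_elliptic b_elliptic.
  apply: (weak_sol_unique V_def V_complete j_lin j_le re bl (robin_solutionP _)).
  apply/weak_sol_trace => v; have [bs _ _] := b_elliptic.
  rewrite (weak_solZ j_lin (- 'i%C) bs (neumann_solutionP f)) /boundary_data -sipZl.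
  congr (pB _ _); rewrite (linear_toZ G_lin) scalerA mulrN -expr2 sqr_i opprK scale1r.
  by rewrite addrAC subrr add0r scaleNr.
rewrite (linear_toZ G_lin) scalerBr scalerA -expr2 sqr_i scaleNr scaleN1r opprK.
by rewrite addrA addNr add0r.
Qed.

(** With v0 the Neumann solution for x, the i R problem reads u = v0 + S0 (-i G u). Taking traces
    reduces it to K (G u) = -i G v0 on the boundary, which [K'] solves with a bound. *)
Lemma robin_regular (K' : B -> B) (C : R) : regular b lambda ->
  (forall f, nB (K' f) <= C * nB f) ->
  cancel neumann_minus_i K' -> cancel K' neumann_minus_i ->
  regular (robin_form b) lambda.
Proof.
move=> bl K'C KK' K'K; have [bs _ _] := b_elliptic.
have S0l := boundary_solution_linear b_elliptic bl neumann_solutionP.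
have [K1 K10 K1P] := resolvent_solve V_def V_complete j_lin j_le b_elliptic bl.
have [K2 K20 K2P] := boundary_solution b_elliptic bl.
have K1X x : (exists u, weak b lambda u (fun v => pX x (j v))) /\
    forall u, weak b lambda u (fun v => pX x (j v)) -> nV u <= K1 * nX x.
  exact: (K1P _ _ (antilinear_ip pX j_lin x) (hnorm_ge0 pX x) (ip_bound j_le x)).
have superpose v0 f x : weak b lambda v0 (fun v => pX x (j v)) ->
    weak b lambda (v0 + S0 f) (fun v => pX x (j v) + boundary_data f v).
  move=> v0x v; have := weak_solZD j_lin 1 bs v0x (neumann_solutionP f) v.
  by rewrite scale1r mul1r.
split=> [x|].
  have [[v0 v0x] _] := K1X x.
  (* [g] is the prospective trace of the solution: K g = -i G v0 says exactly that v0 - i S0 g has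
     trace g. *)
  pose g := K' (- 'i%C *: G v0); exists (v0 + S0 (- 'i%C *: g)).
  apply/weak_sol_robin => v; rewrite (superpose _ _ _ v0x) /boundary_data; congr (_ + _).
  rewrite -mulNr -sipZl; congr (pB (_ *: _) _).
  rewrite (linear_toD G_lin) (linear_toZ S0l) (linear_toZ G_lin).
  have := K'K (- 'i%C *: G v0); rewrite -/g /neumann_minus_i => /eqP.
  rewrite subr_eq => /eqP ->; rewrite scalerDr !scalerA mulrNN mulNr -expr2 sqr_i opprK.
  by rewrite scale1r scaleN1r addrA subrr add0r.
exists (K1 + K2 * (`|C| * (MG * K1))) => x u /weak_sol_robin ux.
have [[v0 v0x] /(_ _ v0x) v0n] := K1X x.
have uE : u = v0 + S0 (- 'i%C *: G u).
  apply: (weak_sol_unique V_def V_complete j_lin j_le b_elliptic bl ux) => v.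
  by rewrite (superpose _ _ _ v0x) /boundary_data sipZl mulNr.
have GuE : G u = K' (- 'i%C *: G v0).
  rewrite -[LHS]KK' /neumann_minus_i; congr K'.
  rewrite {2}uE (linear_toD G_lin) (linear_toZ S0l) (linear_toZ G_lin).
  by rewrite scalerDr scalerA mulrN -expr2 sqr_i opprK scale1r opprD addrCA subrr addr0 scaleNr.
have Gun : nB (G u) <= `|C| * (MG * (K1 * nX x)).
  rewrite GuE; apply: le_trans (K'C _) _; rewrite hnormZ normcN normc_i mul1r.
  apply: (@le_trans _ _ (`|C| * nB (G v0))).
    by rewrite ler_wpM2r ?hnorm_ge0// ler_norm.
  rewrite ler_wpM2l//; apply: le_trans (G_bound _) _; by rewrite ler_wpM2l.
apply: le_trans (j_le _) _; rewrite uE mulrDl; apply: le_trans (ler_hnormD _ _ _) _.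
rewrite lerD// -!mulrA; have [_ /(_ _ (neumann_solutionP _))] := K2P (- 'i%C *: G u).
rewrite hnormZ normcN normc_i mul1r => /le_trans; apply; by rewrite ler_wpM2l.
Qed.

End cayley.
End robin.

(** Passes to the limit in the integration by parts formula that defines the weak gradient, whence
    the sign. *)
Lemma converges_sip {R : realType} {V : lmodType R[i]} (p : sip (V := V))
    (x y : nat -> V) (l m a b : V) :
  converges p x l -> converges p y m ->
  (forall k, p (x k) a = - p (y k) b) -> p l a = - p m b.
Proof.
move=> xl ym xy; apply/eqP; rewrite -subr_eq0 opprK; apply/eqP/eq0_normc/le_anti.
rewrite normc_ge0 andbT; apply/ler_addgt0Pr => e e0; rewrite add0r.
pose c := hnorm p a + hnorm p b + 1.
have c0 : 0 < c by rewrite ltr_wpDl// addr_ge0 ?hnorm_ge0.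
have [N NP] := xl _ (divr_gt0 e0 c0); have [M MP] := ym _ (divr_gt0 e0 c0).
pose k := maxn N M.
have -> : p l a + p m b = p (l - x k) a + p (m - y k) b.
  by rewrite !sipBl xy; ring.
apply: le_trans (le_normcD _ _) _.
apply: (@le_trans _ _ (e / c * hnorm p a + e / c * hnorm p b)).
  apply: lerD; apply: le_trans (cauchy_schwarz _ _ _) _; rewrite hnormBC.
    by rewrite ler_wpM2r ?hnorm_ge0//; apply: NP; exact: leq_maxl.
  by rewrite ler_wpM2r ?hnorm_ge0//; apply: MP; exact: leq_maxr.
by rewrite -mulrDr mulrAC ler_pdivrMr// ler_pM2l// lerDl.
Qed.

(** * Inner products of graph type, the pattern of H^1 *)

Section graph_inner_product.
Context {R : realType} {V X : lmodType R[i]} (J : finType).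
Variables (p : sip (V := X)) (F0 : V -> X) (F : J -> V -> X).
Hypotheses (F0_lin : linear_to F0) (F_lin : forall i, linear_to (F i)).
Local Notation nr := (hnorm p).

Lemma Re_sum (K : Type) (s : seq K) (f : K -> R[i]) :
  complex.Re (\sum_(i <- s) f i) = \sum_(i <- s) complex.Re (f i).
Proof. by elim/big_rec2: _ => // i x y _ <-; rewrite ReD. Qed.

Definition graph_ip (u v : V) : R[i] := p (F0 u) (F0 v) + \sum_i p (F i u) (F i v).

Lemma graph_ip_lin a u v w : graph_ip (a *: u + v) w = a * graph_ip u w + graph_ip v w.
Proof.
rewrite /graph_ip F0_lin sip_lin mulrDr addrACA; congr (_ + _).
rewrite mulr_sumr -big_split; apply: eq_bigr => j _.
by rewrite F_lin sip_lin.
Qed.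

Lemma graph_ip_herm u v : graph_ip v u = conjc (graph_ip u v).
Proof.
rewrite /graph_ip conjcD -sip_herm; congr (_ + _).
rewrite (raddf_sum (@conjc R)); apply: eq_bigr => j _; exact: sip_herm.
Qed.

Lemma Re_graph_ip u : complex.Re (graph_ip u u) = nr (F0 u) ^+ 2 + \sum_i nr (F i u) ^+ 2.
Proof.
rewrite /graph_ip ReD Re_sum sqr_hnorm; congr (_ + _).
by apply: eq_bigr => j _; rewrite sqr_hnorm.
Qed.

Lemma graph_ip_ge0 u : 0 <= complex.Re (graph_ip u u).
Proof.
by rewrite Re_graph_ip addr_ge0 ?sqr_ge0// sumr_ge0// => j _; exact: sqr_ge0.
Qed.

Definition graph_sip : sip (V := V) := Sip graph_ip_lin graph_ip_herm graph_ip_ge0.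

Lemma sqr_hnorm_graph u : hnorm graph_sip u ^+ 2 = nr (F0 u) ^+ 2 + \sum_i nr (F i u) ^+ 2.
Proof. by rewrite sqr_hnorm -Re_graph_ip. Qed.

Lemma hnorm_graphE u : hnorm graph_sip u = Num.sqrt (nr (F0 u) ^+ 2 + \sum_i nr (F i u) ^+ 2).
Proof. by rewrite -sqr_hnorm_graph sqrtr_sqr ger0_norm// hnorm_ge0. Qed.

Lemma graph_le0 u : nr (F0 u) <= hnorm graph_sip u.
Proof.
rewrite -(ler_pXn2r (_ : 0 < 2)%N) ?nnegrE ?hnorm_ge0// sqr_hnorm_graph lerDl.
by apply: sumr_ge0 => j _; exact: sqr_ge0.
Qed.

Lemma graph_le i u : nr (F i u) <= hnorm graph_sip u.
Proof.
rewrite -(ler_pXn2r (_ : 0 < 2)%N) ?nnegrE ?hnorm_ge0// sqr_hnorm_graph.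
rewrite (bigD1 i)//= addrCA lerDl addr_ge0 ?sqr_ge0// sumr_ge0// => k _.
exact: sqr_ge0.
Qed.

Lemma graph_hnorm_le u : hnorm graph_sip u <= nr (F0 u) + \sum_i nr (F i u).
Proof.
have s0 : 0 <= \sum_i nr (F i u) by rewrite sumr_ge0// => i _; exact: hnorm_ge0.
rewrite -(ler_pXn2r (_ : 0 < 2)%N) ?nnegrE ?addr_ge0 ?hnorm_ge0// sqr_hnorm_graph.
have le : \sum_i nr (F i u) ^+ 2 <= (\sum_i nr (F i u)) ^+ 2.
  rewrite (expr2 (\sum_i _)) mulr_suml; apply: ler_sum => i _.
  rewrite expr2 ler_wpM2l ?hnorm_ge0// (bigD1 i)//= lerDl sumr_ge0// => k _.
  exact: hnorm_ge0.
by rewrite sqrrD; have := mulr_ge0 (hnorm_ge0 p (F0 u)) s0; lra.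
Qed.

Lemma graph_definite : definite p ->
  (forall u, F0 u = 0 -> (forall i, F i u = 0) -> u = 0) -> definite graph_sip.
Proof.
move=> pd inj u u0; apply: inj => [|i]; apply/pd/le_anti; rewrite hnorm_ge0 andbT -u0.
  exact: graph_le0.
exact: graph_le.
Qed.

(** The second hypothesis is closedness of the graph: limits of the components must be the
    components of one element. *)
Lemma graph_complete : complete p ->
  (forall (u : nat -> V) f (g : J -> X), converges p (F0 \o u) f ->
     (forall i, converges p (F i \o u) (g i)) ->
     exists2 v, F0 v = f & forall i, F i v = g i) ->
  complete graph_sip.
Proof.
move=> pc closedF u cu.
have cX (H : V -> X) : linear_to H -> (forall v, nr (H v) <= hnorm graph_sip v) ->
    exists l, converges p (H \o u) l.
  move=> Hl Hle; apply: pc => e e0; have [N NP] := cu e e0; exists N => m k Nm Nk.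
  by rewrite /= -(linear_toB Hl); apply: le_trans (Hle _) _; exact: NP.
have [f fP] := cX _ F0_lin graph_le0.
have [g gP] := choice (fun i => cX _ (F_lin i) (graph_le i)).
have [v vf vg] := closedF u f g fP gP; exists v => e e0.
(* One share of e for each [F i] and one for [F0]; the sum of all thresholds then serves as a common
   one. *)
have d0 : 0 < e / (#|J|.+1)%:R by rewrite divr_gt0.
have [N0 N0P] := fP _ d0; have [N NP] := choice (fun i => gP i _ d0).
exists (N0 + \sum_i N i)%N => n nN; apply: le_trans (graph_hnorm_le _) _.
rewrite (linear_toB F0_lin) vf.
have h0 := N0P n (leq_trans (leq_addr _ _) nN).
have h1 : \sum_i nr (F i (u n - v)) <= \sum_(i : J) e / (#|J|.+1)%:R.
  apply: ler_sum => i _; rewrite (linear_toB (F_lin i)) vg; apply: NP.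
  by apply: leq_trans nN; rewrite (bigD1 i)//= addnCA leq_addr.
apply: le_trans (lerD h0 h1) _.
rewrite sumr_const -mulrS -(mulr_natr (e / _)) divfK ?pnatr_eq0//.
Qed.

End graph_inner_product.

(** * Square-integrable functions *)

Section riesz_fischer.
Context {R : realType} d {T : measurableType d}.
Variable mu : {measure set T -> \bar R}.
Implicit Types D : set T.

(** By monotone convergence the sum of the |h (k+1) - h k| is integrable, hence finite almost
    everywhere, so the telescoping series converges absolutely there. *)
Lemma ae_cvg_of_summable_steps D (h : nat -> T -> R) (C : R) : measurable D ->
  (forall k, measurable_fun D (h k)) ->
  (forall k, (\int[mu]_(x in D) `|h k.+1 x - h k x|%:E <= (C / (2 ^ (k + 1))%:R)%:E)%E) ->
  {ae mu, forall x, D x -> cvgn (fun k => h k x)}.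
Proof.
move=> mD mh hC.
pose t k x := `|h k.+1 x - h k x|%:E : \bar R.
have mt k : measurable_fun D (t k).
  by apply/measurable_EFinP; apply: measurableT_comp => //; exact: measurable_funB.
have t0 k x : (0 <= t k x)%E by rewrite lee_fin.
have sfin : (\sum_(k <oo) (\int[mu]_(x in D) t k x) < +oo)%E.
  apply: (@le_lt_trans _ _ (\sum_(k <oo) (C / (2 ^ (k + 1))%:R)%:E)%E).
    by apply: lee_nneseries => k *; [exact: integral_ge0|exact: hC].
  by rewrite (cvg_lim _ (@cvg_geometric_eseries_half R C 0%N))// ltry.
have : mu.-integrable D (fun x => \sum_(k <oo) t k x)%E.
  apply/integrableP; split.
    have := @ge0_emeasurable_sum _ _ R D t xpredT; apply => //.
  rewrite (eq_integral (fun x => \sum_(k <oo) t k x)%E); last first.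
    by move=> x _; rewrite gee0_abs// nneseries_ge0.
  by rewrite integral_nneseries.
move=> /(integrable_ae mD); apply: filterS => x xfin Dx.
have {}xfin := xfin Dx.
have : cvgn (series (telescope (fun k => h k x))).
  apply: (@normed_cvg _ R).
  apply: nondecreasing_is_cvgn.
    by apply/nondecreasing_seqP => n; rewrite /normed_series_of /series/= big_nat_recr//= lerDl.
  exists (fine (\sum_(k <oo) t k x)) => _ [n _ <-].
  rewrite /normed_series_of /series/= -lee_fin fineK// -sumEFin.
  by apply: nneseries_lim_ge => k *; exact: t0.
move=> c; rewrite (_ : (fun k => h k x) =
    (fun k => h 0%N x + series (telescope (fun k => h k x)) k)).
  by apply: is_cvgD => //; exact: is_cvg_cst.
by apply/funext => k; rewrite -eq_sum_telescope.
Qed.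

(** Finiteness of the measure turns small L^2 steps of a subsequence into summable L^1 steps, hence
    convergence almost everywhere; Fatou's lemma returns to L^2. *)
Lemma riesz_fischer D (f : nat -> T -> R) : measurable D -> (mu D < +oo)%E ->
  (forall n, measurable_fun D (f n)) ->
  (forall e : R, 0 < e -> exists N, forall m n, (N <= m)%N -> (N <= n)%N ->
    (\int[mu]_(x in D) ((f m x - f n x) ^+ 2)%:E <= e%:E)%E) ->
  exists2 g : T -> R, measurable_fun D g & forall e : R, 0 < e -> exists N, forall n, (N <= n)%N ->
    (\int[mu]_(x in D) ((f n x - g x) ^+ 2)%:E <= e%:E)%E.
Proof.
move=> mD Dfin mf cf.
have muD : mu D \is a fin_num by rewrite ge0_fin_numE.
pose s k : R := (2 ^ (k + 1))%:R^-1.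
have s0 k : 0 < s k by rewrite invr_gt0 ltr0n expn_gt0.
have [N NP] := choice (fun k => cf (s k ^+ 2) (exprn_gt0 2 (s0 k))).
(* The sum makes [m k] exceed each [N i] with i <= k; the summand k makes it tend to infinity. *)
pose m k := (k + \sum_(i < k.+1) N i)%N.
have Nm k i : (i <= k)%N -> (N i <= m k)%N.
  by move=> ik; rewrite /m (bigD1 (Ordinal (ik : (i < k.+1)%N)))//= addnCA leq_addr.
pose h k := f (m k).
have mh k : measurable_fun D (h k) by exact: mf.
have msq (a b : T -> R) : measurable_fun D a -> measurable_fun D b ->
    measurable_fun D (fun x => ((a x - b x) ^+ 2)%:E).
  by move=> ma mb; apply/measurable_EFinP; apply: measurable_funX; exact: measurable_funB.
have hC k : (\int[mu]_(x in D) `|h k.+1 x - h k x|%:E <=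
    ((fine (mu D) + 1) / (2 ^ (k + 1))%:R)%:E)%E.
  (* From |a| <= s + a^2/s with s = [s k]: the integral of a^2 is at most s^2, so the total is at
     most (mu D + 1) s. *)
  apply: (@le_trans _ _ (\int[mu]_(x in D)
    ((s k)%:E + (s k)^-1%:E * ((h k.+1 x - h k x) ^+ 2)%:E))%E).
    apply: ge0_le_integral => //.
    - by apply/measurable_EFinP; apply: measurableT_comp => //; exact: measurable_funB.
    - by apply: emeasurable_funD => //; apply: measurable_funeM; exact: msq.
    move=> x _; rewrite -EFinM -EFinD lee_fin.
    set a := h _ _ - _; rewrite -(ler_pM2l (s0 k)) mulrDr mulVKf ?gt_eqF//.
    by rewrite -(real_normK (num_real a)); have := sqr_ge0 (`|a| - s k); have := s0 k;
      have := normr_ge0 a; nra.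
  rewrite ge0_integralD//; last 3 first.
  - by move=> x _; rewrite lee_fin ltW.
  - by move=> x _; rewrite mule_ge0// lee_fin ?sqr_ge0// invr_ge0 ltW.
  - by apply: measurable_funeM; exact: msq.
  rewrite integral_cst// ge0_integralZl_EFin//; last 3 first.
  - by move=> x _; rewrite lee_fin sqr_ge0.
  - exact: msq.
  - by rewrite invr_ge0 ltW.
  rewrite mulrDl EFinD mul1r -/(s k) EFinM fineK// muleC leeD2l//.
  have {2}-> : s k = (s k)^-1 * s k ^+ 2 by rewrite expr2 mulKf ?gt_eqF.
  rewrite EFinM lee_pmul2l ?lte_fin ?invr_gt0//.
  by apply: NP; apply: Nm.
have hcvg := ae_cvg_of_summable_steps mD mh hC.
(* The upper limit is measurable everywhere and is the limit almost everywhere. *)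
pose g x := fine (limn_esup (fun k => (h k x)%:E)).
have mg : measurable_fun D g.
  apply: (measurableT_comp (fine_measurable measurableT)).
  by apply: measurable_fun_limn_esup => k; exact/measurable_EFinP.
exists g => // e e0; have [M MP] := cf e e0; exists M => n Mn.
(* Fatou along the subsequence: the integral of |f n - g|^2 is at most the lower limit of those of
   |f n - h k|^2, which are at most e once k >= M. *)
pose F k x := ((f n x - h k x) ^+ 2)%:E.
have mF k : measurable_fun D (F k) by exact: msq.
apply: (@le_trans _ _ (\int[mu]_(x in D) limn_einf (F^~ x))%E).
  apply: ae_ge0_le_integral => //.
  - by move=> x _; rewrite lee_fin sqr_ge0.
  - exact: msq.
  - move=> x _; rewrite limn_einf_lim; apply: lime_ge; first exact: is_cvg_einfs.
    apply: nearW => k; apply: le_ereal_inf_tmp => _ [i _ <-].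
    by rewrite lee_fin sqr_ge0.
  - apply: measurableT_comp => //; apply: measurable_fun_limn_esup => k.
    by apply: measurableT_comp => //; exact: mF.
  apply: filterS hcvg => x hx Dx.
  have hl := hx Dx.
  have gE : g x = limn (fun k => h k x).
    rewrite /g; have -> // : limn_esup (fun k => (h k x)%:E) = (limn (fun k => h k x))%:E.
    by apply: (cvg_limn_einf_sup _).2; apply: cvg_EFin => //; exact: nearW.
  have Fl : F^~ x @ \oo --> ((f n x - g x) ^+ 2)%:E.
    apply: cvg_EFin; first exact: nearW.
    rewrite gE; have : (fun k => (f n x - h k x) ^+ 2) @ \oo -->
        (f n x - limn (fun k => h k x)) ^+ 2; last exact.
    rewrite expr2; under eq_fun do rewrite expr2.
    by apply: cvgM; apply: cvgB => //; exact: cvg_cst.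
  by rewrite (cvg_limn_einf_sup Fl).1.
apply: le_trans (fatou mu mD mF _) _; first by move=> k x _; rewrite lee_fin sqr_ge0.
rewrite limn_einf_lim; apply: lime_le; first exact: is_cvg_einfs.
apply: nearW => k; apply: (@le_trans _ _ (\int[mu]_(x in D) F (maxn k M) x)%E).
  by apply: ereal_inf_lbound; exists (maxn k M) => //=; exact: leq_maxl.
apply: MP => //; exact: leq_trans (leq_maxr k M) (leq_addr _ _).
Qed.
End riesz_fischer.

(** * L^2 as a Hilbert space *)

Section l2_space.
Context {R : realType} d {T : measurableType d}.
Variables (mu : {measure set T -> \bar R}) (D : set T) (mD : measurable D).
Local Notation SI := (square_integrable mu D).
Local Notation L2 := (subquot (L2_data mu mD)).
Implicit Types f g h : T -> R[i].

Definition cip f g : R[i] := cintegral mu D (fun x => f x * conjc (g x)).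

Lemma cmeasurableJ f : cmeasurable D f -> cmeasurable D (fun x => conjc (f x)).
Proof.
move=> [rf jf]; split.
  by rewrite (_ : (fun _ => _) = fun x => complex.Re (f x))//; apply/funext => x; rewrite ReJ.
rewrite (_ : (fun _ => _) = fun x => - complex.Im (f x)).
  exact: measurableT_comp.
by apply/funext => x; case: (f x).
Qed.

Lemma cmeasurableM f g : cmeasurable D f -> cmeasurable D g -> cmeasurable D (f * g).
Proof.
move=> [rf jf] [rg jg]; split.
  rewrite (_ : (fun _ => _) = fun x => complex.Re (f x) * complex.Re (g x) -
      complex.Im (f x) * complex.Im (g x)).
    by apply: measurable_funB; apply: measurable_funM.
  by apply/funext => x; rewrite [in LHS]/GRing.mul/=; case: (f x) (g x) => [? ?] [? ?].
rewrite (_ : (fun _ => _) = fun x => complex.Re (f x) * complex.Im (g x) +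
    complex.Im (f x) * complex.Re (g x)).
  by apply: measurable_funD; apply: measurable_funM.
by apply/funext => x; rewrite [in LHS]/GRing.mul/=; case: (f x) (g x) => [? ?] [? ?].
Qed.

Lemma sqmodE (z : R[i]) : sqmod z = normc z ^+ 2.
Proof. by rewrite sqr_normc. Qed.

Lemma cintegrable_mulJ f g : SI f -> SI g -> cintegrable mu D (fun x => f x * conjc (g x)).
Proof.
move=> [mf ff] [mg gf].
have [mr mi] : cmeasurable D (fun x => f x * conjc (g x)).
  exact: (cmeasurableM mf (cmeasurableJ mg)).
have key (k : T -> R) : measurable_fun D k ->
    (forall x, `|k x| <= normc (f x * conjc (g x))) -> mu.-integrable D (EFin \o k).
  move=> mk kle; apply/integrableP; split; first exact/measurable_EFinP.
  apply: (integral_lty_dom (f := fun x => `|k x|) (g := fun x => sqmod (f x))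
    (h := fun x => sqmod (g x)) (c := 1)) => //; try exact: measurable_sqmod.
  - exact: measurableT_comp.
  - by move=> x; exact: sqmod_ge0.
  - by move=> x; exact: sqmod_ge0.
  move=> x _; apply: le_trans (kle x) _; rewrite normcM normcJ !sqmodE mul1r.
  have := sqr_ge0 (normc (f x) - normc (g x)); have := sqr_ge0 (normc (f x)).
  by have := sqr_ge0 (normc (g x)); rewrite sqrrB => ? ? ?; lra.
by split; apply: key => // x; [exact: ler_Re_normc|exact: ler_Im_normc].
Qed.

Lemma cip_lin a f g h : SI f -> SI g -> SI h ->
  cip (a *: f + g) h = a * cip f h + cip g h.
Proof.
move=> sf sg sh; rewrite /cip -cintegralZD//; try exact: cintegrable_mulJ.
congr cintegral; apply/funext => x.
by rewrite (_ : (a *: f + g) x = a * f x + g x)// mulrDl -mulrA.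
Qed.

Lemma cip_herm f g : SI f -> SI g -> cip g f = conjc (cip f g).
Proof.
move=> sf sg; rewrite /cip /cintegral /=; congr Complex.
  by congr Rintegral; apply/funext => x; case: (f x) (g x) => [? ?] [? ?] /=; ring.
rewrite -mulN1r -RintegralZl//; last exact: (cintegrable_mulJ sf sg).2.
by congr Rintegral; apply/funext => x; case: (f x) (g x) => [? ?] [? ?] /=; ring.
Qed.

Lemma Re_cip f : complex.Re (cip f f) = fine (\int[mu]_(x in D) (sqmod (f x))%:E).
Proof.
rewrite /cip /= /Rintegral; congr fine; apply: eq_integral => x _; congr EFin.
by rewrite /sqmod; case: (f x) => [? ?] /=; ring.
Qed.

Lemma integral_sqmod f : SI f ->
  (\int[mu]_(x in D) (sqmod (f x))%:E = (complex.Re (cip f f))%:E)%E.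
Proof.
move=> [mf ff]; rewrite Re_cip fineK// ge0_fin_numE//.
by apply: integral_ge0 => x _; rewrite lee_fin sqmod_ge0.
Qed.

Lemma cip_null f g : SI f -> SI g -> ae_null mu D f -> cip f g = 0.
Proof.
move=> sf sg f0; have [ir ii] := cintegrable_mulJ sf sg.
have key (k : T -> R) : mu.-integrable D (EFin \o k) ->
    (forall x, f x = 0 -> k x = 0) -> \int[mu]_(x in D) k x = 0.
  move=> ik k0; rewrite /Rintegral (@ae_eq_integral _ _ _ mu D (cst 0%E))//.
  - by rewrite integral0.
  - exact: (measurable_int mu).
  by apply: filterS f0 => x fx Dx; rewrite /= k0// fx.
by rewrite /cip /cintegral !key// => x -> ; rewrite mul0r.
Qed.

(** [sq_val] returns a chosen representative, so sums and multiples of classes agree with those of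
    functions only up to null functions; the inner product absorbs the difference. *)
Lemma cip_congl f f' g : SI f -> SI f' -> SI g -> ae_null mu D (f - f') -> cip f g = cip f' g.
Proof.
move=> sf sf' sg ff'; have sq := square_integrable_subspace mu mD.
have sff : SI (f - f') by rewrite addrC -scaleN1r; apply: sq.2.
have := cip_lin 1 sff sf' sg; rewrite scale1r subrK => ->.
by rewrite (cip_null sff sg ff') mulr0 add0r.
Qed.

Lemma cip_congr f f' g : SI f -> SI f' -> SI g -> ae_null mu D (f - f') -> cip g f = cip g f'.
Proof. by move=> sf sf' sg ff'; rewrite cip_herm// (cip_congl sf sf')// -cip_herm. Qed.

Lemma L2_val (u : L2) : SI (sq_val u). Proof. exact: (sq_val_space u). Qed.

Lemma cip_pil f g (sf : sq_space (L2_data mu mD) f) : SI g ->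
  cip (sq_val (sq_pi sf)) g = cip f g.
Proof. by move=> sg; apply: cip_congl => //; [exact: L2_val|exact: (sq_piK sf)]. Qed.

Lemma cip_pir f g (sf : sq_space (L2_data mu mD) f) : SI g ->
  cip g (sq_val (sq_pi sf)) = cip g f.
Proof. by move=> sg; apply: cip_congr => //; [exact: L2_val|exact: (sq_piK sf)]. Qed.

Definition L2_ip (u v : L2) : R[i] := cip (sq_val u) (sq_val v).

Lemma square_integrable_lin a f g : SI f -> SI g -> SI (a *: f + g).
Proof. exact: (square_integrable_subspace mu mD).2. Qed.

Lemma sq_val_lin a (u v : L2) :
  ae_null mu D (sq_val (a *: u + v) - (a *: sq_val u + sq_val v)).
Proof.
have nl := ae_null_subspace mu D.
rewrite -(subrKA (sq_val (a *: u) + sq_val v)) -[X in ae_null _ _ X]scale1r.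
rewrite scalerDr; apply: nl.2; last first.
  by rewrite scale1r opprD addrACA subrr addr0; exact: (sq_valZ a u).
exact: (sq_valD (a *: u) v).
Qed.

Lemma L2_ip_lin a u v w : L2_ip (a *: u + v) w = a * L2_ip u w + L2_ip v w.
Proof.
rewrite /L2_ip -cip_lin//; try exact: L2_val.
apply: cip_congl; try exact: L2_val; last exact: sq_val_lin.
by apply: square_integrable_lin; exact: L2_val.
Qed.

Lemma L2_ip_herm u v : L2_ip v u = conjc (L2_ip u v).
Proof. by apply: cip_herm; exact: L2_val. Qed.

Lemma L2_ip_ge0 u : 0 <= complex.Re (L2_ip u u).
Proof.
rewrite /L2_ip Re_cip fine_ge0// integral_ge0// => x _.
by rewrite lee_fin sqmod_ge0.
Qed.

Definition L2_sip : sip (V := L2) := Sip L2_ip_lin L2_ip_herm L2_ip_ge0.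

Lemma ae_null_of_cip f : SI f -> complex.Re (cip f f) = 0 -> ae_null mu D f.
Proof.
move=> sf f0; have := integral_sqmod sf; rewrite f0.
rewrite (eq_integral (fun x => `|(sqmod (f x))%:E|%E)); last first.
  by move=> x _; rewrite gee0_abs// lee_fin sqmod_ge0.
move=> /ae_eq_integral_abs -/(_ mD) h.
have /h : measurable_fun D (fun x => (sqmod (f x))%:E).
  by apply/measurable_EFinP; exact: (measurable_sqmod sf.1).
apply: filterS => x fx Dx; have /eqP := fx Dx.
rewrite eqe sqmodE sqrf_eq0 => /eqP; exact: eq0_normc.
Qed.

Lemma L2_definite : definite L2_sip.
Proof.
move=> u u0; apply: sq_eqP.
have nl := ae_null_subspace mu D.
have e : ae_null mu D (sq_val u).
  by apply: ae_null_of_cip; [exact: L2_val|rewrite -[LHS](sqr_hnorm L2_sip) u0 expr0n].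
have z : ae_null mu D (sq_val (0 : L2)).
  by apply: ae_null_of_cip; [exact: L2_val|rewrite -[LHS](sqr_hnorm L2_sip) hnorm0 expr0n].
by rewrite addrC -scaleN1r; exact: nl.2.
Qed.

Lemma sqr_hnorm_L2 (u : L2) f : SI f -> ae_null mu D (sq_val u - f) ->
  hnorm L2_sip u ^+ 2 = complex.Re (cip f f).
Proof.
move=> sf uf; rewrite sqr_hnorm; have su := L2_val u.
rewrite (_ : L2_sip u u = cip (sq_val u) (sq_val u))//.
by rewrite (cip_congl su sf su uf) (cip_congr su sf sf uf).
Qed.

Lemma square_integrableB f g : SI f -> SI g -> SI (f - g).
Proof. by move=> sf sg; rewrite addrC -scaleN1r; exact: square_integrable_lin. Qed.

Lemma sq_valB (u v : L2) : ae_null mu D (sq_val (u - v) - (sq_val u - sq_val v)).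
Proof.
by have := sq_val_lin (-1) v u; rewrite !scaleN1r (addrC (- v)) (addrC (- sq_val v)).
Qed.

(** [part] stands for the real or the imaginary part, to which the real Riesz-Fischer theorem is
    applied separately. *)
Lemma L2_cauchy_part (u : nat -> L2) (part : R[i] -> R) : (mu D < +oo)%E ->
  (forall e : R, 0 < e -> exists N, forall m n, (N <= m)%N -> (N <= n)%N ->
     hnorm L2_sip (u m - u n) <= e) ->
  (forall z, part z ^+ 2 <= sqmod z) -> {morph part : z w / z - w} ->
  (forall n, measurable_fun D (fun x => part (sq_val (u n) x))) ->
  exists2 g : T -> R, measurable_fun D g &
    forall e : R, 0 < e -> exists N, forall n, (N <= n)%N ->
      (\int[mu]_(x in D) ((part (sq_val (u n) x) - g x) ^+ 2)%:E <= e%:E)%E.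
Proof.
move=> Dfin cu ple pB mp; apply: riesz_fischer => // e e0.
have se : 0 < Num.sqrt e by rewrite sqrtr_gt0.
have [N NP] := cu _ se; exists N => m n Nm Nn.
have := NP m n Nm Nn; rewrite -(ler_pXn2r (_ : 0 < 2)%N) ?nnegrE ?hnorm_ge0 ?sqrtr_ge0//.
have sB := square_integrableB (L2_val (u m)) (L2_val (u n)).
rewrite (sqr_hnorm_L2 sB (sq_valB _ _)) (sqr_sqrtr (ltW e0)) -lee_fin => h.
apply: le_trans h; rewrite -(integral_sqmod sB).
apply: ge0_le_integral => //.
- by move=> x _; rewrite lee_fin sqr_ge0.
- by apply/measurable_EFinP; apply: measurable_funX; exact: measurable_funB.
- by apply/measurable_EFinP; apply: measurable_sqmod; exact: sB.1.
by move=> x _; rewrite lee_fin -pB; exact: ple.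
Qed.

Lemma L2_complete : (mu D < +oo)%E -> complete L2_sip.
Proof.
move=> Dfin u cu.
have mu_ n : cmeasurable D (sq_val (u n)) := (L2_val (u n)).1.
have [g1 mg1 g1P] : exists2 g : T -> R, measurable_fun D g &
    forall e : R, 0 < e -> exists N, forall n, (N <= n)%N ->
    (\int[mu]_(x in D) ((complex.Re (sq_val (u n) x) - g x) ^+ 2)%:E <= e%:E)%E.
  apply: (L2_cauchy_part (part := @complex.Re R)) => // [z|z w|n]; last exact: (mu_ n).1.
    by rewrite /sqmod lerDl sqr_ge0.
  by rewrite ReD ReN.
have [g2 mg2 g2P] : exists2 g : T -> R, measurable_fun D g &
    forall e : R, 0 < e -> exists N, forall n, (N <= n)%N ->
    (\int[mu]_(x in D) ((complex.Im (sq_val (u n) x) - g x) ^+ 2)%:E <= e%:E)%E.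
  apply: (L2_cauchy_part (part := @complex.Im R)) => // [z|z w|n]; last exact: (mu_ n).2.
    by rewrite /sqmod lerDr sqr_ge0.
  by case: z w => [? ?] [? ?].
pose g x := Complex (g1 x) (g2 x).
have mg : cmeasurable D g by [].
have mB n : cmeasurable D (sq_val (u n) - g).
  by rewrite addrC -scaleN1r; exact: cmeasurableZD.
have gP (e : R) : 0 < e -> exists N, forall n, (N <= n)%N ->
    (\int[mu]_(x in D) (sqmod ((sq_val (u n) - g) x))%:E <= e%:E)%E.
  move=> e0; have e20 : 0 < e / 2 by rewrite divr_gt0.
  have [N1 h1] := g1P _ e20; have [N2 h2] := g2P _ e20.
  exists (maxn N1 N2) => n; rewrite geq_max => /andP[/h1{}h1 /h2{}h2].
  have mre : measurable_fun D (fun x => ((complex.Re (sq_val (u n) x) - g1 x) ^+ 2)%:E).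
    apply/measurable_EFinP; apply: measurable_funX.
    by apply: measurable_funB => //; exact: (mu_ n).1.
  have mim : measurable_fun D (fun x => ((complex.Im (sq_val (u n) x) - g2 x) ^+ 2)%:E).
    apply/measurable_EFinP; apply: measurable_funX.
    by apply: measurable_funB => //; exact: (mu_ n).2.
  rewrite (eq_integral (fun x => ((complex.Re (sq_val (u n) x) - g1 x) ^+ 2)%:E +
      ((complex.Im (sq_val (u n) x) - g2 x) ^+ 2)%:E)%E); last first.
    move=> x _; rewrite (_ : (sq_val (u n) - g) x = sq_val (u n) x - g x)// /g.
    by case: (sq_val (u n) x).
  rewrite ge0_integralD//; try by move=> x _; rewrite lee_fin sqr_ge0.
  by rewrite (splitr e) EFinD leeD.
(* g differs from a member of the sequence by a function whose squared norm is at most 1. *)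
have sg : SI g.
  have [N NP] := gP 1 ltr01; rewrite -(subKr (sq_val (u N)) g).
  apply: square_integrableB; first exact: L2_val.
  by split=> //; apply: le_lt_trans (NP N (leqnn N)) (ltry 1).
exists (sq_pi (sg : sq_space (L2_data mu mD) g)) => e e0.
have [N NP] := gP _ (exprn_gt0 2 e0); exists N => n Nn.
rewrite -(ler_pXn2r (_ : 0 < 2)%N) ?nnegrE ?hnorm_ge0 ?(ltW e0)//.
have sB := square_integrableB (L2_val (u n)) sg.
rewrite (sqr_hnorm_L2 sB); first by rewrite -lee_fin -integral_sqmod//; exact: NP.
have nl := ae_null_subspace mu D.
rewrite -(subrKA (sq_val (u n) - sq_val (sq_pi (sg : sq_space (L2_data mu mD) g)))).
rewrite -[X in ae_null _ _ (X + _)]scale1r; apply: nl.2; first exact: sq_valB.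
rewrite opprB addrC subrKA -opprB -scaleN1r -[_ *: _]addr0; apply: nl.2; last exact: nl.1.
exact: (sq_piK (sg : sq_space (L2_data mu mD) g)).
Qed.
End l2_space.

(** * Multiplication by essentially bounded functions *)

Section multiplication.
Context {R : realType} d {T : measurableType d}.
Variables (mu : {measure set T -> \bar R}) (D : set T) (mD : measurable D).
Local Notation SI := (square_integrable mu D).
Local Notation L2 := (subquot (L2_data mu mD)).
Local Notation nr := (hnorm (L2_sip mu mD)).
Implicit Types f g h a : T -> R[i].

(** For Lebesgue measure on the domain this is [Linfty]. *)
Definition ess_bounded a : Prop :=
  cmeasurable D a /\ exists M : R, {ae mu, forall x, D x -> normc (a x) <= M}.

Lemma ess_bounded_mul a : ess_bounded a -> exists2 M : R, 0 <= M &
  forall f, SI f -> SI (a * f) /\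
    complex.Re (cip mu D (a * f) (a * f)) <= M ^+ 2 * complex.Re (cip mu D f f).
Proof.
move=> [ma [M0 aM0]]; exists `|M0|; first exact: normr_ge0.
move=> f [mf ff].
have maf : cmeasurable D (a * f) by exact: cmeasurableM.
have le : (\int[mu]_(x in D) (sqmod ((a * f) x))%:E <=
    (`|M0| ^+ 2)%:E * \int[mu]_(x in D) (sqmod (f x))%:E)%E.
  rewrite -ge0_integralZl_EFin//; last 2 first.
  - by move=> x _; rewrite lee_fin sqmod_ge0.
  - by apply/measurable_EFinP; exact: measurable_sqmod.
  apply: ae_ge0_le_integral => //.
  - by move=> x _; rewrite lee_fin sqmod_ge0.
  - by apply/measurable_EFinP; exact: measurable_sqmod.
  - by move=> x _; rewrite mule_ge0// lee_fin ?sqr_ge0// sqmod_ge0.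
  - by apply: measurable_funeM; apply/measurable_EFinP; exact: measurable_sqmod.
  apply: filterS aM0 => x h Dx; rewrite -EFinM lee_fin !sqmodE -exprMn.
  rewrite ler_pXn2r ?nnegrE ?mulr_ge0 ?normc_ge0//.
  rewrite (_ : (a * f) x = a x * f x)// normcM ler_wpM2r ?normc_ge0//.
  exact: le_trans (h Dx) (ler_norm _).
have saf : SI (a * f).
  split=> //; apply: le_lt_trans le _; rewrite lte_mul_pinfty// lee_fin sqr_ge0//.
by split=> //; rewrite -lee_fin EFinM -!integral_sqmod.
Qed.

Lemma square_integrable_mul a f : ess_bounded a -> SI f -> SI (a * f).
Proof. by move=> /ess_bounded_mul[M _ H] /H[]. Qed.

Definition L2_pi f (sf : SI f) : L2 := sq_pi (sf : sq_space (L2_data mu mD) f).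

Lemma L2_ip_pi f g (sf : SI f) (sg : SI g) : L2_sip mu mD (L2_pi sf) (L2_pi sg) = cip mu D f g.
Proof.
rewrite (_ : L2_sip _ _ _ _ = cip mu D (sq_val (L2_pi sf)) (sq_val (L2_pi sg)))//.
by rewrite cip_pil ?cip_pir//; exact: L2_val.
Qed.

Lemma L2_ip_val (u v : L2) : L2_sip mu mD u v = cip mu D (sq_val u) (sq_val v).
Proof. by []. Qed.

Lemma sqr_hnorm_pi f (sf : SI f) : nr (L2_pi sf) ^+ 2 = complex.Re (cip mu D f f).
Proof. by rewrite sqr_hnorm L2_ip_pi. Qed.

Lemma hnorm_val (u : L2) :
  nr u = Num.sqrt (fine (\int[mu]_(x in D) (sqmod (sq_val u x))%:E)).
Proof. by rewrite /hnorm L2_ip_val Re_cip. Qed.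

Lemma eq_L2_pi f g (sf : SI f) (sg : SI g) : ae_null mu D (f - g) -> L2_pi sf = L2_pi sg.
Proof.
move=> fg; apply: (sip_ext (@L2_definite _ _ _ mu D mD)) => h; rewrite !L2_ip_val.
have sh := L2_val h; rewrite (cip_pil _ sh) (cip_pil _ sh).
exact: cip_congl.
Qed.

Lemma L2_pi_val (u : L2) (su : SI (sq_val u)) : L2_pi su = u.
Proof. by apply: sq_eqP; exact: (sq_piK (su : sq_space (L2_data mu mD) (sq_val u))). Qed.

Lemma L2_pi_lin c f g (sf : SI f) (sg : SI g) (sh : SI (c *: f + g)) :
  L2_pi sh = c *: L2_pi sf + L2_pi sg.
Proof.
apply: (sip_ext (@L2_definite _ _ _ mu D mD)) => z.
apply: etrans (esym (sip_lin (L2_sip mu mD) c (L2_pi sf) (L2_pi sg) z)).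
rewrite !L2_ip_val.
have sz := L2_val z; rewrite (cip_pil _ sz) (cip_pil sf sz) (cip_pil sg sz).
exact: cip_lin.
Qed.

Definition L2_mul a (ba : ess_bounded a) (u : L2) : L2 :=
  L2_pi (square_integrable_mul ba (L2_val u)).

Lemma L2_mul_lin a (ba : ess_bounded a) : linear_to (L2_mul ba).
Proof.
move=> c u v; rewrite /L2_mul.
have su := square_integrable_mul ba (L2_val u); have sv := square_integrable_mul ba (L2_val v).
transitivity (L2_pi (square_integrable_lin mD c su sv)); last exact: L2_pi_lin.
apply: eq_L2_pi.
rewrite (_ : _ - _ = a * (sq_val (c *: u + v) - (c *: sq_val u + sq_val v))).
  have := sq_val_lin c u v; apply: filterS => x h Dx.
  by rewrite (_ : (a * _) x = a x * (sq_val (c *: u + v) - (c *: sq_val u + sq_val v)) x)//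
    h// mulr0.
apply/funext => x.
rewrite [LHS](_ : _ = a x * sq_val (c *: u + v) x -
  (c * (a x * sq_val u x) + a x * sq_val v x))//.
rewrite [RHS](_ : _ = a x * (sq_val (c *: u + v) x - (c * sq_val u x + sq_val v x)))//.
by ring.
Qed.

Lemma L2_mul_bound a (ba : ess_bounded a) : exists2 M : R, 0 <= M &
  forall u, nr (L2_mul ba u) <= M * nr u.
Proof.
have [M M0 H] := ess_bounded_mul ba; exists M => // u.
rewrite -(ler_pXn2r (_ : 0 < 2)%N) ?nnegrE ?mulr_ge0 ?hnorm_ge0//.
by rewrite exprMn sqr_hnorm_pi sqr_hnorm; exact: (H _ (L2_val u)).2.
Qed.

Lemma Rintegral_sum (I : Type) (s : seq I) (F : I -> T -> R) :
  (forall i, mu.-integrable D (EFin \o F i)) ->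
  mu.-integrable D (EFin \o (fun x => \sum_(i <- s) F i x)) /\
  \int[mu]_(x in D) (\sum_(i <- s) F i x) = \sum_(i <- s) \int[mu]_(x in D) F i x.
Proof.
move=> iF; elim: s => [|i s [is_ es]].
  split.
    apply: (eq_integrable mD (cst 0%E)); last exact: integrable0.
    by move=> x _; rewrite /= big_nil.
  rewrite big_nil (_ : (fun _ => _) = cst 0); last by apply/funext => x; rewrite big_nil.
  by rewrite /Rintegral integral0.
have e : (fun x => \sum_(i <- i :: s) F i x) = (fun x => F i x + \sum_(i <- s) F i x).
  by apply/funext => x; rewrite big_cons.
rewrite e; split; first by have := integrableD mD (iF i) is_; apply: eq_integrable.
by rewrite big_cons -es RintegralD.
Qed.

End multiplication.

(** * Conjugates of smooth functions *)

Section smooth_conjugate.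
Context {R : realType} {n : nat}.

Lemma Ck_opp k (f : 'rV[R]_n -> R) : Ck k f -> Ck k (- f).
Proof.
elim: k f => [|k IH] f [cf df]; split=> //; try by move=> x; exact: (cvgN (cf x)).
move=> i; have [dfi Ckf] := df i; split; first by move=> x; exact: derivableN.
rewrite (_ : partial i (- f) = - partial i f); first exact: IH.
by apply/funext => x; rewrite /partial deriveN.
Qed.

(** Weak gradients are defined by integrals without conjugation; conjugating the test function turns
    these into inner products. *)
Lemma smoothJ (phi : 'rV[R]_n -> R[i]) : smooth phi -> smooth (fun x => conjc (phi x)).
Proof.
move=> sphi k; have [cr ci] := sphi k; split.
  by rewrite (_ : (fun _ => _) = fun x => complex.Re (phi x))//; apply/funext => x; rewrite ReJ.
rewrite (_ : (fun _ => _) = - (fun x => complex.Im (phi x))); first exact: Ck_opp.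
by apply/funext => x; rewrite [RHS](_ : _ = - complex.Im (phi x))//; case: (phi x).
Qed.

End smooth_conjugate.

(** * The Sobolev space *)

Section h1_space.
Context {R : realType} {n : nat}.
Variable Omega : bounded_lipschitz_domain R n.
Local Notation C := R[i].
Local Notation T := 'rV[R]_n.+1.
Local Notation I := 'I_n.+1.
Local Notation leb := (@lebesgue_rV R n.+1).
Local Notation mO := (dom_measurable Omega).
Local Notation L2 := (L2 Omega).
Local Notation H1 := (H1 Omega).
Local Notation SI := (square_integrable leb Omega).
Local Notation pi := (L2_pi mO).

Definition L2_inner : sip (V := L2) := L2_sip leb mO.
Local Notation nr := (hnorm L2_inner).

Lemma sqr_hnorm_integral f (sf : SI f) :
  nr (pi sf) ^+ 2 = fine (\int[leb]_(x in Omega) (sqmod (f x))%:E).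
Proof. by rewrite (sqr_hnorm_pi mO) Re_cip. Qed.

Lemma L2_normE (f : L2) : L2_norm f = nr f.
Proof. by rewrite hnorm_val. Qed.

Lemma L2_innerE (u v : L2) : L2_inner u v = cip leb Omega (sq_val u) (sq_val v).
Proof. by []. Qed.

Lemma L2_inner_pi f g (sf : SI f) (sg : SI g) : L2_inner (pi sf) (pi sg) = cip leb Omega f g.
Proof. exact: L2_ip_pi. Qed.

Lemma L2_inner_definite : definite L2_inner. Proof. exact: L2_definite. Qed.

Lemma L2_inner_complete : complete L2_inner.
Proof. by apply: L2_complete; exact: lebesgue_dom. Qed.

Opaque L2_inner.

Lemma H1_square_integrable (u : H1) : SI (sq_val u).1.
Proof. by have [] := sq_val_space u. Qed.

Lemma H1_grad_square_integrable (u : H1) j : SI ((sq_val u).2 j).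
Proof. by have [] := sq_val_space u. Qed.

Definition H1_grad (j : I) (u : H1) : L2 := pi (H1_grad_square_integrable u j).

Lemma H1_L2E (u : H1) : H1_L2 u = pi (H1_square_integrable u).
Proof. exact: val_inj. Qed.

Lemma H1_val_lin a (u v : H1) : H1_null Omega (sq_val (a *: u + v) - (a *: sq_val u + sq_val v)).
Proof.
have nl := sq_nullP (H1_data Omega).
have e (V : zmodType) (x y z t : V) : x - (z + t) = (x - (y + t)) + (y - z).
  by rewrite (addrC y) (addrC z) !opprD (addrA x) (addrA x) subrKA.
rewrite (e _ _ (sq_val (a *: u))) -[X in H1_null _ (X + _)]scale1r.
by apply: nl.2; [exact: (sq_valD (a *: u) v)|exact: (sq_valZ a u)].
Qed.

Lemma H1_L2_lin : linear_to (@H1_L2 R n Omega).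
Proof.
have lin a u v := square_integrable_lin mO a (H1_square_integrable u) (H1_square_integrable v).
move=> a u v; rewrite !H1_L2E -(L2_pi_lin mO _ _ (lin a u v)).
by apply: eq_L2_pi; have [] := H1_val_lin a u v.
Qed.

Lemma H1_grad_lin j : linear_to (H1_grad j).
Proof.
have lin a u v := square_integrable_lin mO a
  (H1_grad_square_integrable u j) (H1_grad_square_integrable v j).
move=> a u v; rewrite -(L2_pi_lin mO _ _ (lin a u v)).
have h := (H1_val_lin a u v).2 j.
rewrite [X in ae_null _ _ X](_ : _ = (sq_val (a *: u + v)).2 j -
  (a *: (sq_val u).2 j + (sq_val v).2 j)) in h; last by [].
exact: eq_L2_pi h.
Qed.

Definition H1_inner : sip (V := H1) := graph_sip L2_inner H1_L2_lin H1_grad_lin.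

Lemma H1_normE u : H1_norm u = hnorm H1_inner u.
Proof.
rewrite hnorm_graphE /H1_norm; congr Num.sqrt.
rewrite H1_L2E; congr (_ + _); first exact/esym/sqr_hnorm_integral.
by apply: eq_bigr => j _; exact/esym/sqr_hnorm_integral.
Qed.

Lemma H1_L2_le u : nr (H1_L2 u) <= hnorm H1_inner u.
Proof. exact: graph_le0. Qed.

Lemma H1_grad_le j u : nr (H1_grad j u) <= hnorm H1_inner u.
Proof. exact: graph_le. Qed.

Lemma ae_null_L2_pi f g (sf : SI f) (sg : SI g) : pi sf = pi sg -> ae_null leb Omega (f - g).
Proof.
move=> e; have sB := square_integrableB mO sf sg; apply: (ae_null_of_cip mO sB).
rewrite Re_cip -sqr_hnorm_integral.
have -> : pi sB = pi sf - pi sg.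
  have h := L2_pi_lin mO sg sf (square_integrable_lin mO (-1) sg sf).
  rewrite (addrC (pi sf)) -(scaleN1r (pi sg)) -h; apply: eq_L2_pi.
  by rewrite scaleN1r (addrC (- g)) subrr; exact: (ae_null_subspace leb Omega).1.
by rewrite e subrr hnorm0 expr0n.
Qed.

Lemma H1_ext (u v : H1) : H1_L2 u = H1_L2 v -> (forall j, H1_grad j u = H1_grad j v) -> u = v.
Proof.
move=> uv guv; apply: sq_eqP; split.
  by move: uv; rewrite !H1_L2E; exact: ae_null_L2_pi.
by move=> j; exact: (ae_null_L2_pi (guv j)).
Qed.

Lemma H1_definite : definite H1_inner.
Proof.
apply: graph_definite; first exact: L2_inner_definite.
move=> u u0 gu0; apply: H1_ext => [|j].
  by rewrite u0 (linear_to0 H1_L2_lin).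
by rewrite gu0 (linear_to0 (H1_grad_lin j)).
Qed.

Lemma smooth_square_integrable phi : smooth phi -> SI phi.
Proof.
move=> /(_ 0)[[cr _] [ci _]]; split.
  by split; apply: measurable_funTS; exact: continuous_measurable_rV.
have [M1 h1] := continuous_dom_bounded Omega cr.
have [M2 h2] := continuous_dom_bounded Omega ci.
apply: (@le_lt_trans _ _ (\int[leb]_(x in Omega) (M1 ^+ 2 + M2 ^+ 2)%:E)%E); last first.
  have -> := integral_cst leb mO (M1 ^+ 2 + M2 ^+ 2)%:E; apply: lte_mul_pinfty => //.
    by rewrite lee_fin addr_ge0// sqr_ge0.
  exact: lebesgue_dom.
apply: ge0_le_integral => //.
- exact: dom_measurable.
- by move=> x _; rewrite lee_fin sqmod_ge0.
- apply/measurable_EFinP/measurable_sqmod.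
  by split; apply: measurable_funTS; exact: continuous_measurable_rV.
move=> x Ox; rewrite lee_fin /sqmod -(real_normK (num_real (complex.Re _))).
rewrite -(real_normK (num_real (complex.Im _))).
have := h1 x Ox; have := h2 x Ox.
set a := `|_|; set b := `|_| => ha hb.
have a0 : 0 <= a by rewrite normr_ge0.
have b0 : 0 <= b by rewrite normr_ge0.
nra.
Qed.

Lemma weak_gradient_ip (w : (T -> C) * (I -> T -> C)) : SI w.1 -> (forall j, SI (w.2 j)) ->
  weak_gradient Omega w <->
  forall phi, test_function Omega phi -> forall j,
    cip leb Omega w.1 (fun x => conjc (cpartial j phi x)) =
    - cip leb Omega (w.2 j) (fun x => conjc (phi x)).
Proof.
move=> s1 s2; have E f g : cip leb Omega f (fun x => conjc (g x)) = cintegral leb Omega (f * g).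
  by congr cintegral; apply/funext => x; rewrite conjcK.
by split=> h phi tphi j; have := h phi tphi j; rewrite !E.
Qed.

(** In this form the condition on w consists of identities between continuous functionals on L^2,
    hence survives L^2 limits. *)
Lemma weak_gradient_inner (w : (T -> C) * (I -> T -> C)) (s1 : SI w.1)
    (s2 : forall j, SI (w.2 j)) :
  weak_gradient Omega w <->
  forall phi (tphi : test_function Omega phi) j,
    L2_inner (pi s1) (pi (smooth_square_integrable (smoothJ (smooth_cpartial j tphi.1)))) =
    - L2_inner (pi (s2 j)) (pi (smooth_square_integrable (smoothJ tphi.1))).
Proof.
split=> [/(weak_gradient_ip s1 s2) h phi tphi j|h].
  by rewrite !L2_inner_pi h.
apply/(weak_gradient_ip s1 s2) => phi tphi j.
by have := h phi tphi j; rewrite !L2_inner_pi.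
Qed.

(** The pair of the limits f and g is itself a function with its weak gradient, since each defining
    identity passes to the limit. *)
Lemma H1_closed (u : nat -> H1) f (g : I -> L2) : converges L2_inner (@H1_L2 R n Omega \o u) f ->
  (forall j, converges L2_inner (H1_grad j \o u) (g j)) ->
  exists2 v, H1_L2 v = f & forall j, H1_grad j v = g j.
Proof.
move=> uf ug.
pose w : (T -> C) * (I -> T -> C) := (sq_val f, fun j => sq_val (g j)).
have sw1 : SI w.1 by exact: L2_val.
have sw2 j : SI (w.2 j) by exact: L2_val.
have e1 : pi sw1 = f by exact: L2_pi_val.
have e2 j : pi (sw2 j) = g j by exact: L2_pi_val.
have Hw : sq_space (H1_data Omega) w.
  split=> //; apply/(weak_gradient_inner sw1 sw2) => phi tphi j.
  rewrite e1 e2; set p1 := pi _; set p2 := pi _.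
  have wk k : L2_inner (H1_L2 (u k)) p1 = - L2_inner (H1_grad j (u k)) p2.
    rewrite H1_L2E; have [_ _ wg] := sq_val_space (u k).
    have wgP := weak_gradient_inner (H1_square_integrable (u k)) (H1_grad_square_integrable (u k)).
    exact: (wgP.1 wg phi tphi j).
  exact: (converges_sip uf (ug j) wk).
exists (sq_pi Hw : H1).
  rewrite H1_L2E -e1; apply: eq_L2_pi.
  have [] : H1_null Omega (sq_val (sq_pi Hw) - w) := sq_piK Hw; done.
move=> j; rewrite -e2; apply: eq_L2_pi.
have [_ /(_ j)] : H1_null Omega (sq_val (sq_pi Hw) - w) := sq_piK Hw; done.
Qed.

Lemma H1_complete : complete H1_inner.
Proof. apply: graph_complete; [exact: L2_inner_complete|exact: H1_closed]. Qed.

End h1_space.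

(** * Integrals of partial derivatives over the whole space *)

Section integration_by_parts.
Context {R : realType}.
Local Notation leb n := (@lebesgue_rV R n).

(** Boxes are stable under fixing the first coordinate, as the induction on the dimension
    requires. *)
Definition vanishes_off_box n (M : R) (f : 'rV[R]_n -> R) : Prop :=
  forall (x : 'rV[R]_n) i, M < `|x 0 i| -> f x = 0.

Lemma box_integrable n (f : 'rV[R]_n.+1 -> R) (M : R) : continuous f ->
  vanishes_off_box M f -> (leb n.+1).-integrable setT (EFin \o f).
Proof.
move=> cf f0; pose box := [set x : 'rV[R]_n.+1 | forall i, `|x 0 i| <= M].
have mbox : measurable box.
  rewrite (_ : box = \bigcap_(i in [set: 'I_n.+1])
      ((fun x : 'rV[R]_n.+1 => x 0 i) @^-1` `[- M, M]%classic)); last first.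
    by apply/seteqP; split=> x xM i /=; have := xM i;
      rewrite /= in_itv/= -ler_norml; [move=> + _|exact].
  apply: fin_bigcap_measurable => // i _.
  by rewrite -[X in measurable X]setTI; exact: measurable_coord.
have fE : f \_ box = f.
  apply/funext => x; rewrite patchE; case: ifPn => // /negP xbox.
  have [i Mi] : exists i, M < `|x 0 i|.
    apply: contrapT => /forallNP Mx; apply: xbox; apply/mem_set => i.
    by rewrite leNgt; apply/negP/Mx.
  by rewrite (f0 x i).
(* The radius is positive and exceeds M, so this compact ball contains the box and bounds f on
   it. *)
have cK : compact (closed_ball (0 : 'rV[R]_n.+1) (`|M| + 1)).
  apply: bounded_closed_compact; last exact: closed_ball_closed.
  exists (`|M| + 1); split; first exact: num_real.
  move=> r Mr x; rewrite closed_ballE ?ltr_wpDl// /closed_ball_ /= sub0r normrN.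
  by move=> /le_trans; apply; exact: ltW.
rewrite -fE -restrict_EFin; apply/integrable_restrict => //; rewrite ?setTI.
apply: measurable_bounded_integrable => //.
- exact: lebesgue_rV_bounded.
- by apply: measurable_funTS; exact: continuous_measurable_rV.
have := continuous_compact (continuous_subspaceT cf) cK.
move=> /compact_bounded[N [Nr fN]]; exists N; split=> // N' NN' x xbox.
apply: fN => //; exists x => //.
rewrite closed_ballE ?ltr_wpDl// /closed_ball_ /= sub0r normrN.
rewrite [leLHS]/Num.norm /= mx_normrE; apply/bigmax_leP; split=> [|[i k] _] /=.
  by rewrite addr_ge0.
rewrite (ord1 i); apply: le_trans (xbox k) _; apply: le_trans (ler_norm _) _.
by rewrite lerDl.
Qed.

Lemma derive_comp_line n (h : 'rV[R]_n -> R) (v x : 'rV[R]_n) (t : R) :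
  derivable h (x + t *: v) v ->
  derivable (fun s : R => h (x + s *: v)) t 1 /\
  'D_1 (fun s : R => h (x + s *: v)) t = 'D_v h (x + t *: v).
Proof.
have e : (fun s : R => s^-1 *:
     (((fun s : R => h (x + s *: v)) \o shift t) (s *: 1) - h (x + t *: v))) =
   (fun s => s^-1 *: ((h \o shift (x + t *: v)) (s *: v) - h (x + t *: v))).
  apply/funext => s /=; rewrite (_ : s *: (1 : R) = s); last exact: mulr1.
  by rewrite scalerDl addrCA.
by rewrite /derivable /derive e.
Qed.

Lemma rV_cons_line n (a : R) (y : 'rV[R]_n) :
  rV_cons (a, y) = rV_cons (0, y) + a *: delta_mx 0 ord0.
Proof.
apply/rowP => i; rewrite !mxE; case: (unliftP ord0 i) => [j ->|->].
  by rewrite /= mulr0 addr0.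
by rewrite /= mulr1 add0r.
Qed.

Lemma rV_cons_shift n (a t : R) (y : 'rV[R]_n) j :
  rV_cons (a, t *: delta_mx 0 j + y) = t *: delta_mx 0 (lift ord0 j) + rV_cons (a, y).
Proof.
apply/rowP => i; rewrite !mxE; case: (unliftP ord0 i) => [k ->|->].
  by rewrite !mxE /= (inj_eq lift_inj).
by rewrite /= mulr0 add0r.
Qed.

Lemma derive_rV_cons n (h : 'rV[R]_n.+1 -> R) (a : R) (y : 'rV[R]_n) j :
  derivable h (rV_cons (a, y)) (delta_mx 0 (lift ord0 j)) ->
  derivable (fun y => h (rV_cons (a, y))) y (delta_mx 0 j) /\
  partial j (fun y => h (rV_cons (a, y))) y = partial (lift ord0 j) h (rV_cons (a, y)).
Proof.
have e : (fun t : R => t^-1 *: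
     (((fun y => h (rV_cons (a, y))) \o shift y) (t *: delta_mx 0 j) - h (rV_cons (a, y)))) =
   (fun t => t^-1 *: ((h \o shift (rV_cons (a, y))) (t *: delta_mx 0 (lift ord0 j)) -
     h (rV_cons (a, y)))).
  by apply/funext => s /=; rewrite rV_cons_shift.
by rewrite /partial /derivable /derive e.
Qed.

Lemma continuous_rV_cons n (a : R) : continuous (fun y : 'rV[R]_n => rV_cons (a, y)).
Proof.
move=> y; have FF : Filter (nbhs y) by exact: nbhs_filter.
apply/cvg_ballP => e e0.
have : \forall z \near y, ball y e z by exact: nbhsx_ballx.
apply: filterS => z [_ yz]; split=> // i k; rewrite !mxE /=.
case: (unliftP ord0 k) => [l _|_]; last exact: ballxx.
by have := yz 0 l.
Qed.

(** The strict inequality describes an open set, so h vanishes in a whole neighbourhood of x. *)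
Lemma partial_vanishes_off_box n (h : 'rV[R]_n -> R) M j :
  vanishes_off_box M h -> vanishes_off_box M (partial j h).
Proof.
move=> h0 x i Mi; rewrite /partial (near_eq_derive (g := cst 0)) ?derive_cst//.
have oM : open [set x : 'rV[R]_n | M < `|x 0 i|].
  apply: (@open_comp _ _ (fun x : 'rV[R]_n => `|x 0 i|) [set r | M < r]) => [z _|].
    by apply: continuous_comp; [exact: coord_continuous|exact: norm_continuous].
  exact: open_gt.
have : nbhs x [set x : 'rV[R]_n | M < `|x 0 i|] by apply: open_nbhs_nbhs.
by apply: filterS => z /h0.
Qed.

(* Fubini's theorem: the first variable is handled by the fundamental theorem of
   calculus and the others by induction on the dimension. *)
Lemma integral_partial n (h : 'rV[R]_n -> R) (M : R) (j : 'I_n) : continuous h ->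
  (forall x, derivable h x (delta_mx 0 j)) -> continuous (partial j h) ->
  vanishes_off_box M h ->
  (\int[leb n]_x (partial j h x)%:E = 0)%E.
Proof.
elim: n h j => [h []//|n IH] h j ch dh cd h0.
have id := box_integrable cd (partial_vanishes_off_box j h0).
have mcons : measurable_fun
    [set: (g_sigma_algebraType (R.-ocitv.-measurable) * 'rV[R]_n)%type] (@rV_cons R n).
  exact: measurable_rV_cons.
have md : measurable_fun setT (EFin \o partial j h).
  by apply/measurable_EFinP; exact: continuous_measurable_rV.
have ip : (lebesgue_measure \x leb n)%E.-integrable setT
    ((EFin \o partial j h) \o @rV_cons R n).
  apply/integrableP; split; first exact: measurableT_comp.
  have /integrableP[_] := id.
  rewrite /= /lebesgue_step ge0_integral_pushforward//.
  by apply/measurable_EFinP; apply: measurableT_comp => //; exact: continuous_measurable_rV.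
have -> := integral_pushforward mcons md ip measurableT; rewrite preimage_setT.
(* The variable of differentiation must lie in the inner integral: for j > 0 the last n variables
   come first and the induction hypothesis applies, for j = 0 the first variable. *)
have [[k jk]|j0] : (exists k : 'I_n, j = lift ord0 k) \/ j = ord0.
  by case: (unliftP ord0 j) => [k ->|->]; [left; exists k|right].
  rewrite -integral12_prod_meas1// integral0_eq// => a _; rewrite /fubini_F /=.
  rewrite (eq_integral (fun y : 'rV[R]_n =>
    (partial k (fun y => h (rV_cons (a, y))) y)%:E)); last first.
    by move=> y _; rewrite jk (derive_rV_cons _).2// -jk.
  have dk y : partial k (fun y => h (rV_cons (a, y))) y = partial j h (rV_cons (a, y)).
    by rewrite jk (derive_rV_cons _).2// -jk.
  apply: IH => [|y||y i Mi].
  - by move=> y; apply: continuous_comp; [exact: continuous_rV_cons|exact: ch].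
  - by apply: (derive_rV_cons _).1; rewrite -jk.
  - rewrite (_ : partial k _ = fun y => partial j h (rV_cons (a, y))); last exact/funext.
    by move=> y; apply: continuous_comp; [exact: continuous_rV_cons|exact: cd].
  - by apply: (h0 _ (lift ord0 i)); rewrite mxE liftK.
rewrite -integral21_prod_meas1// integral0_eq// => y _; rewrite /fubini_G /=.
pose x0 := rV_cons (0, y) : 'rV[R]_n.+1; pose e0 : 'rV[R]_n.+1 := delta_mx 0 ord0.
pose phi (a : R) := h (x0 + a *: e0).
have dphi a : derivable phi a 1 /\ 'D_1 phi a = partial j h (rV_cons (a, y)).
  have [d1 d2] := derive_comp_line (dh (x0 + a *: delta_mx 0 j)).
  by rewrite rV_cons_line -/x0; split; [rewrite /phi /e0 -j0|rewrite /phi /e0 -j0].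
have cline : continuous (fun a : R => x0 + a *: e0).
  move=> a; apply: cvgD; first exact: cvg_cst.
  by apply: cvgZr_tmp; exact: cvg_id.
have cphi : continuous phi.
  by move=> a; apply: continuous_comp; [exact: cline|exact: ch].
have cdphi : continuous (fun a => partial j h (rV_cons (a, y))).
  rewrite (_ : (fun a => _) = fun a => partial j h (x0 + a *: e0)).
    by move=> a; apply: continuous_comp; [exact: cline|exact: cd].
  by apply/funext => a; rewrite rV_cons_line.
(* The end points -N and N lie outside the box, so phi vanishes at both. *)
pose N : R := `|M| + 1.
have MN a : N <= `|a| -> M < `|rV_cons (a, y) 0 ord0|.
  move=> Na; rewrite mxE unlift_none /=; apply: lt_le_trans Na.
  by apply: le_lt_trans (ler_norm _) _; rewrite ltrDl.
have N0 : 0 < N by rewrite ltr_wpDl.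
transitivity (\int[@lebesgue_measure R]_(a in `[(- N)%R, N%R]%classic)
  (partial j h (rV_cons (a, y)))%:E)%E.
  rewrite [RHS]integral_mkcond; apply: eq_integral => a _.
  rewrite patchE; case: ifPn => // /negP aN.
  rewrite (partial_vanishes_off_box j h0 (i := ord0))//; apply: MN.
  rewrite leNgt; apply/negP => aN'; apply: aN; apply/mem_set.
  by rewrite /= in_itv /= -ler_norml ltW.
rewrite (@continuous_FTC2 _ _ phi)//.
- rewrite /phi /x0 /e0 -!rV_cons_line !(h0 _ ord0) ?subee//; apply: MN.
    by rewrite normrN ger0_norm// ltW.
  by rewrite ger0_norm// ltW.
- by rewrite gtrN.
- exact: continuous_subspaceT.
- split=> [a _||]; first exact: (dphi a).1.
    exact/cvg_at_right_filter/cphi.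
  exact/cvg_at_left_filter/cphi.
- by move=> a _; rewrite derive1E (dphi a).2.
Qed.
End integration_by_parts.

(** * Test functions as elements of H^1 with zero trace *)

Section test_functions.
Context {R : realType} {n : nat}.
Local Notation C := R[i].
Local Notation T := 'rV[R]_n.+1.
Local Notation I := 'I_n.+1.
Local Notation leb := (@lebesgue_rV R n.+1).
Implicit Types (f g : T -> R) (j : I).

Definition C1_along j f :=
  [/\ continuous f, forall x, derivable f x (delta_mx 0 j) & continuous (partial j f)].

Lemma partialD j f g : C1_along j f -> C1_along j g ->
  partial j (f + g) = partial j f + partial j g.
Proof. by move=> [_ df _] [_ dg _]; apply/funext => x; rewrite /partial deriveD. Qed.

Lemma partialN j f : C1_along j f -> partial j (- f) = - partial j f.
Proof. by move=> [_ df _]; apply/funext => x; rewrite /partial deriveN. Qed.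

Lemma partialM j f g : C1_along j f -> C1_along j g ->
  partial j (f * g) = f * partial j g + g * partial j f.
Proof. by move=> [_ df _] [_ dg _]; apply/funext => x; rewrite /partial deriveM. Qed.

Lemma C1_alongD j f g : C1_along j f -> C1_along j g -> C1_along j (f + g).
Proof.
move=> Cf Cg; have [cf df cdf] := Cf; have [cg dg cdg] := Cg; split.
- by move=> x; exact: (cvgD (cf x) (cg x)).
- by move=> x; exact: derivableD.
- by rewrite partialD// => x; exact: (cvgD (cdf x) (cdg x)).
Qed.

Lemma C1_alongN j f : C1_along j f -> C1_along j (- f).
Proof.
move=> Cf; have [cf df cdf] := Cf; split.
- by move=> x; exact: (cvgN (cf x)).
- by move=> x; exact: derivableN.
- by rewrite partialN// => x; exact: (cvgN (cdf x)).
Qed.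

Lemma C1_alongM j f g : C1_along j f -> C1_along j g -> C1_along j (f * g).
Proof.
move=> Cf Cg; have [cf df cdf] := Cf; have [cg dg cdg] := Cg; split.
- by move=> x; exact: (cvgM (cf x) (cg x)).
- by move=> x; exact: derivableM.
- rewrite partialM// => x.
  exact: (cvgD (cvgM (cf x) (cdg x)) (cvgM (cg x) (cdf x))).
Qed.

Lemma smooth_C1 (w : T -> C) j : smooth w ->
  C1_along j (fun x => complex.Re (w x)) /\ C1_along j (fun x => complex.Im (w x)).
Proof.
by move=> /(_ 1%N)[[cr /(_ j)[dr [cdr _]]] [ci /(_ j)[di [cdi _]]]].
Qed.

Variable Omega : bounded_lipschitz_domain R n.

(** K is closed and contained in the domain, so the derivative vanishes off the domain and the
    integral extends to the whole space. *)
Lemma Rintegral_partial f j (K : set T) : C1_along j f -> compact K -> K `<=` Omega ->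
  (forall x, ~ K x -> f x = 0) -> \int[leb]_(x in Omega) partial j f x = 0.
Proof.
move=> [cf df cdf] cK KO f0.
have [M [_ KM]] := compact_bounded cK.
have fM : vanishes_off_box (M + 1) f.
  move=> x i xi; apply: f0 => Kx; have := KM (M + 1) _ x Kx; rewrite ltrDl ltr01.
  move=> /(_ isT) xM; move: xi; rewrite ltNge => /negP; apply; apply: le_trans xM.
  by rewrite [leRHS]/Num.norm /= mx_normrE; apply/bigmax_geP; right; exists (0, i).
rewrite /Rintegral.
rewrite (_ : (\int[leb]_(x in Omega) _)%E = (\int[leb]_x (partial j f x)%:E)%E).
  by rewrite (integral_partial cf df cdf fM).
rewrite [LHS]integral_mkcond; apply: eq_integral => x _.
rewrite patchE; case: ifPn => // /negP xO.
have xK : ~ K x by move=> /KO Ox; apply: xO; apply/mem_set.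
rewrite /partial (near_eq_derive (g := cst 0)) ?derive_cst//.
have oK : open (~` K) by rewrite openC; apply: compact_closed => //; exact: norm_hausdorff.
have : nbhs x (~` K) by exact: open_nbhs_nbhs.
by apply: filterS => z /f0.
Qed.

(** By the product rule the two integrands add up to the derivative of w phi, which has compact
    support in the domain and so integrates to 0. *)
Lemma test_function_weak_gradient (w : T -> C) : test_function Omega w ->
  weak_gradient Omega (w, fun j => cpartial j w).
Proof.
move=> [sw [K [cK KO w0]]] phi [sphi _] j /=.
have [Ca Cb] := smooth_C1 j sw; have [Cc Cd] := smooth_C1 j sphi.
set a := (fun x => complex.Re (w x)) in Ca; set b := (fun x => complex.Im (w x)) in Cb.
set c := (fun x => complex.Re (phi x)) in Cc; set e := (fun x => complex.Im (phi x)) in Cd.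
have cm (u v : T -> C) : smooth u -> smooth v -> cintegrable leb Omega (u * v).
  move=> su sv; rewrite (_ : u * v = fun x => u x * conjc (conjc (v x))).
    apply: cintegrable_mulJ; [exact: dom_measurable|exact: smooth_square_integrable|].
    by apply: smooth_square_integrable; exact: smoothJ.
  by apply/funext => x; rewrite conjcK.
apply/eqP; rewrite -addr_eq0 -[X in X + _]mul1r -cintegralZD; last 3 first.
- exact: dom_measurable.
- by apply: cm => //; exact: smooth_cpartial.
- by apply: cm => //; exact: smooth_cpartial.
apply/eqP; rewrite /cintegral; congr Complex.
  (* The real part of w phi; the imaginary part, a e + b c, is treated below. *)
  have h0 x : ~ K x -> (a * c - b * e) x = 0.
    by move=> /w0 wx; rewrite [LHS](_ : _ = a x * c x - b x * e x)// /a /b wx !mul0r subrr.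
  have Cac := C1_alongM Ca Cc; have Cbe := C1_alongM Cb Cd.
  have Ch := C1_alongD Cac (C1_alongN Cbe).
  rewrite -[RHS](Rintegral_partial Ch cK KO h0); congr Rintegral; apply/funext => x.
  rewrite (partialD Cac (C1_alongN Cbe)) (partialN Cbe) (partialM Ca Cc) (partialM Cb Cd).
  rewrite [RHS](_ : _ = a x * partial j c x + c x * partial j a x -
    (b x * partial j e x + e x * partial j b x))//.
  rewrite [X in complex.Re X](_ : _ = 1 * (w x * cpartial j phi x) + cpartial j w x * phi x)//.
  by rewrite /cpartial -/a -/b -/c -/e /a /b /c /e; case: (w x) (phi x) => [? ?] [? ?] /=; ring.
have h0 x : ~ K x -> (a * e + b * c) x = 0.
  by move=> /w0 wx; rewrite [LHS](_ : _ = a x * e x + b x * c x)// /a /b wx !mul0r addr0.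
have Cae := C1_alongM Ca Cd; have Cbc := C1_alongM Cb Cc; have Ch := C1_alongD Cae Cbc.
rewrite -[RHS](Rintegral_partial Ch cK KO h0); congr Rintegral; apply/funext => x.
rewrite (partialD Cae Cbc) (partialM Ca Cd) (partialM Cb Cc).
rewrite [RHS](_ : _ = a x * partial j e x + e x * partial j a x +
  (b x * partial j c x + c x * partial j b x))//.
rewrite [X in complex.Im X](_ : _ = 1 * (w x * cpartial j phi x) + cpartial j w x * phi x)//.
by rewrite /cpartial -/a -/b -/c -/e /a /b /c /e; case: (w x) (phi x) => [? ?] [? ?] /=; ring.
Qed.

Definition test_H1_space (w : T -> C) (tw : test_function Omega w) :
  sq_space (H1_data Omega) (w, fun j => cpartial j w).
Proof.
split=> [|j|]; last exact: test_function_weak_gradient.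
  exact: smooth_square_integrable tw.1.
exact: smooth_square_integrable (smooth_cpartial _ tw.1).
Qed.

Definition test_H1 w (tw : test_function Omega w) : H1 Omega := sq_pi (test_H1_space tw).

Variables (sigma : {finite_measure set T -> \bar R}) (gammaD : H1 Omega -> H12 sigma).

Lemma hausdorff0 : (hausdorff n (set0 : set T) <= 0)%E.
Proof.
apply: ge_ereal_sup => _ [delta _ <-].
(* A cover by empty sets: their diameter is -oo, and their weight is 0 even for n = 0. *)
apply: ereal_inf_lbound; exists (fun=> set0); split=> [k|x []|].
  rewrite /diameter (_ : mkset _ = set0) ?ereal_sup0 ?leNye//.
  by apply/seteqP; split=> // r [x [y []]].
by rewrite eseries0// => k _ _; rewrite /hausdorff_weight asboolT.
Qed.

(** An open set is disjoint from its boundary, where the surface measure lives. *)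
Lemma surface_measure_dom : is_surface_measure Omega sigma -> sigma Omega = 0%E.
Proof.
move=> sigmaP; apply/le_anti; rewrite measure_ge0 andbT sigmaP; last exact: dom_measurable.
rewrite (_ : _ `&` _ = set0).
  by rewrite mule_ge0_le0 ?hausdorff0.
apply/seteqP; split=> // x [Ox [_]]; apply.
by rewrite (interior_id _).1 //; exact: dom_open.
Qed.

(** The trace equals w almost everywhere for sigma, and w vanishes off the domain, which is a null
    set for sigma. *)
Lemma test_trace w (tw : test_function Omega w) : is_surface_measure Omega sigma ->
  is_dirichlet_trace gammaD -> gammaD (test_H1 tw) = 0.
Proof.
move=> sigmaP gP; have [K [cK KO w0]] := tw.2.
have nl := ae_null_subspace sigma [set: T].
have uw : ae_null leb Omega ((sq_val (test_H1 tw)).1 - w).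
  by have [] : H1_null Omega (sq_val (test_H1 tw) - (w, fun j => cpartial j w)) :=
    sq_piK (test_H1_space tw).
have gw := trace_restriction gP tw.1 uw.
have wn : ae_null sigma setT w.
  exists Omega; split; [exact: dom_measurable|exact: surface_measure_dom|].
  by move=> x /=; apply: contra_notP => xO _; apply: w0 => /KO.
have g0 : ae_null sigma setT (sq_val (gammaD (test_H1 tw))).
  by rewrite -(subrK w (sq_val _)) -[X in X + _]scale1r; exact: nl.2.
have z0 : ae_null sigma setT (sq_val (0 : H12 sigma)).
  have := sq_piK (sq_spaceP (H12_data sigma)).1.
  by rewrite subr0.
by apply: sq_eqP; rewrite addrC -scaleN1r; exact: nl.2.
Qed.

End test_functions.

(** * The form of the differential expression *)

Section bounded_sesquilinear.
Context {R : realType} {V X : lmodType R[i]}.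
Variables (pV : sip (V := V)) (pX : sip (V := X)) (j : V -> X).
Local Notation nV := (hnorm pV).
Local Notation nX := (hnorm pX).

Definition bounded_sesq (b : V -> V -> R[i]) := sesquilinear b /\ bounded_form pV b.

Definition bounded_map (F : V -> X) :=
  linear_to F /\ exists2 M : R, 0 <= M & forall u, nX (F u) <= M * nV u.

Lemma bounded_sesq_pull (F H : V -> X) : bounded_map F -> bounded_map H ->
  bounded_sesq (fun u v => pX (F u) (H v)).
Proof.
move=> [Fl [M M0 FM]] [Hl [N N0 HN]]; split.
  by split=> [a u v w|u a v w]; [rewrite Fl sip_lin|rewrite Hl sip_linr].
exists (M * N) => u v; apply: le_trans (cauchy_schwarz _ _ _) _.
apply: (@le_trans _ _ ((M * nV u) * (N * nV v))); first by rewrite ler_pM ?hnorm_ge0.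
by rewrite le_eqVlt; apply/orP; left; apply/eqP; ring.
Qed.

Lemma bounded_sesqD b b' : bounded_sesq b -> bounded_sesq b' ->
  bounded_sesq (fun u v => b u v + b' u v).
Proof.
move=> [[bl br] [M bM]] [[bl' br'] [M' bM']]; split.
  split=> [a u v w|u a v w]; first by rewrite bl bl'; ring.
  by rewrite br br'; ring.
exists (M + M') => u v; apply: le_trans (le_normcD _ _) _.
by rewrite !mulrDl lerD.
Qed.

Lemma bounded_sesq0 : bounded_sesq (fun u v => 0).
Proof.
split; first by split=> [a u v w|u a v w]; rewrite mulr0 addr0.
by exists 0 => u v; rewrite !mul0r normc0.
Qed.

Lemma bounded_sesq_sum (I : Type) (s : seq I) (b : I -> V -> V -> R[i]) :
  (forall i, bounded_sesq (b i)) -> bounded_sesq (fun u v => \sum_(i <- s) b i u v).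
Proof.
move=> bi; elim: s => [|i s IH].
  rewrite (_ : (fun u v => _) = fun u v => 0); first exact: bounded_sesq0.
  by apply/funext => u; apply/funext => v; rewrite big_nil.
rewrite (_ : (fun u v => _) = fun u v => b i u v + \sum_(i <- s) b i u v).
  exact: bounded_sesqD.
by apply/funext => u; apply/funext => v; rewrite big_cons.
Qed.

(** Young's inequality K |u| |j u| <= (c/2) |u|^2 + K^2/(2 c) |j u|^2 absorbs the lower-order part;
    the further summand c in the shift restores the part of |u|^2 that [b] does not see. *)
Lemma garding_of_lower_order (b l : V -> V -> R[i]) (c K : R) : 0 < c -> 0 <= K ->
  (forall u, c * (nV u ^+ 2 - nX (j u) ^+ 2) <= complex.Re (b u u)) ->
  (forall u, normc (l u u) <= K * nV u * nX (j u)) ->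
  garding pV pX j (fun u v => b u v + l u v).
Proof.
move=> c0 K0 bc lK; exists (c / 2), (c + K ^+ 2 / (2 * c)); split; first by rewrite divr_gt0.
move=> u; rewrite ReD.
have h1 := bc u; have h2 := lK u; have := ler_Re_normc (l u u).
rewrite ler_norml => /andP[h3 _].
have h4 := sqr_ge0 (c * nV u - K * nX (j u)).
have h5 : 0 <= (c * nV u - K * nX (j u)) ^+ 2 / (2 * c) by rewrite divr_ge0// mulr_ge0// ltW.
have h6 : (c * nV u - K * nX (j u)) ^+ 2 / (2 * c) =
    c / 2 * nV u ^+ 2 - K * nV u * nX (j u) + K ^+ 2 / (2 * c) * nX (j u) ^+ 2.
  by field; rewrite gt_eqF.
rewrite h6 in h5; lra.
Qed.

(** One of the two factors enters only through the weaker norm of [X]. *)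
Definition lower_order (l : V -> V -> R[i]) := exists2 K : R, 0 <= K &
  forall u, normc (l u u) <= K * nV u * nX (j u).

Lemma lower_order_right (F : V -> X) : bounded_map F -> lower_order (fun u v => pX (F u) (j v)).
Proof.
move=> [_ [K K0 FK]]; exists K => // u; apply: le_trans (cauchy_schwarz _ _ _) _.
by rewrite ler_wpM2r ?hnorm_ge0.
Qed.

Lemma lower_order_left (M : X -> X) (F : V -> X) :
  (exists2 K : R, 0 <= K & forall x, nX (M x) <= K * nX x) -> bounded_map F ->
  lower_order (fun u v => pX (M (j u)) (F v)).
Proof.
move=> [N N0 MN] [_ [K K0 FK]]; exists (N * K) => [|u]; first exact: mulr_ge0.
apply: le_trans (cauchy_schwarz _ _ _) _.
apply: (@le_trans _ _ ((N * nX (j u)) * (K * nV u))); first by rewrite ler_pM ?hnorm_ge0.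
by rewrite le_eqVlt; apply/orP; left; apply/eqP; ring.
Qed.

Lemma lower_orderD l l' : lower_order l -> lower_order l' ->
  lower_order (fun u v => l u v + l' u v).
Proof.
move=> [K K0 lK] [K' K'0 lK']; exists (K + K') => [|u]; first exact: addr_ge0.
by apply: le_trans (le_normcD _ _) _; rewrite !mulrDl lerD.
Qed.

Lemma lower_order_sum (I : Type) (s : seq I) (l : I -> V -> V -> R[i]) :
  (forall i, lower_order (l i)) -> lower_order (fun u v => \sum_(i <- s) l i u v).
Proof.
move=> li; elim: s => [|i s IH].
  by exists 0 => // u; rewrite big_nil normc0 !mul0r.
rewrite (_ : (fun u v => _) = fun u v => l i u v + \sum_(i <- s) l i u v).
  exact: lower_orderD.
by apply/funext => u; apply/funext => v; rewrite big_cons.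
Qed.

End bounded_sesquilinear.

Section differential_form.
Context {R : realType} {n : nat}.
Variable Omega : bounded_lipschitz_domain R n.
Local Notation C := R[i].
Local Notation T := 'rV[R]_n.+1.
Local Notation I := 'I_n.+1.
Local Notation leb := (@lebesgue_rV R n.+1).
Local Notation mO := (dom_measurable Omega).
Local Notation L2 := (L2 Omega).
Local Notation H1 := (H1 Omega).
Local Notation SI := (square_integrable leb Omega).
Local Notation pi := (L2_pi mO).
Local Notation L2_inner := (L2_inner Omega).
Local Notation H1_inner := (H1_inner Omega).
Local Notation nr := (hnorm L2_inner).
Local Notation nV := (hnorm H1_inner).
Local Notation J := (@H1_L2 R n Omega).

(** Presents a coefficient as a bounded operator on L^2, so that the form becomes a sum of inner
    products of bounded maps; the last clause lets any representatives be inserted. *)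
Lemma Linfty_mul (a : T -> C) (ba : Linfty Omega a) : exists2 M : L2 -> L2,
  linear_to M /\ (exists2 K : R, 0 <= K & forall x, nr (M x) <= K * nr x) &
  forall f (sf : SI f) g (sg : SI g), L2_inner (M (pi sf)) (pi sg) = cip leb Omega (a * f) g.
Proof.
have eb : ess_bounded leb Omega a by exact: ba.
exists (L2_mul (mD := mO) eb).
  by split; [exact: L2_mul_lin|exact: L2_mul_bound].
move=> f sf g sg.
have e : L2_mul (mD := mO) eb (pi sf) = pi (square_integrable_mul mO eb sf).
  apply: eq_L2_pi; have := sq_piK (sf : sq_space (L2_data leb mO) f).
  apply: filterS => x h Ox.
  have -> : (a * sq_val (pi sf) - a * f) x = a x * (sq_val (pi sf) - f) x.
    rewrite [LHS](_ : _ = a x * sq_val (pi sf) x - a x * f x)//.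
    by rewrite [RHS](_ : _ = a x * (sq_val (pi sf) x - f x))// mulrBr.
  by rewrite h// mulr0.
exact: (etrans (congr1 (fun z => L2_inner z (pi sg)) e) (L2_inner_pi _ _)).
Qed.

Lemma bounded_L2 : bounded_map H1_inner L2_inner J.
Proof.
split; first exact: H1_L2_lin.
by exists 1 => // u; rewrite mul1r; exact: H1_L2_le.
Qed.

Lemma bounded_grad j : bounded_map H1_inner L2_inner (@H1_grad R n Omega j).
Proof.
split; first exact: H1_grad_lin.
by exists 1 => // u; rewrite mul1r; exact: H1_grad_le.
Qed.

Lemma bounded_map_comp (M : L2 -> L2) (F : H1 -> L2) : linear_to M ->
  (exists2 K : R, 0 <= K & forall x, nr (M x) <= K * nr x) ->
  bounded_map H1_inner L2_inner F -> bounded_map H1_inner L2_inner (M \o F).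
Proof.
move=> Ml [K K0 MK] [Fl [N N0 FN]]; split; first by move=> a u v; rewrite /= Fl Ml.
exists (K * N) => [|u]; first by rewrite mulr_ge0.
by apply: le_trans (MK _) _; rewrite -mulrA ler_wpM2l.
Qed.

(** Pointwise ellipticity with xi_j = F_j(x), integrated over the domain. *)
Lemma principal_part_ge (L : @coefficients R n) (c : R) (F : I -> T -> C) :
  Linfty_coefficients Omega L ->
  (forall (xi : I -> C) x, dom Omega x -> c * (\sum_j sqmod (xi j)) <=
    complex.Re (\sum_j \sum_k coef_a L j k x * conjc (xi j) * xi k)) ->
  (forall j, SI (F j)) ->
  c * (\sum_j complex.Re (cip leb Omega (F j) (F j))) <=
  complex.Re (\sum_j \sum_k cip leb Omega (coef_a L j k * F k) (F j)).
Proof.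
move=> [aL _ _ _] ell sF.
have saF j k : SI (coef_a L j k * F k).
  by apply: square_integrable_mul; [exact: mO|exact: aL|exact: sF].
have i1 j k := (cintegrable_mulJ mO (saF j k) (sF j)).1.
have i2 j := (cintegrable_mulJ mO (sF j) (sF j)).1.
have [i1s e1s] : leb.-integrable Omega (EFin \o (fun x => \sum_j \sum_k
      complex.Re ((coef_a L j k * F k) x * conjc (F j x)))) /\
    \int[leb]_(x in Omega) (\sum_j \sum_k complex.Re ((coef_a L j k * F k) x * conjc (F j x))) =
    \sum_j \sum_k complex.Re (cip leb Omega (coef_a L j k * F k) (F j)).
  have h j := Rintegral_sum mO (index_enum I) (i1 j).
  have [h1 h2] := Rintegral_sum mO (index_enum I) (fun j => (h j).1).
  by split=> //; rewrite h2; apply: eq_bigr => j _; rewrite (h j).2.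
have [i2s e2s] := Rintegral_sum mO (index_enum I) i2.
rewrite Re_sum; under [leRHS]eq_bigr do rewrite Re_sum.
rewrite -e1s.
have -> : \sum_j complex.Re (cip leb Omega (F j) (F j)) =
    \int[leb]_(x in Omega) (\sum_j complex.Re (F j x * conjc (F j x))) by rewrite e2s.
rewrite -RintegralZl//; last exact: mO.
apply: le_Rintegral => //; first exact: mO.
  by have := integrableZl mO c i2s; apply: eq_integrable; first exact: mO.
move=> x Ox; have := ell (fun j => F j x) x Ox.
have -> : \sum_j complex.Re (F j x * conjc (F j x)) = \sum_j sqmod (F j x).
  by apply: eq_bigr => j _; case: (F j x) => a b; rewrite /sqmod /=; ring.
rewrite Re_sum => /le_trans; apply; rewrite le_eqVlt; apply/orP; left; apply/eqP.
apply: eq_bigr => j _; rewrite Re_sum; apply: eq_bigr => k _.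
rewrite (_ : (coef_a L j k * F k) x = coef_a L j k x * F k x)//.
by congr complex.Re; ring.
Qed.

Lemma Phi_elliptic (L : @coefficients R n) :
  Linfty_coefficients Omega L -> uniformly_elliptic Omega L ->
  elliptic_sesq H1_inner L2_inner J (@Phi R n Omega L).
Proof.
move=> Li [c c0 ell]; have [aL bL dL qL] := Li.
have mA j k := cid2 (Linfty_mul (aL j k)).
have mB j := cid2 (Linfty_mul (bL j)).
have mD j := cid2 (Linfty_mul (dL j)).
have [Q [Ql Qb] QE] := Linfty_mul qL.
pose G j : H1 -> L2 := H1_grad j.
(* [b] is the principal part; [l] gathers the terms with at least one undifferentiated factor. *)
pose b u v : C := \sum_j \sum_k L2_inner (sval (mA j k) (G k u)) (G j v).
pose l u v : C := \sum_j L2_inner (sval (mB j) (G j u)) (J v)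
  + \sum_j L2_inner (sval (mD j) (J u)) (G j v) + L2_inner (Q (J u)) (J v).
have PhiE : @Phi R n Omega L = fun u v => b u v + l u v.
  apply/funext => u; apply/funext => v.
  rewrite /Phi /form /b /l !addrA; congr (_ + _ + _ + _).
  - apply: eq_bigr => j _; apply: eq_bigr => k _.
    by case: (mA j k) => M MP /= E; exact/esym/E.
  - apply: eq_bigr => j _; case: (mB j) => M MP /= E; rewrite H1_L2E; exact/esym/E.
  - apply: eq_bigr => j _; case: (mD j) => M MP /= E; rewrite H1_L2E; exact/esym/E.
  - by rewrite !H1_L2E; exact/esym/QE.
have bA j k : bounded_map H1_inner L2_inner (sval (mA j k) \o G k).
  by case: (mA j k) => M [Ml Mb] /= _; apply: bounded_map_comp => //; exact: bounded_grad.
have bB j : bounded_map H1_inner L2_inner (sval (mB j) \o G j).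
  by case: (mB j) => M [Ml Mb] /= _; apply: bounded_map_comp => //; exact: bounded_grad.
have bD j : bounded_map H1_inner L2_inner (sval (mD j) \o J).
  by case: (mD j) => M [Ml Mb] /= _; apply: bounded_map_comp => //; exact: bounded_L2.
have bQ : bounded_map H1_inner L2_inner (Q \o J).
  by apply: bounded_map_comp => //; exact: bounded_L2.
have sb : bounded_sesq H1_inner b.
  apply: bounded_sesq_sum => j; apply: bounded_sesq_sum => k.
  exact: (bounded_sesq_pull (bA j k) (bounded_grad j)).
have sl : bounded_sesq H1_inner l.
  apply: bounded_sesqD; first apply: bounded_sesqD.
  - apply: bounded_sesq_sum => j; exact: (bounded_sesq_pull (bB j) bounded_L2).
  - apply: bounded_sesq_sum => j; exact: (bounded_sesq_pull (bD j) (bounded_grad j)).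
  - exact: (bounded_sesq_pull bQ bounded_L2).
have [s1 s2] := bounded_sesqD sb sl.
rewrite PhiE; split=> //.
have [K K0 lK'] : lower_order H1_inner L2_inner J l.
  apply: lower_orderD; first apply: lower_orderD.
  - by apply: lower_order_sum => j; exact: (lower_order_right _ (bB j)).
  - apply: lower_order_sum => j; case: (mD j) => M [Ml Mb] /= _.
    exact: lower_order_left Mb (bounded_grad j).
  - exact: (lower_order_right _ bQ).
apply: (garding_of_lower_order c0 K0 _ lK') => u.
(* The graph norm without its L^2 part is the norm of the gradient, which is what ellipticity
   controls. *)
have -> : nV u ^+ 2 - nr (J u) ^+ 2 = \sum_j nr (G j u) ^+ 2.
  by rewrite sqr_hnorm_graph addrC addKr.
have := principal_part_ge Li ell (H1_grad_square_integrable u).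
have -> : b u u = \sum_j \sum_k cip leb Omega (coef_a L j k * (sq_val u).2 k) ((sq_val u).2 j).
  by apply: eq_bigr => j _; apply: eq_bigr => k _; case: (mA j k) => M MP /= E; exact: E.
apply: le_trans; rewrite ler_pM2l// le_eqVlt; apply/orP; left; apply/eqP.
by apply: eq_bigr => j _; rewrite Re_cip; exact: sqr_hnorm_integral.
Qed.

End differential_form.

(** * Boundary value problems *)

Section boundary_operators.
Context {R : realType} {n : nat}.
Local Notation T := 'rV[R]_n.+1.
Variable sigma : {finite_measure set T -> \bar R}.
Local Notation H12 := (H12 sigma).
Local Notation Hm12 := (Hm12 sigma).
Variable p : H12_inner_product sigma.

Lemma pairingD (phi psi : Hm12) g : pairing (phi + psi) g = pairing phi g + pairing psi g.
Proof. by have := sq_valD phi psi => /= /eqP; rewrite subr_eq0 /pairing => /eqP ->. Qed.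

Lemma pairingZ a (phi : Hm12) g : pairing (a *: phi) g = a * pairing phi g.
Proof. by have := sq_valZ a phi => /= /eqP; rewrite subr_eq0 /pairing => /eqP ->. Qed.

Lemma pairingN (phi : Hm12) g : pairing (- phi) g = - pairing phi g.
Proof. by rewrite -scaleN1r pairingZ mulN1r. Qed.

Lemma pairing0 g : pairing (0 : Hm12) g = 0.
Proof. by rewrite -(scale0r (0 : Hm12)) pairingZ mul0r. Qed.

Lemma pairing_antilinear (phi : Hm12) : antilinear (pairing phi).
Proof. by have [] := sq_val_space phi. Qed.

Lemma pairing_ext (phi psi : Hm12) : (forall g, pairing phi g = pairing psi g) -> phi = psi.
Proof.
by move=> e; apply: sq_eqP; apply/eqP; rewrite subr_eq0; apply/eqP/funext.
Qed.

Lemma pairing_riesz f g : pairing (riesz p f) g = p f g.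
Proof.
have : sq_val (riesz p f) - (fun g => p f g) = 0.
  by rewrite /riesz; exact: (sq_piK (D := Hm12_data sigma)).
by move=> /eqP; rewrite subr_eq0 /pairing => /eqP ->.
Qed.

Lemma ip_ge0 f : 0 <= complex.Re (p f f).
Proof.
have [c [c0 cP]] := ip_coercive p; apply: le_trans (cP f).
by rewrite mulr_ge0 ?sqr_ge0// ltW.
Qed.

Definition H12_inner : sip (V := H12) := Sip (ip_linear p) (ip_herm p) ip_ge0.
Local Notation nB := (hnorm H12_inner).

Lemma H12_norm_ge0 (f : H12) : 0 <= H12_norm f. Proof. exact: sqrtr_ge0. Qed.

(** Together with [le_H12_norm], this lets estimates move between the Sobolev-Slobodeckij norm of
    the definitions and the Hilbert norm of [p]. *)
Lemma H12_norm_le : exists2 c : R, 0 < c & forall f, H12_norm f <= c * nB f.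
Proof.
have [c [c0 cP]] := ip_coercive p.
have s0 : 0 < Num.sqrt c by rewrite sqrtr_gt0.
exists (Num.sqrt c)^-1 => [|f]; first by rewrite invr_gt0.
rewrite ler_pdivlMl// -(ler_pXn2r (_ : 0 < 2)%N) ?nnegrE ?mulr_ge0 ?hnorm_ge0 ?H12_norm_ge0//.
by rewrite exprMn sqr_sqrtr ?(ltW c0)// sqr_hnorm; exact: cP.
Qed.

Lemma le_H12_norm : exists2 c : R, 0 < c & forall f, nB f <= c * H12_norm f.
Proof.
have [M pM] := ip_bounded p.
pose N := `|M| + 1; have N0 : 0 < N by rewrite ltr_wpDl.
have s0 : 0 < Num.sqrt N by rewrite sqrtr_gt0.
exists (Num.sqrt N) => // f.
rewrite -(ler_pXn2r (_ : 0 < 2)%N) ?nnegrE ?mulr_ge0 ?hnorm_ge0 ?H12_norm_ge0//.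
have sE : Num.sqrt N ^+ 2 = N by rewrite sqr_sqrtr// ltW.
rewrite exprMn sE sqr_hnorm; apply: le_trans (Re_le_normc _) _.
apply: le_trans (pM _ _) _; rewrite -expr2 ler_wpM2r ?sqr_ge0//.
by apply: le_trans (ler_norm _) _; rewrite lerDl.
Qed.

(** Coercivity makes the Sobolev norm vanish, and its L^2 part over the boundary alone forces the
    class to be zero. *)
Lemma H12_definite : definite H12_inner.
Proof.
move=> f f0; have [c c0 cP] := H12_norm_le.
have : H12_norm f <= 0 by rewrite -(mulr0 c) -f0.
rewrite /H12_norm => h.
have [sf _] := sq_val_space f.
have A0 : 0 <= fine (\int[sigma]_x (sqmod (sq_val f x))%:E).
  by rewrite fine_ge0// integral_ge0// => x _; rewrite lee_fin sqmod_ge0.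
have B0 : 0 <= fine (\int[(sigma \x sigma)%E]_q (slobodeckij (sq_val f) q)%:E).
  rewrite fine_ge0// integral_ge0// => x _; rewrite lee_fin divr_ge0 ?sqmod_ge0//.
  by rewrite exprn_ge0// sqrtr_ge0.
have {}h : fine (\int[sigma]_x (sqmod (sq_val f x))%:E) = 0.
  move: h; rewrite -[X in _ <= X -> _]sqrtr0 ler_sqrt// => h.
  by apply/le_anti; rewrite A0 andbT; apply: le_trans h; rewrite lerDl.
have nl := ae_null_subspace sigma [set: T].
have fn : ae_null sigma setT (sq_val f).
  by apply: (ae_null_of_cip measurableT sf); rewrite Re_cip.
have zn : ae_null sigma setT (sq_val (0 : H12)).
  have := sq_piK (sq_spaceP (H12_data sigma)).1.
  by rewrite subr0.
by apply: sq_eqP; rewrite addrC -scaleN1r; exact: nl.2.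
Qed.

Lemma riesz_lin : linear_to (riesz p).
Proof.
move=> a f g; apply: pairing_ext => h.
by rewrite pairingD pairingZ !pairing_riesz ip_linear.
Qed.

Lemma riesz_inj : injective (riesz p).
Proof.
move=> f g fg; apply/eqP; rewrite -subr_eq0; apply/eqP/H12_definite.
have e h : H12_inner f h = H12_inner g h by have := pairing_riesz f h; rewrite fg pairing_riesz.
by rewrite /hnorm sipBl e subrr sqrtr0.
Qed.

(** [riesz_inv] selects some preimage, and injectivity identifies it. *)
Lemma riesz_invK f : riesz_inv p (riesz p f) = f.
Proof.
apply: riesz_inj; rewrite /riesz_inv.
by apply: (@xgetPex _ 0 [set h | riesz p h = riesz p f]); exists f.
Qed.

Lemma bounded_linearP (S : H12 -> H12) :
  bounded_linear S <-> linear_to S /\ exists2 M : R, 0 <= M & forall f, nB (S f) <= M * nB f.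
Proof.
have [c1 c10 c1P] := H12_norm_le; have [c2 c20 c2P] := le_H12_norm.
split=> -[Sl].
  move=> [M SM]; split=> //; exists (c2 * (`|M| * c1)) => [|f].
    by rewrite mulr_ge0 ?mulr_ge0// ltW.
  apply: le_trans (c2P _) _; rewrite -!mulrA ler_pM2l//; apply: le_trans (SM _) _.
  apply: (@le_trans _ _ (`|M| * H12_norm f)).
    by rewrite ler_wpM2r ?H12_norm_ge0// ler_norm.
  by rewrite ler_wpM2l.
move=> [M M0 SM]; split=> //; exists (c1 * (M * c2)) => f.
apply: le_trans (c1P _) _; rewrite -!mulrA ler_pM2l//; apply: le_trans (SM _) _.
by rewrite ler_wpM2l.
Qed.

End boundary_operators.

(** * Weak formulation of the operators and of the boundary value problems *)

Section weak_formulation.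
Context {R : realType} {n : nat}.
Variable Omega : bounded_lipschitz_domain R n.
Local Notation C := R[i].
Local Notation T := 'rV[R]_n.+1.
Local Notation I := 'I_n.+1.
Local Notation leb := (@lebesgue_rV R n.+1).
Local Notation L2 := (L2 Omega).
Local Notation H1 := (H1 Omega).
Variables (sigma : {finite_measure set T -> \bar R}).
Local Notation H12 := (H12 sigma).
Local Notation Hm12 := (Hm12 sigma).
Local Notation L2_inner := (L2_inner Omega).
Local Notation H1_inner := (H1_inner Omega).
Local Notation J := (@H1_L2 R n Omega).
Variables (L : @coefficients R n) (gammaD : H1 -> H12).
Hypotheses (sigmaP : is_surface_measure Omega sigma)
  (L_Linfty : Linfty_coefficients Omega L)
  (gammaDP : is_dirichlet_trace gammaD).
Implicit Types (u v : H1) (Theta : H12 -> Hm12) (lambda : C).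

(** [Phi] uses the chosen representative of a class, whereas [distributional] evaluates the form at
    the test function itself. *)
Lemma form_congr (u v w : (T -> C) * (I -> T -> C)) :
  (square_integrable leb Omega u.1) -> (forall j, square_integrable leb Omega (u.2 j)) ->
  (square_integrable leb Omega v.1) -> (forall j, square_integrable leb Omega (v.2 j)) ->
  (square_integrable leb Omega w.1) -> (forall j, square_integrable leb Omega (w.2 j)) ->
  H1_null Omega (v - w) -> form Omega L u v = form Omega L u w.
Proof.
move=> u1 u2 v1 v2 w1 w2 [vw1 vw2]; have [aL bL dL qL] := L_Linfty.
have mO := dom_measurable Omega.
have sm a f : Linfty Omega a -> square_integrable leb Omega f ->
    square_integrable leb Omega (a * f) by move=> ba sf; exact: (square_integrable_mul mO).
rewrite /form; congr (_ + _ + _ + _).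
- apply: eq_bigr => j _; apply: eq_bigr => k _.
  by apply: (cip_congr mO (v2 j) (w2 j) _ (vw2 j)); exact: sm.
- by apply: eq_bigr => j _; apply: (cip_congr mO v1 w1 _ vw1); exact: sm.
- by apply: eq_bigr => j _; apply: (cip_congr mO (v2 j) (w2 j) _ (vw2 j)); exact: sm.
- by apply: (cip_congr mO v1 w1 _ vw1); exact: sm.
Qed.

(* Test functions are elements of H^1 with zero trace, so the distributional
   equation is contained in the second identity. *)
Lemma conormalP u (f : L2) (phi : Hm12) : conormal L gammaD u f phi <->
  forall v, Phi L u v = L2_inner f (J v) + pairing phi (gammaD v).
Proof.
split=> [[_ h] v|h]; first exact: h.
split=> [w tw|v]; last exact: h.
have := h (test_H1 tw).
rewrite (test_trace tw sigmaP gammaDP).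
have -> : pairing phi 0 = 0.
  have := pairing_antilinear phi (-1) 0 0; rewrite scaler0 addr0 => ->.
  by rewrite conjcN conjc1 mulN1r addNr.
rewrite addr0.
have [tw1 tw2 _] := test_H1_space tw.
have nw : H1_null Omega (sq_val (test_H1 tw) - (w, fun j => cpartial j w)) :=
  sq_piK (test_H1_space tw).
rewrite /Phi (form_congr (H1_square_integrable u) (H1_grad_square_integrable u)
  (H1_square_integrable _) (H1_grad_square_integrable _) tw1 tw2 nw) => ->.
rewrite L2_innerE H1_L2E.
transitivity (cip leb Omega (sq_val f) (sq_val (test_H1 tw)).1).
  by apply: cip_pir; exact: L2_val.
have mO := dom_measurable Omega.
exact: (cip_congr mO (H1_square_integrable _) tw1 (L2_val f) nw.1).
Qed.

Lemma boundary_problemP Theta lambda (g : Hm12) u :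
  boundary_problem L gammaD Theta lambda g u <->
  weak_sol L2_inner J (PhiTheta L gammaD Theta) lambda u (fun v => pairing g (gammaD v)).
Proof.
split=> [[phi /conormalP h <-] v|h].
  by rewrite /PhiTheta h sipZl pairingD; ring.
(* The boundary condition forces this conormal derivative. *)
exists (g - Theta (gammaD u)); last by rewrite subrK.
apply/conormalP => v; rewrite pairingD pairingN -h /PhiTheta sipZl; ring.
Qed.

Lemma LThetaP Theta (v h : L2) : LTheta L gammaD Theta (v, h) <->
  exists2 u, J u = v & forall w, PhiTheta L gammaD Theta u w = L2_inner h (J w).
Proof.
split=> [[u [phi [uv /conormalP uh e]]]|[u uv uh]].
  exists u => // w; rewrite /PhiTheta uh -addrA -pairingD e pairing0 addr0//.
exists u, (- Theta (gammaD u)); split=> //; last by rewrite addNr.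
by apply/conormalP => w; rewrite pairingN -[X in X + _]uh /PhiTheta addrK.
Qed.

Lemma weak_sol_LTheta Theta lambda u (x : L2) :
  weak_sol L2_inner J (PhiTheta L gammaD Theta) lambda u (fun v => L2_inner x (J v)) <->
  forall w, PhiTheta L gammaD Theta u w = L2_inner (x + lambda *: J u) (J w).
Proof.
split=> h w; first by rewrite sipDl sipZl -h; ring.
by rewrite h sipDl sipZl; ring.
Qed.

(** In the operator equation v is J u and h must be f + lambda v, so it is the weak equation with
    datum f; uniqueness of v comes from that of weak solutions. *)
Lemma resolvent_setP Theta lambda :
  elliptic_sesq H1_inner L2_inner J (PhiTheta L gammaD Theta) ->
  resolvent_set (LTheta L gammaD Theta) lambda <->
  resolvent_point L2_inner J (PhiTheta L gammaD Theta) lambda.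
Proof.
move=> el; split=> [[ex [M bd]]|rp].
  split=> [x|].
    have [v [[h /LThetaP[u uv uh] hx] _]] := ex x; exists u.
    apply/weak_sol_LTheta => w; rewrite uh; congr (L2_inner _ _).
    by rewrite -hx uv subrK.
  exists M => x u /weak_sol_LTheta xu.
  have := bd (J u) (x + lambda *: J u); rewrite addrK !L2_normE; apply.
  by apply/LThetaP; exists u.
have [ex [M bd]] := rp; split=> [f|].
  have [u uf] := ex f; exists (J u); split.
    exists (f + lambda *: J u); last by rewrite addrK.
    by apply/LThetaP; exists u => //; exact/weak_sol_LTheta.
  move=> v [h /LThetaP[u' <- uh] hf]; congr J.
  apply: (weak_sol_unique (@H1_definite R n Omega) (@H1_complete R n Omega)
    (@H1_L2_lin R n Omega) (@H1_L2_le R n Omega) el rp uf).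
  by apply/weak_sol_LTheta => w; rewrite uh -hf subrK.
exists M => v h /LThetaP[u <- uh]; rewrite !L2_normE; apply: bd.
by apply/weak_sol_LTheta => w; rewrite uh subrK.
Qed.

(** Two conormal derivatives of u agree on all traces, and every boundary function is a trace. *)
Lemma conormal_derivativeP lambda u phi :
  conormal L gammaD u (lambda *: J u) phi -> conormal_derivative L gammaD lambda u = phi.
Proof.
move=> /[dup] hc /conormalP hphi.
have : conormal L gammaD u (lambda *: J u) (conormal_derivative L gammaD lambda u).
  by apply: (@xgetPex _ 0 [set phi | conormal L gammaD u (lambda *: J u) phi]); exists phi.
move=> /conormalP h; apply: pairing_ext => g; have [v <-] := trace_onto gammaDP g.
by have := h v; rewrite hphi => /addrI.
Qed.

Lemma solution_boundary_problem Theta lambda g :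
  (exists u, weak_sol L2_inner J (PhiTheta L gammaD Theta) lambda u
    (fun v => pairing g (gammaD v))) ->
  weak_sol L2_inner J (PhiTheta L gammaD Theta) lambda (solution L gammaD Theta lambda g)
    (fun v => pairing g (gammaD v)).
Proof.
move=> [u uP]; apply/boundary_problemP.
apply: (@xgetPex _ 0 [set u | boundary_problem L gammaD Theta lambda g u]).
by exists u; exact/boundary_problemP.
Qed.

Lemma elliptic_formP Theta : bounded_linear_dual Theta ->
  elliptic_sesq H1_inner L2_inner J (Phi L) ->
  elliptic_form (PhiTheta L gammaD Theta) ->
  elliptic_sesq H1_inner L2_inner J (PhiTheta L gammaD Theta).
Proof.
move=> [Tl _] [[Pl Pr] _ _] [[M bM] [g [c [g0 gc]]]]; split.
- split=> [a u v w|u a v w]; rewrite /PhiTheta.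
    by rewrite Pl (trace_linear gammaDP) Tl pairingD pairingZ; ring.
  by rewrite Pr (trace_linear gammaDP) pairing_antilinear; ring.
- by exists M => u v; rewrite -!H1_normE.
(* The lower-order term changes sides between the two ellipticity conditions. *)
exists g, (- c); split=> // u; have := gc u; rewrite -!H1_normE -!L2_normE; lra.
Qed.

End weak_formulation.

(** * The Cayley transform and its continuation *)

Section main_argument.
Context {R : realType} {n : nat}.
Variable Omega : bounded_lipschitz_domain R n.
Local Notation C := R[i].
Local Notation T := 'rV[R]_n.+1.
Local Notation L2 := (L2 Omega).
Local Notation H1 := (H1 Omega).
Variables (sigma : {finite_measure set T -> \bar R}).
Local Notation H12 := (H12 sigma).
Local Notation Hm12 := (Hm12 sigma).
Local Notation L2_inner := (L2_inner Omega).
Local Notation H1_inner := (H1_inner Omega).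
Local Notation J := (@H1_L2 R n Omega).
Variables (L : @coefficients R n) (gammaD : H1 -> H12) (p : H12_inner_product sigma).
Hypotheses (sigmaP : is_surface_measure Omega sigma)
  (L_Linfty : Linfty_coefficients Omega L)
  (L_elliptic : uniformly_elliptic Omega L)
  (gammaDP : is_dirichlet_trace gammaD).
Local Notation H12_inner := (H12_inner p).
Local Notation nB := (hnorm H12_inner).
Local Notation weak := (weak_sol L2_inner J).
Local Notation elliptic := (elliptic_sesq H1_inner L2_inner J).
Local Notation regular := (resolvent_point L2_inner J).
Local Notation PhiL := (@Phi R n Omega L).
Local Notation iR := (iriesz p).
Local Notation Theta0 := (fun _ : H12 => 0 : Hm12).
Local Notation data := (boundary_data H12_inner gammaD).
Local Notation PhiR := (robin_form H12_inner gammaD PhiL).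
Let H1_def : definite H1_inner := @H1_definite R n Omega.
Let H1_cpl : complete H1_inner := @H1_complete R n Omega.
Let J_lin : linear_to J := @H1_L2_lin R n Omega.
Let J_le := @H1_L2_le R n Omega.
Let Phi_ell : elliptic PhiL := Phi_elliptic L_Linfty L_elliptic.
Let gammaD_lin : linear_to gammaD := trace_linear gammaDP.

Lemma trace_hnorm_bound : exists2 M : R, 0 <= M & forall u, nB (gammaD u) <= M * hnorm H1_inner u.
Proof.
have [c c0 cP] := le_H12_norm p; have [M MP] := trace_bounded gammaDP.
exists (c * `|M|) => [|u]; first by rewrite mulr_ge0// ltW.
apply: le_trans (cP _) _; rewrite -mulrA ler_pM2l//; apply: le_trans (MP u) _.
by rewrite H1_normE ler_wpM2r ?hnorm_ge0// ler_norm.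
Qed.

Lemma PhiTheta0 : PhiTheta L gammaD Theta0 = PhiL.
Proof. by apply/funext => u; apply/funext => v; rewrite /PhiTheta pairing0 addr0. Qed.

Lemma PhiTheta_iR : PhiTheta L gammaD iR = PhiR.
Proof.
apply/funext => u; apply/funext => v.
by rewrite /PhiTheta /robin_form /iriesz pairingZ pairing_riesz.
Qed.

Lemma data_riesz f : data f = fun v => pairing (riesz p f) (gammaD v).
Proof. by apply/funext => v; rewrite pairing_riesz. Qed.

Lemma robin_Phi_elliptic : elliptic PhiR.
Proof.
have [M M0 GM] := trace_hnorm_bound.
by apply: robin_elliptic.
Qed.

Lemma neumann_resolventP lambda :
  resolvent_set (LTheta L gammaD Theta0) lambda <-> regular PhiL lambda.
Proof.
have := @resolvent_setP _ _ Omega sigma L gammaD sigmaP L_Linfty gammaDP Theta0 lambda.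
by rewrite PhiTheta0; apply; exact: Phi_ell.
Qed.

Lemma robin_resolventP lambda :
  resolvent_set (LTheta L gammaD iR) lambda <-> regular PhiR lambda.
Proof.
have := @resolvent_setP _ _ Omega sigma L gammaD sigmaP L_Linfty gammaDP iR lambda.
by rewrite PhiTheta_iR; apply; exact: robin_Phi_elliptic.
Qed.

Lemma weak_solution_exists b lambda : elliptic b -> regular b lambda ->
  exists2 K : R, 0 <= K & forall f,
    (exists u, weak b lambda u (data f)) /\
    forall u, weak b lambda u (data f) -> hnorm H1_inner u <= K * nB f.
Proof.
have [M M0 GM] := trace_hnorm_bound.
exact: (boundary_solution H1_def H1_cpl J_lin J_le gammaD_lin GM M0).
Qed.

Definition neumann_solution lambda f : H1 := solution L gammaD Theta0 lambda (riesz p f).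
Definition robin_solution lambda f : H1 := solution L gammaD iR lambda (riesz p f).

Lemma neumann_solutionP lambda : regular PhiL lambda ->
  forall f, weak PhiL lambda (neumann_solution lambda f) (data f).
Proof.
move=> bl f; have [K _ KP] := weak_solution_exists Phi_ell bl.
have := @solution_boundary_problem _ _ Omega sigma L gammaD sigmaP L_Linfty gammaDP Theta0
  lambda (riesz p f).
by rewrite PhiTheta0 -data_riesz; apply; exact: (KP f).1.
Qed.

Lemma robin_solutionP lambda : regular PhiR lambda ->
  forall f, weak PhiR lambda (robin_solution lambda f) (data f).
Proof.
move=> bl f; have [K _ KP] := weak_solution_exists robin_Phi_elliptic bl.
have := @solution_boundary_problem _ _ Omega sigma L gammaD sigmaP L_Linfty gammaDP iR
  lambda (riesz p f).
by rewrite PhiTheta_iR -data_riesz; apply; exact: (KP f).1.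
Qed.

Lemma trace_affine_bounded b lambda (S : H12 -> H1) (a c : C) : elliptic b -> regular b lambda ->
  (forall f, weak b lambda (S f) (data f)) ->
  bounded_linear (fun f => a *: gammaD (S f) + c *: f).
Proof.
move=> be bl SP; have [M M0 GM] := trace_hnorm_bound; apply/(bounded_linearP p).
exact: (affine_trace H1_def H1_cpl J_lin J_le gammaD_lin GM M0 a c be bl SP).
Qed.

Local Notation Kmap lambda :=
  (fun f => Nmap L gammaD Theta0 lambda (riesz p f) - 'i%C *: f).
Local Notation Kinv lambda := (fun f => gammaD (robin_solution lambda f) + 'i%C *: f).

Lemma neumann_minus_i_bounded lambda : regular PhiL lambda -> bounded_linear (Kmap lambda).
Proof.
move=> bl; have := trace_affine_bounded 1 (- 'i%C) Phi_ell bl (neumann_solutionP bl).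
by under eq_fun do rewrite scale1r scaleNr.
Qed.

Lemma neumann_minus_i_inverse_bounded lambda : regular PhiR lambda ->
  bounded_linear (Kinv lambda).
Proof.
move=> bl; have := trace_affine_bounded 1 ('i%C) robin_Phi_elliptic bl (robin_solutionP bl).
by under eq_fun do rewrite scale1r.
Qed.

Lemma neumann_minus_iK lambda : regular PhiL lambda -> regular PhiR lambda ->
  cancel (Kinv lambda) (Kmap lambda) /\ cancel (Kmap lambda) (Kinv lambda).
Proof.
move=> b0 b1; have [M M0 GM] := trace_hnorm_bound; split.
  exact: (robin_rightK H1_def H1_cpl J_lin J_le gammaD_lin Phi_ell
    (neumann_solutionP b0) b0 (robin_solutionP b1)).
exact: (robin_leftK H1_def H1_cpl J_lin J_le gammaD_lin GM Phi_ell
  (neumann_solutionP b0) b1 (robin_solutionP b1)).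
Qed.

Lemma neumann_minus_i_invertible lambda : regular PhiL lambda ->
  invertible (Kmap lambda) <-> regular PhiR lambda.
Proof.
move=> b0; split=> [[_ [K' [/(bounded_linearP p)[_ [c _ cP]] h1 h2]]]|b1].
  have [M M0 GM] := trace_hnorm_bound.
  exact: (robin_regular H1_def H1_cpl J_lin J_le gammaD_lin GM M0 Phi_ell
    (neumann_solutionP b0) b0 cP h1 h2).
split; first exact: neumann_minus_i_bounded.
have [h1 h2] := neumann_minus_iK b0 b1.
by exists (Kinv lambda); split => //; exact: neumann_minus_i_inverse_bounded.
Qed.

Lemma W0_eq lambda : regular PhiL lambda -> regular PhiR lambda ->
  forall f, W0 L gammaD p lambda f =
    (2 * 'i%C) *: Nmap L gammaD iR lambda (riesz p f) - f.
Proof.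
move=> b0 b1 f; have [h1 h2] := neumann_minus_iK b0 b1.
rewrite /W0; set h := inverse _ f.
(* [inverse] selects some preimage: the right inverse shows that one exists, the left inverse that
   it is [Kinv lambda f]. *)
have Kh : Kmap lambda h = f.
  apply: (@xgetPex _ 0 [set h | Kmap lambda h = f]).
  by exists (Kinv lambda f); exact: h1.
have hE : h = Kinv lambda f by rewrite -Kh h2.
have -> : Nmap L gammaD Theta0 lambda (riesz p h) = f + 'i%C *: h by rewrite -[X in X + _]Kh subrK.
by rewrite hE; exact: cayley_identity.
Qed.

(** This is the continuation W; it refers only to the i R problem. *)
Definition cayley lambda f : H12 := (2 * 'i%C) *: Nmap L gammaD iR lambda (riesz p f) - f.

Lemma cayley_bounded lambda : regular PhiR lambda -> bounded_linear (cayley lambda).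
Proof.
move=> bl; have := trace_affine_bounded (2 * 'i%C) (-1) robin_Phi_elliptic bl (robin_solutionP bl).
by under eq_fun do rewrite scaleN1r.
Qed.

Lemma cayley_analytic : analytic_on (resolvent_set (LTheta L gammaD iR)) cayley.
Proof.
split=> [z /robin_resolventP rz|z /robin_resolventP rz].
  have [r r0 rP] := resolvent_open H1_def H1_cpl J_lin J_le robin_Phi_elliptic rz.
  by exists r => // w /rP /robin_resolventP.
split; first exact: cayley_bounded.
have [M M0 GM] := trace_hnorm_bound.
have [D [Dl DN DP]] := affine_trace_derivative H1_def H1_cpl J_lin J_le gammaD_lin GM M0
  (2 * 'i%C) robin_Phi_elliptic rz (robin_solutionP rz).
exists D; first exact/(bounded_linearP p).
move=> e e0; have [c1 c10 c1P] := H12_norm_le p; have [c2 c20 c2P] := le_H12_norm p.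
(* The factor c1 c2 pays for passing from the Sobolev norm to the Hilbert norm and back. *)
have e'0 : 0 < e / (c1 * c2) by rewrite divr_gt0// mulr_gt0.
have [r r0 rP] := DP _ e'0; exists r => // w /robin_resolventP rw wz f.
have h := rP w wz f _ (robin_solutionP rw f).
apply: le_trans (c1P _) _; apply: le_trans (ler_wpM2l (ltW c10) h) _.
apply: (@le_trans _ _ (c1 * (e / (c1 * c2) * normc (w - z) * (c2 * H12_norm f)))).
  rewrite ler_pM2l// ler_wpM2l//.
  by rewrite mulr_ge0 ?normc_ge0// ltW.
by rewrite le_eqVlt; apply/orP; left; apply/eqP; field; rewrite !gt_eqF.
Qed.

(** One function u solves both problems: R_{iR,Theta} yields exactly the Theta-datum of u, and the
    Theta-problem with this datum returns u. So N_Theta R_{iR,Theta} R f is the trace of u. *)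
Lemma cayley_robin Theta : bounded_linear_dual Theta ->
  elliptic_form (PhiTheta L gammaD Theta) -> forall lambda,
  resolvent_set (LTheta L gammaD iR) lambda -> resolvent_set (LTheta L gammaD Theta) lambda ->
  forall f,
    cayley lambda f = - riesz_inv p (Rmap L gammaD Theta (fun h => - iR h) lambda
                    (Rmap L gammaD iR Theta lambda (riesz p f))) /\
    cayley lambda f = (2 * 'i%C) *: Nmap L gammaD Theta lambda
                (Rmap L gammaD iR Theta lambda (riesz p f)) - f.
Proof.
move=> Tb Te lambda /robin_resolventP r1 r2 f.
have el := elliptic_formP gammaDP Tb Phi_ell Te.
have {}r2 := (resolvent_setP sigmaP L_Linfty gammaDP lambda el).1 r2.
set u := robin_solution lambda f.
have [phi cphi phiE] : boundary_problem L gammaD iR lambda (riesz p f) u.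
  apply/(boundary_problemP sigmaP L_Linfty gammaDP); rewrite PhiTheta_iR -data_riesz.
  exact: robin_solutionP.
have cd := conormal_derivativeP sigmaP L_Linfty gammaDP cphi.
have RE : Rmap L gammaD iR Theta lambda (riesz p f) = phi + Theta (gammaD u).
  by rewrite /Rmap -/(robin_solution lambda f) -/u cd.
have uT : boundary_problem L gammaD Theta lambda (phi + Theta (gammaD u)) u by exists phi.
move/(boundary_problemP sigmaP L_Linfty gammaDP) in uT.
have sT : solution L gammaD Theta lambda (phi + Theta (gammaD u)) = u.
  apply: (weak_sol_unique H1_def H1_cpl J_lin J_le el r2 _ uT).
  by apply: solution_boundary_problem => //; exists u.
rewrite RE /Nmap /Rmap sT cd; split=> //.
(* Since phi + i R gamma_D u = R f, subtracting 2 i R gamma_D u leaves an element of the range of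
   R. *)
have -> : phi - iR (gammaD u) = riesz p (f - (2 * 'i%C) *: gammaD u).
  rewrite (linear_toB (riesz_lin p)) (linear_toZ (riesz_lin p)) -phiE /iriesz.
  by rewrite -scalerA scaler_nat mulr2n opprD addrA addrK.
by rewrite riesz_invK opprB.
Qed.

End main_argument.

Theorem theorem7p1 (R : realType) (n : nat)
    (Omega : bounded_lipschitz_domain R n)
    (sigma : {finite_measure set 'rV[R]_n.+1 -> \bar R})
    (sigmaP : is_surface_measure Omega sigma)
    (p : H12_inner_product sigma)
    (L : coefficients)
    (L_Linfty : Linfty_coefficients Omega L)
    (L_elliptic : uniformly_elliptic Omega L)
    (gammaD : H1 Omega -> H12 sigma)
    (gammaDP : is_dirichlet_trace gammaD) :
  let Theta0 : H12 sigma -> Hm12 sigma := fun=> 0 in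
  let rho (Theta : H12 sigma -> Hm12 sigma) : set R[i] :=
    resolvent_set (LTheta L gammaD Theta) in
  let iR := iriesz p in
  (forall lambda, rho Theta0 lambda ->
     (invertible (fun f => Nmap L gammaD Theta0 lambda (riesz p f) - 'i%C *: f)
      <-> rho iR lambda)) /\
  (forall lambda, rho Theta0 lambda -> rho iR lambda ->
     bounded_linear (W0 L gammaD p lambda) /\
     forall f, W0 L gammaD p lambda f =
       (2 * 'i%C) *: Nmap L gammaD iR lambda (riesz p f) - f) /\
  exists W : R[i] -> H12 sigma -> H12 sigma,
    [/\ analytic_on (rho iR) W,
        forall lambda, rho Theta0 lambda -> rho iR lambda ->
          W lambda = W0 L gammaD p lambda &
        forall Theta : H12 sigma -> Hm12 sigma,
          bounded_linear_dual Theta ->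
          elliptic_form (PhiTheta L gammaD Theta) ->
          forall lambda, rho iR lambda -> rho Theta lambda ->
          forall f,
            W lambda f =
              - riesz_inv p
                  (Rmap L gammaD Theta (fun h => - iR h) lambda
                    (Rmap L gammaD iR Theta lambda (riesz p f))) /\
            W lambda f =
              (2 * 'i%C) *: Nmap L gammaD Theta lambda
                (Rmap L gammaD iR Theta lambda (riesz p f)) - f].

Proof.
move=> Theta0 rho iR.
split=> [lambda /(neumann_resolventP sigmaP L_Linfty L_elliptic gammaDP) r0|].
  split=> [/(neumann_minus_i_invertible p sigmaP L_Linfty L_elliptic gammaDP r0) h|].
    exact/(robin_resolventP p sigmaP L_Linfty L_elliptic gammaDP).
  move=> /(robin_resolventP p sigmaP L_Linfty L_elliptic gammaDP).
  exact: (neumann_minus_i_invertible p sigmaP L_Linfty L_elliptic gammaDP r0).2.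
have W0_cayley lambda : rho Theta0 lambda -> rho iR lambda ->
    W0 L gammaD p lambda = cayley L gammaD p lambda.
  move=> /(neumann_resolventP sigmaP L_Linfty L_elliptic gammaDP) r0.
  move=> /(robin_resolventP p sigmaP L_Linfty L_elliptic gammaDP) r1.
  by apply/funext => f; exact: (W0_eq sigmaP L_Linfty L_elliptic gammaDP r0 r1).
split=> [lambda r0 r1|].
  rewrite (W0_cayley _ r0 r1); split=> //.
  move/(robin_resolventP p sigmaP L_Linfty L_elliptic gammaDP) in r1.
  exact: (cayley_bounded sigmaP L_Linfty L_elliptic gammaDP r1).
exists (cayley L gammaD p); split.
- exact: (cayley_analytic p sigmaP L_Linfty L_elliptic gammaDP).
- by move=> lambda r0 r1; rewrite W0_cayley.
- move=> Theta Tb Te lambda r1 r2 f.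
  exact: (cayley_robin sigmaP L_Linfty L_elliptic gammaDP Tb Te r1 r2).
Qed.
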